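(* For ranked pairs with any feasible tie-breaking functions, the bribery problem is in FPT with respect to the parameter ''number of candidates'', in both the succinct and nonsuccinct input models, for both constructive and destructive bribery, and in both the nonunique-winner model and the unique-winner model.
   Context: An election consists of a finite candidate set $C$ and a collection $V$ of voters, each casting a tie-free linear order over $C$. The weighted majority graph (WMG) has, for each ordered pair of distinct candidates $(c,d)$, an edge of weight $D(c,d)$ = (number of voters preferring $c$ to $d$) minus (number preferring $d$ to $c$). Ranked pairs is parameterized by two feasible tie-breaking functions: a polynomial-time computable linear order on candidates, and a polynomial-time computable linear order on unordered pairs of candidates. The procedure repeatedly considers the unordered pair $\{a,b\}$ (not yet considered) whose larger edge weight $\max(D(a,b),D(b,a))$ is greatest, ties among pairs broken by the pair order. If the relative order of $a,b$ is already implied (transitively) by the orderings fixed so far, the pair is discarded; otherwise the one with the positive edge is fixed above the other (if both edges are $0$, the candidate tie-breaking order decides). When a linear order is complete, its top candidate is the (unique) winner. Bribery problem: given $C$, $V$, a distinguished $p\in C$, and a nonnegative integer $k$, can the votes of at most $k$ voters be changed so that $p$ is a winner (constructive) / is not a winner (destructive)? In the unique-winner model ''a winner'' is replaced by ''the unique winner''. Nonsuccinct input: each vote listed separately; succinct: each distinct vote listed once with its multiplicity in binary. FPT with respect to a parameter: solvable in time $f(j)\cdot I^{O(1)}$ with $j$ the parameter value, $f$ computable, $I$ the input size. *)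

(* Defs.v *)
From mathcomp Require Import all_boot all_order all_algebra.
Set Implicit Arguments. Unset Strict Implicit. Unset Printing Implicit Defensive.
Import Order.TTheory GRing.Theory Num.Theory.

(* 1. Machine model: unit-cost RAM with addition, truncated subtraction,     *)
(*    constants, indirect addressing and conditional jumps (no              *)
(*    multiplication).  This model is polynomially equivalent to Turing     *)
(*    machines (Cook--Reckhow), so "polynomial time" / "f(k)*poly" are the   *)
(*    usual notions.                                                        *)

Inductive instr : Type :=
| IConst of nat & nat
| IAdd of nat & nat & nat
| ISub of nat & nat & nat
| ILoad of nat & nat
| IStore of nat & nat
| IJz of nat & nat
| IHalt.                     (* halt (also: pc outside the program)       *)

Definition program := seq instr.
Definition memory := nat -> nat.
Definition state : Type := (nat * memory)%type.

Definition upd (m : memory) (r v : nat) : memory :=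
  fun i => if i == r then v else m i.

Definition step (P : program) (s : state) : state :=
  let: (pc, m) := s in
  match nth IHalt P pc with
  | IConst r c => (pc.+1, upd m r c)
  | IAdd d a b => (pc.+1, upd m d (m a + m b))
  | ISub d a b => (pc.+1, upd m d (m a - m b))
  | ILoad d a => (pc.+1, upd m d (m (m a)))
  | IStore a x => (pc.+1, upd m (m a) (m x))
  | IJz r t => if m r == 0 then (t, m) else (pc.+1, m)
  | IHalt => (pc, m)
  end.

Definition halted (P : program) (s : state) : bool :=
  match nth IHalt P s.1 with IHalt => true | _ => false end.

Definition exec (P : program) (t : nat) (s : state) : state := iter t (step P) s.

Definition init (x : seq nat) : state :=
  (0, fun i => if i == 0 then size x else nth 0 x i.-1).

Definition output (s : state) : seq nat := [seq s.2 i.+1 | i <- iota 0 (s.2 0)].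

Definition accepts (s : state) : bool := s.2 0 != 0.

Definition bits (n : nat) : nat := (trunc_log 2 n).+1.
Definition enc_size (x : seq nat) : nat := (sumn [seq bits n | n <- x]).+1.

Definition computable_fun (f : nat -> nat) : Prop :=
  exists P : program, forall j : nat, exists t : nat,
    halted P (exec P t (init [:: j])) /\ output (exec P t (init [:: j])) = [:: f j].

Definition poly_time_computable (dom : seq nat -> Prop)
    (F : seq nat -> seq nat) : Prop :=
  exists (P : program) (c : nat), forall x, dom x ->
    let s := exec P (c * enc_size x ^ c + c) (init x) in
    halted P s /\ output s = F x.

Definition FPT (I : Type) (wf : I -> Prop) (enc : I -> seq nat)
    (kappa : I -> nat) (yes : I -> Prop) : Prop :=
  exists (P : program) (f : nat -> nat) (c : nat),
    computable_fun f /\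
    forall inst : I, wf inst ->
      let x := enc inst in
      let s := exec P (f (kappa inst) * enc_size x ^ c) (init x) in
      halted P s /\ (accepts s <-> yes inst).

(* Candidates are named by natural numbers; the candidate set C is a
   duplicate-free list.  A vote is a list of the candidates of C, most
   preferred first (a tie-free linear order over C). *)
Definition is_vote (C v : seq nat) : bool := perm_eq v C.

Definition prefers (v : seq nat) (c d : nat) : bool := index c v < index d v.

Definition D (V : seq (seq nat)) (c d : nat) : int :=
  (count (fun v => prefers v c d) V)%:Z - (count (fun v => prefers v d c) V)%:Z.

(* Tie-breaking functions: given the candidate set C,
   - tbc C : a linear order on C (list, earlier = preferred),
   - tbp C : a linear order on the unordered pairs of distinct candidates of C
             (list, earlier = considered first); each unordered pair {a,b}
             appears exactly once, as (a,b) or (b,a). *)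
Definition upair (q : nat * nat) : nat * nat := (minn q.1 q.2, maxn q.1 q.2).
Definition cpairs (C : seq nat) : seq (nat * nat) :=
  [seq (a, b) | a <- C, b <- [seq b <- C | a < b]].

Definition valid_tbc (tbc : seq nat -> seq nat) : Prop :=
  forall C : seq nat, uniq C -> perm_eq (tbc C) C.

Definition valid_tbp (tbp : seq nat -> seq (nat * nat)) : Prop :=
  forall C : seq nat, uniq C -> perm_eq [seq upair q | q <- tbp C] (cpairs C).

Definition feasible_tbc (tbc : seq nat -> seq nat) : Prop :=
  poly_time_computable (fun C => uniq C) tbc.

Definition feasible_tbp (tbp : seq nat -> seq (nat * nat)) : Prop :=
  poly_time_computable (fun C => uniq C)
    (fun C => flatten [seq [:: q.1; q.2] | q <- tbp C]).

(* Transitive closure of the fixed orderings R ((x,y) : x fixed above y). *)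
Definition succs (R : seq (nat * nat)) (S : seq nat) : seq nat :=
  S ++ [seq e.2 | e <- R & e.1 \in S].
(* candidates reachable from x (including x); simple paths have <= size R edges *)
Definition reachable (R : seq (nat * nat)) (x : nat) : seq nat :=
  iter (size R) (succs R) [:: x].
Definition implied (R : seq (nat * nat)) (a b : nat) : bool :=
  (b \in reachable R a) || (a \in reachable R b).

Section RankedPairs.
Variables (tbc : seq nat -> seq nat) (tbp : seq nat -> seq (nat * nat)).
Variables (C : seq nat) (V : seq (seq nat)).

Definition rp_weight (q : nat * nat) : int := Num.max (D V q.1 q.2) (D V q.2 q.1).
Definition rp_rank (q : nat * nat) : nat :=
  index (upair q) [seq upair r | r <- tbp C].

Definition rp_pairs : seq (nat * nat) :=
  sort (fun q r => (rp_weight r < rp_weight q)%R ||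
                   ((rp_weight r == rp_weight q) && (rp_rank q <= rp_rank r)))
       (tbp C).

Definition rp_orient (q : nat * nat) : nat * nat :=
  let: (a, b) := q in
  if (0 < D V a b)%R then (a, b)
  else if (0 < D V b a)%R then (b, a)
  else if index a (tbc C) < index b (tbc C) then (a, b) else (b, a).

Definition rp_step (R : seq (nat * nat)) (q : nat * nat) : seq (nat * nat) :=
  if implied R q.1 q.2 then R else rp_orient q :: R.

Definition rp_fixed : seq (nat * nat) := foldl rp_step [::] rp_pairs.

Definition rp_winners : seq nat :=
  [seq c <- C | all (fun d => (d == c) || (d \in reachable rp_fixed c)) C].

End RankedPairs.

Definition bribed (C : seq nat) (k : nat) (V V' : seq (seq nat)) : Prop :=
  [/\ size V' = size V, all (is_vote C) V' &
      count id [seq u.1 != u.2 | u <- zip V V'] <= k].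

Definition win_pred (unique : bool) (W : seq nat) (p : nat) : bool :=
  if unique then W == [:: p] else p \in W.

Definition bribery_yes tbc tbp (constructive unique : bool)
    (C : seq nat) (V : seq (seq nat)) (p k : nat) : Prop :=
  exists V' : seq (seq nat), bribed C k V V' /\
    (if constructive then win_pred unique (rp_winners tbc tbp C V') p
     else ~~ win_pred unique (rp_winners tbc tbp C V') p).

Record ns_inst := NSInst {
  ns_C : seq nat; ns_V : seq (seq nat); ns_p : nat; ns_k : nat }.

Definition ns_wf (I : ns_inst) : Prop :=
  [/\ uniq (ns_C I), ns_p I \in ns_C I & all (is_vote (ns_C I)) (ns_V I)].

Definition ns_enc (I : ns_inst) : seq nat :=
  [:: size (ns_C I)] ++ ns_C I ++ [:: ns_p I; ns_k I; size (ns_V I)] ++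
  flatten (ns_V I).

Definition ns_yes tbc tbp constructive unique (I : ns_inst) : Prop :=
  bribery_yes tbc tbp constructive unique (ns_C I) (ns_V I) (ns_p I) (ns_k I).

(* Succinct instances: each distinct vote once, with its multiplicity
   (in binary, since numbers are measured by their bit length). *)
Record s_inst := SInst {
  s_C : seq nat; s_V : seq (seq nat * nat); s_p : nat; s_k : nat }.

Definition s_wf (I : s_inst) : Prop :=
  [/\ uniq (s_C I), s_p I \in s_C I, all (is_vote (s_C I)) (map fst (s_V I)),
      uniq (map fst (s_V I)) & all (fun vm => 0 < vm.2) (s_V I)].

Definition s_enc (I : s_inst) : seq nat :=
  [:: size (s_C I)] ++ s_C I ++ [:: s_p I; s_k I; size (s_V I)] ++
  flatten [seq vm.1 ++ [:: vm.2] | vm <- s_V I].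

Definition s_voters (I : s_inst) : seq (seq nat) :=
  flatten [seq nseq vm.2 vm.1 | vm <- s_V I].

Definition s_yes tbc tbp constructive unique (I : s_inst) : Prop :=
  bribery_yes tbc tbp constructive unique (s_C I) (s_voters I) (s_p I) (s_k I).

(* Main.v *)
Require Import Defs.
From mathcomp Require Import all_boot all_order all_algebra zify.
Set Implicit Arguments. Unset Strict Implicit. Unset Printing Implicit Defensive.

(** The ranked pairs winner depends on a profile only through the order of the
    numbers [D a b], so a bribery is described by the numbers of voters moving
    from vote [u] to vote [w], subject to sign conditions on linear forms whose
    coefficients are bounded in terms of the number [m] of candidates.  Such
    conditions are decided digit by digit: reading the binary digits of the vote
    counts and of [k] from the most significant one and guessing those of the
    moves, a form with value [s] passes to [2 s + O(B)], so values outside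
    [[-B, B]] keep their sign and may be clipped.  The set of reachable clipped
    states is updated by a function of [m], the set and the digits read that is
    primitive recursive, hence computable in time depending on [m] only.  The
    remaining work (translating candidates into indices, extracting digits and
    running the two tie-breaking programs) is polynomial. *)

(** * Executions of the machine *)

Arguments exec : simpl never.
Arguments iteri : simpl never.

(** The time bound must be [f(m)] times a polynomial, although codes of lists are huge in terms of
    [m] and vote counts may be exponential in the input length. Under unit-cost arithmetic the size
    of numbers is harmless; only loop counts matter. Let [Y] be [G m] times the input length, where
    [G] bounds the cost of all calls of pure functions. Every loop runs at most [Y] times, so each
    fixed expression costs at most a fixed power of [Y], and [Y ^ d] splits into [G m ^ d] and a
    power of the input length. For [G] to be computable, the running time of a pure expression is
    bounded by a function that a pure expression computes again. Memory is the other obstacle. The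
    input initially fills the registers, so the part lying there is first copied beyond the input;
    and the two tie-breaking programs, which may touch arbitrary addresses, run in interleaved
    cells. Numbers of moves come from an actual bribery as soon as the moves out of each vote add up
    exactly to its voters; hence the linear forms labelled by votes have to vanish, not merely be
    nonnegative. *)

Lemma execD P t1 t2 s : exec P (t1 + t2) s = exec P t2 (exec P t1 s).
Proof. by rewrite /exec addnC iterD. Qed.

Lemma exec_halted P t s : halted P s -> exec P t s = s.
Proof.
move=> Hh; elim: t => // t IH; rewrite -addn1 execD IH; move: Hh.
by rewrite /halted /exec /=; case: s {IH} => pc m /=; case: nth.
Qed.

(** A halted state is a fixed point of [step], so stopping within [t] steps determines the state at
    every later time, in particular at the exact time named in [FPT]. *)
Lemma exec_halted_le P t T s : t <= T -> halted P (exec P t s) ->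
  exec P T s = exec P t s.
Proof. by move=> tT Hh; rewrite -(subnKC tT) execD exec_halted. Qed.

(** * Code embedded in a larger program *)

Definition code_at (P : program) (pc : nat) (c : seq instr) :=
  forall i, i < size c -> nth IHalt P (pc + i) = nth IHalt c i.

Lemma code_at_cat P pc c1 c2 :
  code_at P pc (c1 ++ c2) <-> code_at P pc c1 /\ code_at P (pc + size c1) c2.
Proof.
split=> [H|[H1 H2] i].
  split=> i Hi; first by rewrite H ?size_cat ?nth_cat ?Hi //; lia.
  by rewrite -addnA H ?size_cat ?nth_cat ?ltn_add2l // ltnNge leq_addr addKn.
rewrite size_cat nth_cat => Hi; case: ltnP => Hc; first exact: H1.
rewrite -H2; last by lia.
by congr nth; lia.
Qed.

Lemma code_at_cons P pc i c :
  code_at P pc (i :: c) <-> nth IHalt P pc = i /\ code_at P pc.+1 c.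
Proof.
rewrite -cat1s code_at_cat addn1; split=> -[H1 H2]; split=> //.
  by have := H1 0 isT; rewrite addn0.
by case=> // _; rewrite addn0.
Qed.

Definition straight_instr (i : instr) (m : memory) : memory :=
  match i with
  | IConst r c => upd m r c
  | IAdd d a b => upd m d (m a + m b)
  | ISub d a b => upd m d (m a - m b)
  | ILoad d a => upd m d (m (m a))
  | IStore a x => upd m (m a) (m x)
  | _ => m
  end.

Definition is_straight (i : instr) : bool :=
  match i with IJz _ _ | IHalt => false | _ => true end.

Definition straight (c : seq instr) (m : memory) : memory :=
  foldl (fun m i => straight_instr i m) m c.

Lemma straight_cat c1 c2 m : straight (c1 ++ c2) m = straight c2 (straight c1 m).
Proof. by rewrite /straight foldl_cat. Qed.

Lemma exec_straight P pc c m : all is_straight c -> code_at P pc c ->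
  exec P (size c) (pc, m) = (pc + size c, straight c m).
Proof.
elim: c pc m => [|i c IH] pc m /=; first by rewrite addn0.
case/andP=> Hi Hc /code_at_cons [Hpc Hat].
rewrite -[(size c).+1]add1n execD addnA addn1 -IH //; congr (exec _ _ _).
by rewrite /exec /= Hpc; case: i Hi {Hpc}.
Qed.

Lemma exec_jz P pc r t m : nth IHalt P pc = IJz r t ->
  exec P 1 (pc, m) = (if m r == 0 then t else pc.+1, m).
Proof. by move=> H; rewrite /exec /= H; case: eqP. Qed.

(** The only jump is conditional, so a scratch register is cleared just before it is tested. *)
Definition jump (r t : nat) : seq instr := [:: IConst r 0; IJz r t].

Lemma exec_jump P pc r t m : code_at P pc (jump r t) ->
  exec P 2 (pc, m) = (t, upd m r 0).
Proof.
rewrite /jump -cat1s => /code_at_cat [H1 H2].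
rewrite -[2]/(1 + 1) execD (@exec_straight P pc [:: IConst r 0]) //= addn1.
rewrite (@exec_jz P _ r t) /upd /= ?eqxx //.
by move: H2 => /code_at_cons []; rewrite addn1.
Qed.

(** Copying is clearing followed by addition, hence correct only when [d] and [s] differ. *)
Definition move (d s : nat) : seq instr := [:: IConst d 0; IAdd d d s].

(** * A language of arithmetic expressions compiled to the machine *)

(* Variables are de Bruijn indices.  [Glb i] is machine register [i], and
   [Read a] the memory cell [K + a], where the [K] lowest cells are
   the registers.  [App2 f a b] evaluates [f] in the two-variable
   environment given by [a] and [b]; in [Rec n b s] the step [s] sees the
   accumulator as variable 0 and the loop index as variable 1. *)
Inductive expr : Type :=
| Var of nat
| Cst of nat
| Glb of nat
| Read of expr
| Add of expr & expr
| Sub of expr & expr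
| Ite of expr & expr & expr
| Let of expr & expr
| App2 of expr & expr & expr
| Rec of expr & expr & expr
| Lg of expr.

(** Unlike [bits], this vanishes at 0, which makes the equivalence [lgP] hold for every number. *)
Definition lg (n : nat) : nat := if n == 0 then 0 else bits n.

Section Semantics.
Variable K : nat.

Fixpoint eval (M : memory) (e : expr) (env : seq nat) : nat :=
  match e with
  | Var i => nth 0 env i
  | Cst c => c
  | Glb i => M i
  | Read a => M (K + eval M a env)
  | Add a b => eval M a env + eval M b env
  | Sub a b => eval M a env - eval M b env
  | Ite c a b => if eval M c env == 0 then eval M b env else eval M a env
  | Let a b => eval M b (eval M a env :: env)
  | App2 f a b => eval M f [:: eval M a env; eval M b env]
  | Rec n b s =>
      iteri (eval M n env) (fun i acc => eval M s [:: acc, i & env]) (eval M b env)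
  | Lg a => lg (eval M a env)
  end.

(** The constants count the instructions that [comp] puts around the subexpressions: a round of
    [Rec] adds 2 for the test, 4 for the update and 2 for the jump back, and a round of [Lg] also
    takes 8. *)
Fixpoint cost (M : memory) (e : expr) (env : seq nat) : nat :=
  match e with
  | Var i => 2
  | Cst c => 1
  | Glb i => 2
  | Read a => cost M a env + 3
  | Add a b | Sub a b => cost M a env + cost M b env + 1
  | Ite c a b => cost M c env + 3 +
      (if eval M c env == 0 then cost M b env else cost M a env)
  | Let a b => cost M a env + cost M b (eval M a env :: env) + 2
  | App2 f a b => cost M a env + cost M b env +
      cost M f [:: eval M a env; eval M b env] + 2
  | Rec n b s => cost M n env + cost M b env + 5 +
      \sum_(i < eval M n env)
        (cost M s [:: iteri i (fun i acc => eval M s [:: acc, i & env])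
                        (eval M b env), val i & env] + 8)
  | Lg a => cost M a env + 8 + lg (eval M a env) * 8
  end.

Fixpoint wf (g n : nat) (e : expr) : bool :=
  match e with
  | Var i => i < n
  | Cst _ => true
  | Glb i => i < g
  | Read a | Lg a => wf g n a
  | Add a b | Sub a b => wf g n a && wf g n b
  | Ite c a b => [&& wf g n c, wf g n a & wf g n b]
  | Let a b => wf g n a && wf g n.+1 b
  | App2 f a b => [&& wf g 2 f, wf g n a & wf g n b]
  | Rec c b s => [&& wf g n c, wf g n b & wf g n.+2 s]
  end.

Fixpoint regs (e : expr) : nat :=
  match e with
  | Var _ | Cst _ | Glb _ => 1
  | Read a => 2 + regs a
  | Add a b | Sub a b => 1 + (regs a + regs b)
  | Ite c a b => 2 + (regs c + regs a + regs b)
  | Let a b => 1 + (regs a + regs b)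
  | App2 f a b => 2 + (regs f + regs a + regs b)
  | Rec c b s => 4 + (regs c + regs b + regs s)
  | Lg a => 5 + regs a
  end.

(* The result goes to register [d]; registers [>= d] are scratch, variable
   [i] sits in register [nth 0 rho i], and [pc] is the address of the code. *)
Fixpoint comp (e : expr) (rho : seq nat) (d pc : nat) : seq instr :=
  match e with
  | Var i => move d (nth 0 rho i)
  | Cst c => [:: IConst d c]
  | Glb i => move d i
  | Read a => comp a rho d pc ++ [:: IConst d.+1 K; IAdd d d d.+1; ILoad d d]
  | Add a b =>
      let ca := comp a rho d pc in
      ca ++ comp b rho d.+1 (pc + size ca) ++ [:: IAdd d d d.+1]
  | Sub a b =>
      let ca := comp a rho d pc in
      ca ++ comp b rho d.+1 (pc + size ca) ++ [:: ISub d d d.+1]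
  | Ite c a b =>
      let cc := comp c rho d pc in
      let pa := pc + size cc + 1 in
      let ca := comp a rho d pa in
      let pb := pa + size ca + 2 in
      let cb := comp b rho d pb in
      cc ++ [:: IJz d pb] ++ ca ++ jump d.+1 (pb + size cb) ++ cb
  | Let a b =>
      let ca := comp a rho d pc in
      ca ++ comp b (d :: rho) d.+1 (pc + size ca) ++ move d d.+1
  | App2 f a b =>
      let ca := comp a rho d pc in
      let cb := comp b rho d.+1 (pc + size ca) in
      ca ++ cb ++ comp f [:: d; d.+1] d.+2 (pc + size ca + size cb) ++ move d d.+2
  | Rec n b s =>
      let cn := comp n rho d pc in
      let pb := pc + size cn + 1 in
      let cb := comp b rho d.+2 pb in
      let pl := pb + size cb in
      let cs := comp s [:: d.+2, d.+1 & rho] d.+3 (pl + 2) in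
      cn ++ [:: IConst d.+1 0] ++ cb ++
      [:: ISub d.+3 d d.+1; IJz d.+3 (pl + 2 + size cs + 6)] ++ cs ++
      (move d.+2 d.+3 ++ [:: IConst d.+3 1; IAdd d.+1 d.+1 d.+3]) ++
      jump d.+3 pl ++ move d d.+2
  | Lg a =>
      let ca := comp a rho d pc in
      let pl := pc + size ca + 2 in
      ca ++ [:: IConst d.+1 1; IConst d.+2 0] ++
      [:: IConst d.+3 1; IAdd d.+4 d d.+3; ISub d.+4 d.+4 d.+1] ++
      [:: IJz d.+4 (pl + 8)] ++
      [:: IAdd d.+1 d.+1 d.+1; IAdd d.+2 d.+2 d.+3] ++
      jump d.+3 pl ++ move d d.+2
  end.

(** Exactly what an expression can observe: the global registers below [g] and the cells from [K]
    on. The registers in between are scratch space. *)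
Definition agree (g : nat) (M M' : memory) :=
  forall i, (i < g) || (K <= i) -> M i = M' i.

Lemma eval_agree g M M' n e env : agree g M M' -> wf g n e ->
  eval M e env = eval M' e env.
Proof.
move=> HM; elim: e n env => //=.
- by move=> i _ _ Hi; apply: HM; rewrite Hi.
- by move=> a IHa n env Ha; rewrite (IHa n) // HM // leq_addr orbT.
- by move=> a IHa b IHb n env /andP[Ha Hb]; rewrite (IHa n) // (IHb n).
- by move=> a IHa b IHb n env /andP[Ha Hb]; rewrite (IHa n) // (IHb n).
- by move=> c IHc a IHa b IHb n env /and3P[Hc Ha Hb]; rewrite (IHc n) // (IHa n) // (IHb n).
- by move=> a IHa b IHb n env /andP[Ha Hb]; rewrite (IHa n) // (IHb n.+1).
- by move=> f IHf a IHa b IHb n env /and3P[Hf Ha Hb]; rewrite (IHa n) // (IHb n) // (IHf 2).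
- move=> c IHc b IHb s IHs n env /and3P[Hc Hb Hs]; rewrite (IHc n) // (IHb n) //.
  by apply: eq_iteri => i x; rewrite (IHs n.+2).
- by move=> a IHa n env Ha; rewrite (IHa n).
Qed.

Lemma cost_agree g M M' n e env : agree g M M' -> wf g n e ->
  cost M e env = cost M' e env.
Proof.
move=> HM; elim: e n env => //=.
- by move=> a IHa n env Ha; rewrite (IHa n).
- by move=> a IHa b IHb n env /andP[Ha Hb]; rewrite (IHa n) // (IHb n).
- by move=> a IHa b IHb n env /andP[Ha Hb]; rewrite (IHa n) // (IHb n).
- move=> c IHc a IHa b IHb n env /and3P[Hc Ha Hb].
  by rewrite (IHc n) // (IHa n) // (IHb n) // (eval_agree _ HM Hc).
- move=> a IHa b IHb n env /andP[Ha Hb].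
  by rewrite (IHa n) // (IHb n.+1) // (eval_agree _ HM Ha).
- move=> f IHf a IHa b IHb n env /and3P[Hf Ha Hb].
  by rewrite (IHa n) // (IHb n) // (IHf 2) // (eval_agree _ HM Ha) // (eval_agree _ HM Hb).
- move=> c IHc b IHb s IHs n env /and3P[Hc Hb Hs].
  rewrite (IHc n) // (IHb n) // (eval_agree _ HM Hc); congr (_ + _).
  apply: eq_bigr => i _; rewrite (IHs n.+2) // (eval_agree _ HM Hb).
  by rewrite (eq_iteri (fun i x => eval_agree [:: x, i & env] HM Hs)).
- by move=> a IHa n env Ha; rewrite (IHa n) // (eval_agree _ HM Ha).
Qed.

Definition scratch_eq (d : nat) (m m' : memory) :=
  forall r, (r < d) || (K <= r) -> m' r = m r.

Definition env_in (rho env : seq nat) (m : memory) :=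
  forall i, i < size rho -> m (nth 0 rho i) = nth 0 env i.

(** Only registers from [d] to [K] may change, so an operand compiled with a larger [d] preserves
    the results already stored below it. The address [pc] is arbitrary because jumps are absolute
    and the code is generated for its place. *)
Definition comp_spec (g : nat) (e : expr) : Prop :=
  forall rho d pc P m env, wf g (size rho) e -> size env = size rho ->
    all (fun r => r < d) rho -> g <= d -> d + regs e <= K ->
    code_at P pc (comp e rho d pc) -> env_in rho env m ->
    exists t m', [/\ t <= cost m e env,
      exec P t (pc, m) = (pc + size (comp e rho d pc), m'),
      m' d = eval m e env & scratch_eq d m m'].

Lemma scratch_agree g d m m' : g <= d -> scratch_eq d m m' -> agree g m m'.
Proof. by move=> gd H i Hi; rewrite H //; lia. Qed.

Lemma scratch_trans d d' m m' m'' : d <= d' ->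
  scratch_eq d m m' -> scratch_eq d' m' m'' -> scratch_eq d m m''.
Proof. by move=> dd H1 H2 r Hr; rewrite H2 ?H1 //; lia. Qed.

Lemma env_in_scratch d rho env m m' : all (fun r => r < d) rho ->
  scratch_eq d m m' -> env_in rho env m -> env_in rho env m'.
Proof. by move=> /allP Hd Hm H i Hi; rewrite Hm ?H // Hd ?mem_nth. Qed.

Lemma all_ltnW d d' rho : d <= d' -> all (fun r => r < d) rho ->
  all (fun r => r < d') rho.
Proof. by move=> dd; apply: sub_all => r /leq_trans; apply. Qed.

End Semantics.

Lemma updE m r v i : upd m r v i = if i == r then v else m i.
Proof. by []. Qed.

Lemma upd_eq m r v : upd m r v r = v.
Proof. by rewrite /upd eqxx. Qed.

Lemma upd_neq m r v i : i != r -> upd m r v i = m i.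
Proof. by rewrite /upd => /negPf ->. Qed.

Ltac upd_tac := rewrite /straight /= ?/move /upd /=;
  repeat (case: eqP => ? //=); try lia.

Ltac upd_s := rewrite ?/straight /= ?/upd /=;
  repeat (match goal with |- context [if ?x == ?y then _ else _] =>
    ((have -> : (x == y) = true by lia) || (have -> : (x == y) = false by lia))
  end; rewrite /=).

Section Compilation.
Variables (K g : nat).
Local Notation comp_spec := (comp_spec K g).
Local Notation comp := (comp K).
Local Notation eval := (eval K).
Local Notation cost := (cost K).
Local Notation scratch_eq := (scratch_eq K).

Lemma comp_Var i : comp_spec (Var i).
Proof.
move=> rho d pc P m env /= Hi Hs /allP Hrho gd HK Hat Henv.
have Hr : nth 0 rho i < d by apply: Hrho; rewrite mem_nth.
exists 2, (straight (move d (nth 0 rho i)) m); split=> //.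
- by rewrite (@exec_straight P pc (move d (nth 0 rho i))).
- by rewrite -Henv //; upd_tac.
- by move=> r Hr'; upd_tac.
Qed.

Lemma comp_Cst c : comp_spec (Cst c).
Proof.
move=> rho d pc P m env /= _ Hs /allP Hrho gd HK Hat Henv.
exists 1, (straight [:: IConst d c] m); split=> //.
- by rewrite (@exec_straight P pc [:: IConst d c]).
- by upd_tac.
- by move=> r Hr'; upd_tac.
Qed.

Lemma comp_Glb i : comp_spec (Glb i).
Proof.
move=> rho d pc P m env /= Hi Hs /allP Hrho gd HK Hat Henv.
exists 2, (straight (move d i) m); split=> //.
- by rewrite (@exec_straight P pc (move d i)).
- by upd_tac.
- by move=> r Hr'; upd_tac.
Qed.

Lemma comp_Read a : comp_spec a -> comp_spec (Read a).
Proof.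
move=> IHa rho d pc P m env /= Ha Hs Hrho gd HK /code_at_cat [Hca Hc] Henv.
have [|t [m1 [Ht Hx Hv Hm]]] := IHa rho d pc P m env Ha Hs Hrho gd _ Hca Henv.
  by lia.
pose c := [:: IConst d.+1 K; IAdd d d d.+1; ILoad d d].
exists (t + 3), (straight c m1); split; first by lia.
- by rewrite execD Hx (@exec_straight P _ c) // size_cat addnA.
- have -> : straight c m1 d = m1 (m1 d + K).
    by rewrite /c; upd_s.
  by rewrite Hv addnC Hm // leq_addr orbT.
- move=> r Hr; rewrite -(Hm r Hr) /c; rewrite /straight /= /upd.
  by repeat (case: eqP => ? //=); lia.
Qed.

(** The second operand runs in a memory altered by the first one, but only on scratch registers;
    [eval_agree] and [cost_agree] bring its value and cost back to the initial memory. *)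
Lemma comp_bin2 a b rho d pc P m env : comp_spec a -> comp_spec b ->
  wf g (size rho) a -> wf g (size rho) b -> size env = size rho ->
  all (fun r => r < d) rho -> g <= d ->
  d + regs a <= K -> d.+1 + regs b <= K ->
  let ca := comp a rho d pc in
  let cb := comp b rho d.+1 (pc + size ca) in
  code_at P pc ca -> code_at P (pc + size ca) cb -> env_in rho env m ->
  exists t m', [/\ t <= cost m a env + cost m b env,
      exec P t (pc, m) = (pc + size ca + size cb, m'),
      m' d = eval m a env, m' d.+1 = eval m b env & scratch_eq d m m'].
Proof.
move=> IHa IHb Ha Hb Hs Hrho gd HKa HKb ca cb Hca Hcb Henv.
have [t [m1 [Ht Hx Hv Hm]]] := IHa rho d pc P m env Ha Hs Hrho gd HKa Hca Henv.
have Henv1 := env_in_scratch Hrho Hm Henv.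
have Hrho1 := all_ltnW (leqnSn d) Hrho.
have [|t2 [m2 [Ht2 Hx2 Hv2 Hm2]]] :=
  IHb rho d.+1 _ P m1 env Hb Hs Hrho1 _ HKb Hcb Henv1; first by lia.
have Hag := scratch_agree gd Hm.
rewrite -(cost_agree _ Hag Hb) in Ht2.
rewrite -(eval_agree _ Hag Hb) in Hv2.
exists (t + t2), m2; split=> //; first by lia.
- by rewrite execD Hx Hx2.
- by rewrite Hm2 ?ltnSn.
- exact: scratch_trans (leqnSn d) Hm Hm2.
Qed.

Lemma comp_Add a b : comp_spec a -> comp_spec b -> comp_spec (Add a b).
Proof.
move=> IHa IHb rho d pc P m env /= /andP[Ha Hb] Hs Hrho gd HK.
case/code_at_cat=> Hca /code_at_cat [Hcb Hc] Henv.
have [||t [m2 [Ht Hx Hv1 Hv2 Hm]]] :=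
  comp_bin2 IHa IHb Ha Hb Hs Hrho gd _ _ Hca Hcb Henv; try by lia.
pose c := [:: IAdd d d d.+1].
exists (t + 1), (straight c m2); split; first by lia.
- by rewrite execD Hx (@exec_straight P _ c) // !size_cat !addnA.
- by rewrite /straight /= upd_eq Hv1 Hv2.
- by move=> r Hr; rewrite -(Hm r Hr) /c; upd_tac.
Qed.

Lemma comp_Sub a b : comp_spec a -> comp_spec b -> comp_spec (Sub a b).
Proof.
move=> IHa IHb rho d pc P m env /= /andP[Ha Hb] Hs Hrho gd HK.
case/code_at_cat=> Hca /code_at_cat [Hcb Hc] Henv.
have [||t [m2 [Ht Hx Hv1 Hv2 Hm]]] :=
  comp_bin2 IHa IHb Ha Hb Hs Hrho gd _ _ Hca Hcb Henv; try by lia.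
pose c := [:: ISub d d d.+1].
exists (t + 1), (straight c m2); split; first by lia.
- by rewrite execD Hx (@exec_straight P _ c) // !size_cat !addnA.
- by rewrite /straight /= upd_eq Hv1 Hv2.
- by move=> r Hr; rewrite -(Hm r Hr) /c; upd_tac.
Qed.

Lemma comp_App2 f a b :
  comp_spec f -> comp_spec a -> comp_spec b -> comp_spec (App2 f a b).
Proof.
move=> IHf IHa IHb rho d pc P m env /= /and3P[Hf Ha Hb] Hs Hrho gd HK.
case/code_at_cat=> Hca /code_at_cat [Hcb /code_at_cat [Hcf Hc]] Henv.
have [||t [m2 [Ht Hx Hv1 Hv2 Hm]]] :=
  comp_bin2 IHa IHb Ha Hb Hs Hrho gd _ _ Hca Hcb Henv; try by lia.
have [||||t3 [m3 [Ht3 Hx3 Hv3 Hm3]]] :=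
  IHf [:: d; d.+1] d.+2 _ P m2 [:: eval m a env; eval m b env] Hf erefl
      _ _ _ Hcf _; try by rewrite /= ?leqnn ?leqnSn; lia.
  by move=> [|[|i]].
have Hag := scratch_agree gd Hm.
rewrite -(cost_agree _ Hag Hf) in Ht3.
rewrite -(eval_agree _ Hag Hf) in Hv3.
exists (t + (t3 + 2)), (straight (move d d.+2) m3); split; first by lia.
- by rewrite execD Hx execD Hx3 (@exec_straight P _ (move d d.+2)) // !size_cat !addnA.
- by rewrite -Hv3; upd_tac.
- move=> r Hr; rewrite -(Hm r Hr) -(Hm3 r); last by lia.
  by upd_tac.
Qed.

Lemma comp_Let a b : comp_spec a -> comp_spec b -> comp_spec (Let a b).
Proof.
move=> IHa IHb rho d pc P m env /= /andP[Ha Hb] Hs Hrho gd HK.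
case/code_at_cat=> Hca /code_at_cat [Hcb Hc] Henv.
have [|t [m1 [Ht Hx Hv Hm]]] := IHa rho d pc P m env Ha Hs Hrho gd _ Hca Henv.
  by lia.
have Henv1 := env_in_scratch Hrho Hm Henv.
have [|||||t2 [m2 [Ht2 Hx2 Hv2 Hm2]]] :=
  IHb (d :: rho) d.+1 _ P m1 (eval m a env :: env) Hb _ _ _ _ Hcb _.
- by rewrite /= Hs.
- by rewrite /= ltnSn (all_ltnW (leqnSn d) Hrho).
- by lia.
- by lia.
- by case=> [|i] /=; [rewrite Hv | exact: Henv1].
have Hag := scratch_agree gd Hm.
rewrite -(cost_agree _ Hag Hb) in Ht2.
rewrite -(eval_agree _ Hag Hb) in Hv2.
exists (t + (t2 + 2)), (straight (move d d.+1) m2); split; first by lia.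
- by rewrite execD Hx execD Hx2 (@exec_straight P _ (move d d.+1)) // !size_cat !addnA.
- by rewrite -Hv2; upd_tac.
- move=> r Hr; rewrite -(Hm r Hr) -(Hm2 r); last by lia.
  by upd_tac.
Qed.

Lemma comp_Ite c a b :
  comp_spec c -> comp_spec a -> comp_spec b -> comp_spec (Ite c a b).
Proof.
move=> IHc IHa IHb rho d pc P m env /= /and3P[Hc Ha Hb] Hs Hrho gd HK.
set cc := comp c rho d pc; set pa := pc + size cc + 1.
set ca := comp a rho d pa; set pb := pa + size ca + 2.
set cb := comp b rho d pb.
rewrite -[IJz _ _ :: _]cat1s -[IConst _ _ :: _]/(jump _ _ ++ cb).
case/code_at_cat=> Hcc /code_at_cat [/code_at_cons [Hjz _]].
rewrite -/pa => /code_at_cat [Hca] /code_at_cat [Hj Hcb] Henv.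
rewrite /= -/pb in Hcb.
have [|t [m1 [Ht Hx Hv Hm]]] := IHc rho d pc P m env Hc Hs Hrho gd _ Hcc Henv.
  by lia.
have Henv1 := env_in_scratch Hrho Hm Henv.
have Hag := scratch_agree gd Hm.
have Hend : pc + size (cc ++ [:: IJz d pb] ++ ca ++ jump d.+1 (pb + size cb) ++ cb)
  = pb + size cb.
  by rewrite !size_cat /= ?size_cat /= /pb /pa; lia.
rewrite Hend; have Hx1 : exec P (t + 1) (pc, m) = (if eval m c env == 0 then pb else pa, m1).
  by rewrite execD Hx (exec_jz _ Hjz) Hv /pa addn1.
case: eqP Hx1 => _ Hx1.
  have [|t2 [m2 [Ht2 Hx2 Hv2 Hm2]]] := IHb rho d pb P m1 env Hb Hs Hrho gd _ Hcb Henv1.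
    by lia.
  rewrite -(cost_agree _ Hag Hb) in Ht2; rewrite -(eval_agree _ Hag Hb) in Hv2.
  exists (t + 1 + t2), m2; split=> //; first by lia.
    by rewrite execD Hx1 Hx2.
  exact: scratch_trans Hm Hm2.
have [|t2 [m2 [Ht2 Hx2 Hv2 Hm2]]] := IHa rho d pa P m1 env Ha Hs Hrho gd _ Hca Henv1.
  by lia.
rewrite -(cost_agree _ Hag Ha) in Ht2; rewrite -(eval_agree _ Hag Ha) in Hv2.
exists (t + 1 + (t2 + 2)), (upd m2 d.+1 0); split; first by lia.
- by rewrite execD Hx1 execD Hx2 (exec_jump _ Hj).
- by rewrite -Hv2; upd_tac.
- move=> r Hr; rewrite -(Hm r Hr) -(Hm2 r) //.
  by upd_tac.
Qed.

Lemma lgP n l : (n < 2 ^ l) = (lg n <= l).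
Proof.
rewrite /lg; case: eqP => [->|/eqP n0]; first by rewrite expn_gt0.
rewrite /bits -lt0n in n0 *; apply/idP/idP => H.
  have [/leq_ltn_trans/(_ H)] := andP (trunc_log_bounds (isT : 1 < 2) n0).
  by rewrite ltn_exp2l.
apply: (leq_trans (trunc_log_ltn n (isT : 1 < 2))).
by rewrite leq_exp2l.
Qed.

Lemma comp_Lg a : comp_spec a -> comp_spec (Lg a).
Proof.
move=> IHa rho d pc P m env /= Ha Hs Hrho gd HK.
set ca := comp a rho d pc; set pl := pc + size ca + 2.
set ci := [:: IConst d.+1 1; IConst d.+2 0].
set cl := [:: IConst d.+3 1; IAdd d.+4 d d.+3; ISub d.+4 d.+4 d.+1].
set cs := [:: IAdd d.+1 d.+1 d.+1; IAdd d.+2 d.+2 d.+3].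
rewrite -[_ :: _]/(ci ++ cl ++ [:: IJz d.+4 (pl + 8)] ++ cs ++ jump d.+3 pl ++ move d d.+2).
case/code_at_cat=> Hca /code_at_cat [Hci] /code_at_cat [Hcl] /code_at_cons [Hjz].
case/code_at_cat=> Hcs /code_at_cat [Hj Hmv] Henv.
have [|t [m1 [Ht Hx Hv Hm]]] := IHa rho d pc P m env Ha Hs Hrho gd _ Hca Henv.
  by lia.
move: (eval m a env) Hv => v Hv.
rewrite -/ca -/pl in Hcl Hjz Hcs Hj Hmv.
have Hi : exec P (t + 2) (pc, m) = (pl, straight ci m1).
  by rewrite execD Hx (@exec_straight P _ ci).
(* Invariant: [d.+1] holds [2 ^ k] and [d.+2] holds [k]. The test computes [v + 1 - 2 ^ k], which is
   zero exactly when [v < 2 ^ k], that is, by [lgP], from [k = lg v] on. *)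
have Hloop k : k <= lg v -> exists m2, [/\ exec P (t + 2 + k * 8) (pc, m) = (pl, m2),
   m2 d = v, m2 d.+1 = 2 ^ k, m2 d.+2 = k & scratch_eq d m m2].
  elim: k => [|k IH] Hk.
    exists (straight ci m1); rewrite mul0n addn0 Hi; split=> //.
    - by rewrite -Hv; upd_tac.
    - by upd_tac.
    - by upd_tac.
    - by move=> r Hr; rewrite -(Hm r Hr); upd_tac.
  have [m2 [Hx2 H0 H1 H2 Hm2]] := IH (ltnW Hk).
  have Hn : 2 ^ k <= v by rewrite leqNgt lgP -ltnNge.
  pose m3 := straight cs (straight cl m2).
  exists (upd m3 d.+3 0); split.
  - rewrite mulSn (addnC 8) addnA execD Hx2 -[8]/(3 + (1 + (2 + 2))) execD.
    rewrite (@exec_straight P _ cl) // execD (exec_jz _ Hjz) ifN; last first.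
      by rewrite /cl; upd_s; lia.
    by rewrite execD (@exec_straight P _ cs) // (exec_jump _ Hj).
  - by rewrite -H0 /m3 /cs /cl; upd_tac.
  - rewrite expnS mul2n -addnn -H1 /m3 /cs /cl /straight /=.
    by rewrite !updE; repeat (case: eqP => ? //=); lia.
  - rewrite -[in RHS]H2 /m3 /cs /cl /straight /=.
    by rewrite !updE; repeat (case: eqP => ? //=); lia.
  - move=> r Hr; rewrite -(Hm2 r Hr) /m3 /cs /cl.
    by upd_tac.
have [m2 [Hx2 H0 H1 H2 Hm2]] := Hloop (lg v) (leqnn _).
have Hn : v < 2 ^ lg v by rewrite lgP.
pose m3 := straight cl m2.
exists (t + 2 + lg v * 8 + (3 + (1 + 2))), (straight (move d d.+2) m3); split.
- by lia.
- rewrite execD Hx2 execD (@exec_straight P _ cl) // execD (exec_jz _ Hjz) ifT; last first.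
    by rewrite /cl; upd_s; lia.
  rewrite (_ : pl + 8 = (pl + size cl).+1 + size cs + size (jump d.+3 pl)); last first.
    by rewrite /= !addnS !addn0.
  rewrite (@exec_straight P _ (move d d.+2)) //.
  by rewrite /pl !size_cat /=; congr pair; lia.
- rewrite -[in RHS]H2 /m3 /cl; upd_tac.
- move=> r Hr; rewrite -(Hm2 r Hr) /m3 /cl.
  by upd_tac.
Qed.

Lemma comp_Rec n b s :
  comp_spec n -> comp_spec b -> comp_spec s -> comp_spec (Rec n b s).
Proof.
move=> IHn IHb IHs rho d pc P m env /= /and3P[Hn Hb Hs] Hsz Hrho gd HK.
set cn := comp n rho d pc; set pb := pc + size cn + 1.
set cb := comp b rho d.+2 pb; set pl := pb + size cb.
set cs := comp s [:: d.+2, d.+1 & rho] d.+3 (pl + 2).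
set pe := pl + 2 + size cs + 6.
set ct := move d.+2 d.+3 ++ [:: IConst d.+3 1; IAdd d.+1 d.+1 d.+3].
rewrite -[_ :: _]/([:: IConst d.+1 0] ++ cb ++ [:: ISub d.+3 d d.+1] ++
  [:: IJz d.+3 pe] ++ cs ++ ct ++ jump d.+3 pl ++ move d d.+2).
case/code_at_cat=> Hcn /code_at_cat [Hc0] /code_at_cat [Hcb] /code_at_cat [Hsub].
case/code_at_cons=> Hjz /code_at_cat [Hcs] /code_at_cat [Hct] /code_at_cat [Hj Hmv] Henv.
rewrite /= in Hcb Hsub Hjz Hcs Hct Hj Hmv.
have [|t [m1 [Ht Hx Hv Hm]]] := IHn rho d pc P m env Hn Hsz Hrho gd _ Hcn Henv.
  by lia.
rewrite -/pb -/pl in Hcb Hsub Hjz Hcs Hct Hj Hmv.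
pose m1' := straight [:: IConst d.+1 0] m1.
have Hm' : scratch_eq d m m1'.
  by move=> r Hr; rewrite -(Hm r Hr) /m1'; upd_tac.
have Hv' : m1' d = eval m n env by rewrite -Hv /m1'; upd_tac.
have Hi' : m1' d.+1 = 0 by rewrite /m1'; upd_tac.
have Henv1 := env_in_scratch Hrho Hm' Henv.
have [|||t2 [m2 [Ht2 Hx2 Hv2 Hm2]]] := IHb rho d.+2 pb P m1' env Hb Hsz _ _ _ Hcb Henv1.
- by apply: all_ltnW Hrho; lia.
- by lia.
- by lia.
have Hag := scratch_agree gd Hm'.
rewrite -(cost_agree _ Hag Hb) in Ht2; rewrite -(eval_agree _ Hag Hb) in Hv2.
have Hstart : exec P (t + (1 + t2)) (pc, m) = (pl, m2).
  rewrite execD Hx execD (@exec_straight P _ [:: IConst d.+1 0]) //= -/m1'.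
set N := eval m n env in Hv Hv' *.
set F := fun k => iteri k (fun i acc => eval m s [:: acc, i & env]) (eval m b env).
(* Invariant: [d] keeps the number of rounds, [d.+1] counts those done and [d.+2] is the
   accumulator; the step reads the latter two as its variables 1 and 0. *)
have Hloop k : k <= N -> exists t3 m3, [/\
   t3 <= cost m n env + cost m b env + 1 +
     \sum_(i < k) (cost m s [:: F i, val i & env] + 8),
   exec P t3 (pc, m) = (pl, m3), m3 d = N, m3 d.+1 = k /\ m3 d.+2 = F k
   & scratch_eq d m m3].
  elim: k => [|k IH] Hk.
    exists (t + (1 + t2)), m2; rewrite big_ord0; split; first by lia.
    - exact: Hstart.
    - by rewrite Hm2 ?Hv' //; lia.
    - by rewrite Hm2 ?Hi' //; lia.
    - by apply: scratch_trans Hm' Hm2; lia.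
  have [t3 [m3 [Ht3 Hx3 H0 [H1 H2] Hm3]]] := IH (ltnW Hk).
  pose m4 := straight [:: ISub d.+3 d d.+1] m3.
  have H40 : m4 d = N by rewrite -H0 /m4; upd_tac.
  have H41 : m4 d.+1 = k by rewrite -H1 /m4; upd_tac.
  have H42 : m4 d.+2 = F k by rewrite -H2 /m4; upd_tac.
  have H43 : m4 d.+3 = N - k by rewrite /m4 /straight /= upd_eq H0 H1.
  have Hm4 : scratch_eq d m m4.
    by move=> r Hr; rewrite -(Hm3 r Hr) /m4; upd_tac.
  have Henv4 := env_in_scratch Hrho Hm4 Henv.
  rewrite -addn1 addn1 -[(pl + 1).+1]addnS in Hcs.
  have [|||||t5 [m5 [Ht5 Hx5 Hv5 Hm5]]] :=
    IHs [:: d.+2, d.+1 & rho] d.+3 (pl + 2) P m4 [:: F k, k & env] Hs _ _ _ _ Hcs _.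
  - by rewrite /= Hsz.
  - by rewrite /= ltnSn ltnS leqnSn /=; apply: all_ltnW Hrho; lia.
  - by lia.
  - by lia.
  - case=> [|[|i]] //= Hi; rewrite Henv4 //.
  have Hag4 := scratch_agree gd Hm4.
  rewrite -(cost_agree _ Hag4 Hs) in Ht5; rewrite -(eval_agree _ Hag4 Hs) in Hv5.
  pose m6 := straight ct m5.
  exists (t3 + (1 + (1 + (t5 + (4 + 2))))), (upd m6 d.+3 0).
  split.
  - by move: Ht3 Ht5; rewrite big_ord_recr /=; lia.
  - rewrite execD Hx3 execD (@exec_straight P pl [:: ISub d.+3 d d.+1]) // -/m4 [size [:: ISub _ _ _]]/=.
    rewrite execD (exec_jz _ Hjz) H43 ifN; last by lia.
    rewrite -addnS execD Hx5 -/cs execD.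
    have -> : pl + 2 + size cs = (pl + 1).+1 + size cs by lia.
    by rewrite (@exec_straight P _ ct) // (exec_jump _ Hj).
  - rewrite -H40 -(Hm5 d) /m6 /ct; last by lia.
    by upd_tac.
  - split.
      rewrite -[in RHS]H41 -(Hm5 d.+1); last by lia.
      by rewrite /m6 /ct /straight /= !updE; repeat (case: eqP => ? //=); lia.
    rewrite /F /iteri -/(iteri k _ _) -/(F k) -Hv5 /m6 /ct.
    by upd_tac.
  - move=> r Hr; rewrite -(Hm4 r Hr) -(Hm5 r) /m6 /ct; last by lia.
    by upd_tac.
have [t3 [m3 [Ht3 Hx3 H0 [H1 H2] Hm3]]] := Hloop N (leqnn _).
pose m4 := straight [:: ISub d.+3 d d.+1] m3.
have H43 : m4 d.+3 = 0 by rewrite /m4 /straight /= upd_eq H0 H1 subnn.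
exists (t3 + (1 + (1 + 2))), (straight (move d d.+2) m4); split.
- by move: Ht3; rewrite /F /=; lia.
- rewrite execD Hx3 execD (@exec_straight P pl [:: ISub d.+3 d d.+1]) // -/m4 [size [:: ISub _ _ _]]/=.
  rewrite execD (exec_jz _ Hjz) H43 eqxx.
  have -> : pe = (pl + 1).+1 + size cs + 4 + 2 by rewrite /pe; lia.
  rewrite (@exec_straight P _ (move d d.+2)) //.
  by rewrite /pl /pb !size_cat /= ?size_cat /=; congr pair; lia.
- rewrite -/(F N) -H2 /m4; upd_tac.
- move=> r Hr; rewrite -(Hm3 r Hr) /m4.
  by upd_tac.
Qed.

Lemma comp_ok e : comp_spec e.
Proof.
elim: e => [i|c|i|a ?|a ? b ?|a ? b ?|c ? a ? b ?|a ? b ?|f ? a ? b ?|n ? b ? s ?|a ?].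
- exact: comp_Var.
- exact: comp_Cst.
- exact: comp_Glb.
- exact: comp_Read.
- exact: comp_Add.
- exact: comp_Sub.
- exact: comp_Ite.
- exact: comp_Let.
- exact: comp_App2.
- exact: comp_Rec.
- exact: comp_Lg.
Qed.

End Compilation.

(** * Phases of a program *)

Section Phases.
Variables (K g : nat).
Local Notation agree := (agree K g).

(** Memories matter only up to [agree], so consecutive phases compose without any knowledge of what
    was left in the scratch registers. *)
Definition phase (c : nat -> seq instr) (M M' : memory) (T : nat) : Prop :=
  forall P pc m, code_at P pc (c pc) -> agree M m ->
    exists t m', [/\ t <= T, exec P t (pc, m) = (pc + size (c pc), m') & agree M' m'].

Definition cseq (c1 c2 : nat -> seq instr) (pc : nat) : seq instr :=
  c1 pc ++ c2 (pc + size (c1 pc)).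

Lemma phase_seq c1 c2 M1 M2 M3 T1 T2 :
  phase c1 M1 M2 T1 -> phase c2 M2 M3 T2 -> phase (cseq c1 c2) M1 M3 (T1 + T2).
Proof.
move=> H1 H2 P pc m /code_at_cat [Hc1 Hc2] Hm.
have [t1 [m1 [Ht1 Hx1 Hm1]]] := H1 P pc m Hc1 Hm.
have [t2 [m2 [Ht2 Hx2 Hm2]]] := H2 P _ m1 Hc2 Hm1.
exists (t1 + t2), m2; split=> //; first by lia.
by rewrite execD Hx1 Hx2 size_cat addnA.
Qed.

(** The value is formed in the first scratch register and moved at the end, since [e] may read
    register [i]. *)
Definition set_code (i : nat) (e : expr) (pc : nat) : seq instr :=
  comp K e [::] g pc ++ move i g.

Lemma phase_set i e M : i < g -> wf g 0 e -> g + regs e <= K ->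
  phase (set_code i e) M (upd M i (eval K M e [::])) (cost K M e [::] + 2).
Proof.
move=> Hi He HK P pc m /code_at_cat [Hc Hmv] Hm.
have [|t [m1 [Ht Hx Hv Hm1]]] :=
  @comp_ok K g e [::] g pc P m [::] He erefl isT (leqnn g) HK Hc; first by [].
rewrite -(cost_agree _ Hm He) in Ht; rewrite -(eval_agree _ Hm He) in Hv.
exists (t + 2), (straight (move i g) m1); split; first by lia.
  by rewrite execD Hx (@exec_straight P _ (move i g)) // size_cat addnA.
move=> r Hr; rewrite /straight /= !updE eqxx.
case: (r =P i) => [_|ri]; first by rewrite ifN ?Hv //; lia.
by rewrite Hm1 ?Hm.
Qed.

Definition fill_code (n a v : expr) (pc : nat) : seq instr :=
  let cn := comp K n [::] g pc in
  let pl := pc + size cn + 1 in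
  let ca := comp K a [:: g.+1] g.+2 (pl + 2) in
  let cv := comp K v [:: g.+1] g.+3 (pl + 2 + size ca) in
  let ct := [:: IConst g.+4 K; IAdd g.+2 g.+2 g.+4; IStore g.+2 g.+3;
                IConst g.+4 1; IAdd g.+1 g.+1 g.+4] in
  cn ++ [:: IConst g.+1 0] ++ [:: ISub g.+2 g g.+1] ++
  [:: IJz g.+2 (pl + 2 + size ca + size cv + 7)] ++ ca ++ cv ++ ct ++ jump g.+4 pl.

Definition fill_mem (A V : nat -> nat) (M : memory) (k : nat) : memory :=
  iteri k (fun i M => upd M (K + A i) (V i)) M.

(** The hypotheses on [a] and [v] concern the memory after [i] writes, because these expressions
    read the memory that the loop is changing. *)
Lemma phase_fill n a v M N A V ca cv :
  wf g 0 n -> wf g 1 a -> wf g 1 v -> g + regs n <= K ->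
  g + 5 + regs a + regs v <= K -> eval K M n [::] = N ->
  (forall i, i < N -> let M' := fill_mem A V M i in
    [/\ eval K M' a [:: i] = A i, cost K M' a [:: i] <= ca,
        eval K M' v [:: i] = V i & cost K M' v [:: i] <= cv]) ->
  phase (fill_code n a v) M (fill_mem A V M N)
    (cost K M n [::] + 3 + N * (ca + cv + 9)).
Proof.
move=> Hn Ha Hv HKn HKv HN HAV P pc m; rewrite /fill_code.
set cn := comp K n _ _ _; set pl := pc + size cn + 1.
set cca := comp K a _ _ _; set ccv := comp K v _ _ _; set pe := _ + 7.
set ct := [:: IConst g.+4 K; _; _; _; _].
case/code_at_cat=> Hcn /code_at_cat [Hc0] /code_at_cat [Hsub] /code_at_cat [].
case/code_at_cons=> Hjz _ /code_at_cat [Hca] /code_at_cat [Hcv] /code_at_cat [Hct Hj] Hm.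
rewrite /= -/pl in Hsub Hjz Hca Hcv Hct Hj.
have [|t [m1 [Ht Hx Hv1 Hm1]]] :=
  @comp_ok K g n [::] g pc P m [::] Hn erefl isT (leqnn g) HKn Hcn; first by [].
rewrite -(cost_agree _ Hm Hn) in Ht; rewrite -(eval_agree _ Hm Hn) HN in Hv1.
have E1 : pl + 1 + 1 = pl + 2 by lia.
rewrite E1 in Hca Hcv Hct Hj.
have Hloop k : k <= N -> exists t3 m3, [/\ t3 <= cost K M n [::] + 1 + k * (ca + cv + 9),
   exec P t3 (pc, m) = (pl, m3), m3 g = N, m3 g.+1 = k & agree (fill_mem A V M k) m3].
  elim: k => [|k IH] Hk.
    exists (t + 1), (straight [:: IConst g.+1 0] m1); split; first by lia.
    - by rewrite execD Hx (@exec_straight P _ [:: IConst g.+1 0]).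
    - by rewrite -Hv1; upd_s.
    - by upd_s.
    - move=> r Hr; rewrite /straight /= updE ifN; last by lia.
      by rewrite Hm1 // -Hm.
  have [t3 [m3 [Ht3 Hx3 H0 H1 Hm3]]] := IH (ltnW Hk).
  have [Ea Ca Ev Cv] := HAV k Hk.
  pose m4 := straight [:: ISub g.+2 g g.+1] m3.
  have H40 : m4 g = N by rewrite -H0 /m4; upd_s.
  have H41 : m4 g.+1 = k by rewrite -H1 /m4; upd_s.
  have H43 : m4 g.+2 = N - k by rewrite /m4 /straight /= upd_eq H0 H1.
  have Hm4 : agree (fill_mem A V M k) m4.
    by move=> r Hr; rewrite Hm3 // /m4 /straight /= updE ifN //; lia.
  have [|||||t5 [m5 [Ht5 Hx5 Hv5 Hv5' Hm5]]] := comp_bin2 (@comp_ok K g a) (@comp_ok K g v)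
    (rho := [:: g.+1]) (env := [:: k]) (d := g.+2) Ha Hv erefl _ _ _ _ Hca Hcv (m := m4).
  - by rewrite /= leqnn.
  - by lia.
  - by lia.
  - by lia.
  - by case.
  rewrite -(cost_agree _ Hm4 Ha) -(cost_agree _ Hm4 Hv) in Ht5.
  rewrite -(eval_agree _ Hm4 Ha) Ea in Hv5.
  rewrite -(eval_agree _ Hm4 Hv) Ev in Hv5'.
  exists (t3 + (1 + (1 + (t5 + (5 + 2))))), (upd (straight ct m5) g.+4 0).
  split.
  - by lia.
  - rewrite execD Hx3 execD (@exec_straight P pl [:: ISub g.+2 g g.+1]) // -/m4.
    rewrite [size [:: _]]/= execD (exec_jz _ Hjz) H43 ifN; last by lia.
    rewrite -addnS execD Hx5 execD.
    by rewrite (@exec_straight P _ ct) // (exec_jump _ Hj).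
  - have E5 : m5 g = m4 g by apply: Hm5; lia.
    by rewrite /ct; upd_s; lia.
  - have E5 : m5 g.+1 = m4 g.+1 by apply: Hm5; lia.
    by rewrite /ct; upd_s; lia.
  - move=> r Hr; rewrite -[LHS]/(upd (fill_mem A V M k) (K + A k) (V k) r).
    have E5 : m5 r = fill_mem A V M k r by rewrite Hm5 ?Hm4 //; lia.
    rewrite /ct; upd_s; rewrite Hv5 Hv5' E5.
    by case: (r =P K + A k) => [->|]; [rewrite addnC eqxx | case: eqP; lia].
have [t3 [m3 [Ht3 Hx3 H0 H1 Hm3]]] := Hloop N (leqnn _).
pose m4 := straight [:: ISub g.+2 g g.+1] m3.
exists (t3 + (1 + 1)), m4; split; first by lia.
  rewrite execD Hx3 execD (@exec_straight P pl [:: ISub g.+2 g g.+1]) // -/m4.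
  rewrite [size [:: _]]/= (exec_jz _ Hjz) ifT; last by rewrite /m4 /straight /= upd_eq H0 H1 subnn.
  by rewrite /pe /pl !size_cat /=; congr pair; lia.
by move=> r Hr; rewrite Hm3 // /m4 /straight /= updE ifN //; lia.
Qed.

End Phases.

(** * Simulating a program inside an arithmetic progression of cells *)

Section Simulation.
Variables (K g bb j : nat) (Q : program).
Hypotheses (g0 : 0 < g) (gK : g + 2 <= K) (Kb : K <= bb) (j2 : j < 2).

(** Two programs share the cells from [bb] on, one at even and one at odd offsets; this separates
    them without a bound on the addresses they use. *)
Definition cell (a : nat) : nat := bb + (a + a) + j.

Definition sim_addr (t c : nat) := [:: IConst t (c + c + j); IAdd t t 0].
Definition sim_load (t c : nat) := [:: IConst t (c + c + j); IAdd t t 0; ILoad t t].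
Definition sim_ind (t s : nat) :=
  [:: IAdd t t t; IConst s j; IAdd t t s; IAdd t t 0].

(** Every instruction becomes a block of 11, padded with assignments to the scratch register [g];
    then the block of instruction number [i] starts [11 * i] after the beginning, and jump targets
    are known when the code is generated. Register 0 is expected to hold [bb]. *)
Definition sim_straight (i : instr) : seq instr :=
  match i with
  | IConst r c => sim_addr g r ++ [:: IConst g.+1 c; IStore g g.+1] ++ nseq 7 (IConst g 0)
  | IAdd d a b => sim_load g a ++ sim_load g.+1 b ++ [:: IAdd g g g.+1] ++
                  sim_addr g.+1 d ++ [:: IStore g.+1 g] ++ [:: IConst g 0]
  | ISub d a b => sim_load g a ++ sim_load g.+1 b ++ [:: ISub g g g.+1] ++
                  sim_addr g.+1 d ++ [:: IStore g.+1 g] ++ [:: IConst g 0]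
  | ILoad d a => sim_load g a ++ sim_ind g g.+1 ++ [:: ILoad g g] ++
                 sim_addr g.+1 d ++ [:: IStore g.+1 g]
  | IStore a x => sim_load g a ++ sim_ind g g.+1 ++ sim_load g.+1 x ++ [:: IStore g g.+1]
  | _ => [::]
  end.

Definition sim_block (pc0 : nat) (i : instr) : seq instr :=
  match i with
  | IJz r t => nseq 7 (IConst g 0) ++ sim_load g r ++
               [:: IJz g (pc0 + 11 * minn t (size Q))]
  | IHalt => nseq 9 (IConst g 0) ++ jump g (pc0 + 11 * size Q)
  | _ => sim_straight i
  end.

Definition sim_code (pc0 : nat) : seq instr := flatten [seq sim_block pc0 i | i <- Q].

Lemma size_sim_block pc0 i : size (sim_block pc0 i) = 11.
Proof. by case: i. Qed.

Lemma size_sim_code pc0 : size (sim_code pc0) = 11 * size Q.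
Proof.
rewrite /sim_code size_flatten /shape -map_comp.
by elim: Q => //= i q ->; rewrite size_sim_block mulnS.
Qed.

Lemma sim_code_at P pc0 pq : code_at P pc0 (sim_code pc0) -> pq < size Q ->
  code_at P (pc0 + 11 * pq) (sim_block pc0 (nth IHalt Q pq)).
Proof.
rewrite /sim_code => H Hpq.
rewrite -(cat_take_drop pq Q) (drop_nth IHalt Hpq) map_cat flatten_cat /= in H.
move: H => /code_at_cat [_] /code_at_cat [].
rewrite size_flatten /shape -map_comp.
suff -> : sumn [seq (size \o sim_block pc0) i | i <- take pq Q] = 11 * pq by [].
rewrite -[in RHS](size_takel (ltnW Hpq)).
by elim: (take pq Q) => //= i q ->; rewrite size_sim_block mulnS.
Qed.

Definition sim_mem (M : memory) (ms : memory) (m : memory) : Prop :=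
  [/\ forall a, m (cell a) = ms a, M 0 = bb
    & forall r, (r < g) || (K <= r) -> (forall a, r != cell a) -> m r = M r].

Lemma sim_mem0 M ms m : sim_mem M ms m -> m 0 = bb.
Proof.
by case=> _ HM H; rewrite H ?HM ?g0 // => a; rewrite /cell; lia.
Qed.

Lemma sim_mem_upd M ms m d v m' : sim_mem M ms m ->
  (forall r, r != g -> r != g.+1 -> m' r = if r == cell d then v else m r) ->
  sim_mem M (upd ms d v) m'.
Proof.
move=> [H1 H2 H3] H; split=> // [a|r Hr Ha].
  rewrite H; try by rewrite /cell; lia.
  rewrite H1 updE (_ : (cell a == cell d) = (a == d)) //.
  by rewrite /cell; lia.
rewrite H; [|lia|lia].
by rewrite (negPf (Ha d)) H3.
Qed.

Lemma sim_load_spec M ms m t c : sim_mem M ms m -> t \in [:: g; g.+1] ->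
  forall r, straight (sim_load t c) m r = if r == t then ms c else m r.
Proof.
move=> Hs Ht r; have Hm := sim_mem0 Hs; have Hc : c + c + j + bb = cell c by rewrite /cell; lia.
have Ht' : (t == g) || (t == g.+1) by move: Ht; rewrite !inE.
have t0 : (0 == t) = false by lia.
rewrite /straight /= !updE eqxx t0 Hm; case: eqP => // _.
by rewrite ifN ?Hc; [rewrite ifN; [case: Hs => -> | rewrite /cell; lia] | rewrite /cell; lia].
Qed.

Lemma sim_mem_ext M ms m m' : sim_mem M ms m ->
  (forall r, r != g -> r != g.+1 -> m' r = m r) -> sim_mem M ms m'.
Proof.
move=> [H1 H2 H3] H; split=> // [a|r Hr Ha].
  by rewrite H ?H1 // /cell; lia.
by rewrite H ?H3 //; lia.
Qed.

Lemma sim_straight_ok M ms m i : is_straight i -> sim_mem M ms m ->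
  sim_mem M (straight_instr i ms) (straight (sim_straight i) m).
Proof.
have Hc c : c + c + j + bb = cell c by rewrite /cell; lia.
have tg : g \in [:: g; g.+1] by rewrite !inE eqxx.
have tg1 : g.+1 \in [:: g; g.+1] by rewrite !inE eqxx orbT.
have ne0 : (g == g.+1) = false by lia.
have ne1 : (g.+1 == g) = false by lia.
have ng : (0 == g) = false by lia.
have ng1 : (0 == g.+1) = false by lia.
have cg c : (cell c == g) = false by rewrite /cell; lia.
have cg1 c : (cell c == g.+1) = false by rewrite /cell; lia.
case: i => // [r c|d a b|d a b|d a|a x] _ Hs; have Hm := sim_mem0 Hs;
  rewrite /straight_instr /sim_straight.
- apply: sim_mem_upd Hs _ => s s1 s2; rewrite /straight /=.
  by rewrite !updE !eqxx ?ne0 ?ne1 ?ng ?ng1 (negPf s1) (negPf s2) Hm Hc.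
- have Ha := sim_load_spec a Hs tg; rewrite !straight_cat.
  set m1 := straight _ m in Ha *.
  have Hs1 : sim_mem M ms m1 by apply: sim_mem_ext Hs _ => s s1 s2; rewrite Ha (negPf s1).
  have Hb := sim_load_spec b Hs1 tg1.
  set m2 := straight (sim_load g.+1 b) m1 in Hb *.
  apply: sim_mem_upd Hs _ => s s1 s2; rewrite /straight /=.
  rewrite !updE !eqxx ?ne0 ?ne1 ?ng ?ng1 (negPf s1) (negPf s2).
  by rewrite !Hb !Ha !eqxx ?ne0 ?ne1 ?ng ?ng1 Hm (negPf s1) (negPf s2) Hc.
- have Ha := sim_load_spec a Hs tg; rewrite !straight_cat.
  set m1 := straight _ m in Ha *.
  have Hs1 : sim_mem M ms m1 by apply: sim_mem_ext Hs _ => s s1 s2; rewrite Ha (negPf s1).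
  have Hb := sim_load_spec b Hs1 tg1.
  set m2 := straight (sim_load g.+1 b) m1 in Hb *.
  apply: sim_mem_upd Hs _ => s s1 s2; rewrite /straight /=.
  rewrite !updE !eqxx ?ne0 ?ne1 ?ng ?ng1 (negPf s1) (negPf s2).
  by rewrite !Hb !Ha !eqxx ?ne0 ?ne1 ?ng ?ng1 Hm (negPf s1) (negPf s2) Hc.
- have Ha := sim_load_spec a Hs tg; rewrite !straight_cat.
  set m1 := straight _ m in Ha *.
  apply: sim_mem_upd (Hs) _ => s s1 s2; rewrite /straight /=.
  rewrite !updE !eqxx ?ne0 ?ne1 ?ng ?ng1 (negPf s1) (negPf s2).
  rewrite !Ha !eqxx ?ne0 ?ne1 ?ng ?ng1 Hm (negPf s1) !Hc ?cg ?cg1.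
  by case: Hs => ->.
- have Ha := sim_load_spec a Hs tg; rewrite !straight_cat.
  set m1 := straight (sim_load g a) m in Ha *.
  have Hi s : straight (sim_ind g g.+1) m1 s =
      if s == g then cell (ms a) else if s == g.+1 then j else m s.
    rewrite /straight /= !updE !eqxx ?ne0 ?ne1 ?ng ?ng1 !Ha !eqxx ?ng Hm Hc.
    by case: (s == g).
  set m2 := straight (sim_ind _ _) m1 in Hi *.
  have Hs2 : sim_mem M ms m2.
    by apply: sim_mem_ext Hs _ => s s1 s2; rewrite Hi (negPf s1) (negPf s2).
  have Hx := sim_load_spec x Hs2 tg1.
  set m3 := straight _ m2 in Hx *.
  apply: sim_mem_upd Hs _ => s s1 s2; rewrite /straight /=.
  by rewrite !updE !Hx !eqxx ?ne0 ?ne1 (negPf s2) !Hi eqxx (negPf s1) (negPf s2).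
Qed.

Lemma straight_nops M ms m n : sim_mem M ms m ->
  sim_mem M ms (straight (nseq n (IConst g 0)) m).
Proof.
move=> Hs; apply: sim_mem_ext (Hs) _ => r r1 r2.
rewrite /straight; elim: n {Hs} m => //= n IH m; rewrite IH upd_neq //.
Qed.

(** A program counter outside [Q] means that [Q] has halted; [minn pq (size Q)] sends all such
    counters to the end of the simulating code. *)
Lemma sim_step P pc0 M ms m pq : code_at P pc0 (sim_code pc0) ->
  sim_mem M ms m -> ~~ halted Q (pq, ms) ->
  exists m', exec P 11 (pc0 + 11 * minn pq (size Q), m) =
               (pc0 + 11 * minn (step Q (pq, ms)).1 (size Q), m') /\
             sim_mem M (step Q (pq, ms)).2 m'.
Proof.
move=> Hat Hs Hh.
have Hpq : pq < size Q by rewrite ltnNge; apply/negP => H; rewrite /halted nth_default in Hh.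
rewrite (minn_idPl (ltnW Hpq)); have := sim_code_at Hat Hpq.
have [Hst|] := boolP (is_straight (nth IHalt Q pq)).
  move=> Hc; have -> : step Q (pq, ms) = (pq.+1, straight_instr (nth IHalt Q pq) ms).
    by move: Hst; rewrite /step; case: nth.
  exists (straight (sim_straight (nth IHalt Q pq)) m); split; last exact: sim_straight_ok.
  have Eb : sim_block pc0 (nth IHalt Q pq) = sim_straight (nth IHalt Q pq).
    by move: Hst; case: nth.
  have := @exec_straight P _ _ m _ Hc; rewrite size_sim_block => ->.
    by rewrite Eb (minn_idPl Hpq) mulnS (addnC 11) addnA.
  by move: Hst; rewrite Eb; case: nth.
move: Hh; rewrite /halted /=; case E: (nth IHalt Q pq) => [| | | | |r t|] //= _ _ Hc.
move: Hc; rewrite -[_ :: _]/(nseq 7 (IConst g 0) ++ sim_load g r ++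
  [:: IJz g (pc0 + 11 * minn t (size Q))]) => /code_at_cat [Hn] /code_at_cat [Hl] /code_at_cons [Hjz _].
rewrite -[11]/(7 + (3 + 1)) execD (@exec_straight P _ (nseq 7 (IConst g 0))) //.
rewrite execD (@exec_straight P _ (sim_load g r)) // (exec_jz _ Hjz).
have Hs1 := straight_nops 7 Hs; set m1 := straight _ m in Hs1 *.
have tg : g \in [:: g; g.+1] by rewrite !inE eqxx.
have Hld := sim_load_spec r Hs1 tg; set m2 := straight _ m1 in Hld *.
exists m2; split; last first.
  have : sim_mem M ms m2 by apply: sim_mem_ext Hs1 _ => s s1 s2; rewrite Hld (negPf s1).
  by case: ifP.
rewrite Hld eqxx; case: ifP => _ //=.
by rewrite (minn_idPl Hpq); congr pair; lia.
Qed.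

Lemma sim_run P pc0 M ms m T : code_at P pc0 (sim_code pc0) -> sim_mem M ms m ->
  halted Q (exec Q T (0, ms)) ->
  exists t m', [/\ t <= 11 * T + 11, exec P t (pc0, m) = (pc0 + 11 * size Q, m')
    & sim_mem M (exec Q T (0, ms)).2 m'].
Proof.
move=> Hat Hs HT.
(* With [n] the first halting time, [sim_step] applies to all earlier steps. At time [n] control is
   either at the end of the blocks already or in a block of [IHalt], which jumps there. *)
have [n nT [Hh Hmin]] : exists2 n, n <= T & halted Q (exec Q n (0, ms)) /\
    forall k, k < n -> ~~ halted Q (exec Q k (0, ms)).
  have ex : exists n, halted Q (exec Q n (0, ms)) by exists T.
  exists (ex_minn ex); case: ex_minnP => n Hn Hmin; first exact: Hmin.
  by split=> // k kn; apply/negP => /Hmin; lia.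
rewrite (exec_halted_le nT Hh).
have Hrun k : k <= n -> exists m', exec P (11 * k) (pc0, m) =
    (pc0 + 11 * minn (exec Q k (0, ms)).1 (size Q), m') /\
    sim_mem M (exec Q k (0, ms)).2 m'.
  elim: k => [|k IH] Hk; first by exists m; rewrite muln0 /= min0n muln0 addn0.
  have [m1 [Hx1 Hs1]] := IH (ltnW Hk).
  have Hn := Hmin k Hk; case E: (exec Q k (0, ms)) Hx1 Hs1 Hn => [pq msk] Hx1 Hs1 Hn.
  have [m2 [Hx2 Hs2]] := sim_step Hat Hs1 Hn.
  exists m2; rewrite mulnS addnC execD Hx1 Hx2.
  by rewrite -[k.+1]addn1 execD E /exec.
have [m1 [Hx1 Hs1]] := Hrun n (leqnn n).
case E: (exec Q n (0, ms)) Hx1 Hs1 Hh => [pq msk] /= Hx1 Hs1 Hh.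
have [Hpq|Hpq] := ltnP pq (size Q); last first.
  by exists (11 * n), m1; split=> //; [lia | rewrite Hx1 (minn_idPr Hpq)].
have := sim_code_at Hat Hpq; move: Hh; rewrite /halted /=.
case Ei: (nth IHalt Q pq) => // _ Hc.
rewrite -[sim_block _ _]/(nseq 9 (IConst g 0) ++ jump g (pc0 + 11 * size Q)) in Hc.
move: Hc => /code_at_cat [Hn Hj].
have Hs2 := straight_nops 9 Hs1.
exists (11 * n + (9 + 2)), (upd (straight (nseq 9 (IConst g 0)) m1) g 0); split.
- by lia.
- rewrite execD Hx1 (minn_idPl (ltnW Hpq)) execD (@exec_straight P _ (nseq 9 (IConst g 0))) //.
  by rewrite (exec_jump _ Hj).
- by apply: sim_mem_ext Hs2 _ => s s1 s2; rewrite upd_neq.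
Qed.

Definition overlay (ms M : memory) : memory := fun r =>
  if (bb <= r) && (odd (r - bb) == (j == 1)) then ms (r - bb)./2 else M r.

Lemma phase_sim M x T : M 0 = bb ->
  (forall a, M (cell a) = (init x).2 a) -> halted Q (exec Q T (init x)) ->
  phase K g sim_code M (overlay (exec Q T (init x)).2 M) (11 * T + 11).
Proof.
move=> HM0 HM HT P pc m Hc Hm.
have Hs : sim_mem M (init x).2 m.
  split=> // [a|r Hr _]; last by rewrite Hm.
  by rewrite -Hm ?HM // /cell; lia.
have [t [m' [Ht Hx Hs']]] := sim_run Hc Hs HT.
exists t, m'; split=> //; first by rewrite Hx size_sim_code.
case: Hs' => H1 _ H3 r Hr; rewrite /overlay; case: ifP => [/andP[br /eqP Ho]|Hb].
  rewrite -[in RHS](_ : cell (r - bb)./2 = r) ?H1 //.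
  rewrite /cell addnn; have := odd_double_half (r - bb); rewrite Ho.
  by move: j2; case: eqP => [->|]; lia.
rewrite H3 // => a; apply/eqP => E; move: Hb; rewrite E /cell -addnA leq_addr addKn addnn.
by rewrite oddD odd_double; move: j2; case: (j) => [|[|]].
Qed.

End Simulation.

(** * Saving the registers' share of the input *)

Section Prelude.
Variables (K : nat) (x : seq nat).
Hypotheses (K2 : 1 < K) (x0 : 0 < size x).

Definition save_code (k : nat) : seq instr :=
  flatten [seq [:: IAdd 0 0 1; IStore 0 i] | i <- iota 2 k].

(** At the start every register may hold input. Register 0 holds the length, and doubling it [K]
    times reaches an address beyond both the input and the registers without using any other cell.
    The first store then saves cell 1, which becomes free to hold the increment 1 for copying the
    remaining registers. *)
Definition prelude : seq instr :=
  nseq K (IAdd 0 0 0) ++ [:: IStore 0 1; IConst 1 1] ++ save_code (K - 2) ++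
  [:: IAdd 0 0 1; IConst 1 K].

Definition save_base : nat := 2 ^ K * size x.
Definition free_base : nat := save_base + K - 1.

Lemma straight_double k m r :
  straight (nseq k (IAdd 0 0 0)) m r = if r == 0 then 2 ^ k * m 0 else m r.
Proof.
rewrite /straight; elim: k m r => [|k IH] m r /=; first by rewrite mul1n; case: eqP => [->|].
by rewrite IH !updE eqxx expnS; case: eqP => // _; lia.
Qed.

Lemma save_base_ge : size x + K <= save_base.
Proof. by rewrite /save_base; have := ltn_expl K (isT : 1 < 2); nia. Qed.

Lemma straight_prelude : is_true (all is_straight prelude).
Proof.
rewrite /prelude !all_cat /= andbT all_nseq /= orbT /=.
by rewrite /save_code; elim: (iota _ _).
Qed.

Lemma prelude_ok (m := straight prelude (init x).2) :
  [/\ m 0 = free_base, m 1 = K,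
      forall i, i < K - 1 -> m (save_base + i) = nth 0 x i,
      forall r, K <= r -> r < save_base -> m r = nth 0 x r.-1
    & forall r, free_base <= r -> m r = 0].
Proof.
have Hb := save_base_ge.
pose m1 := straight (nseq K (IAdd 0 0 0) ++ [:: IStore 0 1; IConst 1 1]) (init x).2.
have Hm1 : [/\ m1 0 = save_base, m1 1 = 1, m1 save_base = nth 0 x 0 &
    forall r, 1 < r -> r != save_base -> m1 r = nth 0 x r.-1].
  have Hd r := straight_double K (init x).2 r.
  rewrite /m1 straight_cat; set md := straight _ _ in Hd *.
  have H0 : md 0 = save_base by rewrite Hd.
  have H1 : md 1 = nth 0 x 0 by rewrite Hd.
  split.
  - by rewrite -H0; upd_s.
  - by upd_s.
  - by rewrite /straight /= !updE H0 eqxx H1; case: eqP; lia.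
  - move=> r r1 rb; rewrite /straight /= !updE H0 (negPf rb) Hd /=.
    by do 2 (case: eqP; first by lia).
have Hs k : k + 2 <= K -> let mk := straight (save_code k) m1 in
  [/\ mk 0 = save_base + k, mk 1 = 1,
      forall i, i < k.+1 -> mk (save_base + i) = nth 0 x i &
      forall r, 1 < r -> (r < save_base) || (save_base + k < r) -> mk r = nth 0 x r.-1].
  elim: k => [|k IH] Hk; case: Hm1 => H0 H1 Hb1 Hr.
    rewrite /save_code /straight /= addn0; split=> // [[|i] // _|r r1 rb].
      by rewrite addn0.
    by rewrite Hr //; lia.
  have -> : save_code k.+1 = save_code k ++ [:: IAdd 0 0 1; IStore 0 (2 + k)].
    by rewrite /save_code -[k.+1]addn1 iotaD map_cat flatten_cat.
  rewrite straight_cat.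
  have := IH (ltnW Hk); set mk := straight (save_code k) m1 => -[K0 K1 Kb1 Kr].
  have E0 : 2 + k != 0 by lia.
  split=> [||i Hi|r r1 Hr1].
  - by upd_s; lia.
  - by upd_s.
  - rewrite /straight /= !updE /= K0 K1.
    case: (i =P k.+1) => [->|ik]; last by rewrite !ifN ?Kb1 //; lia.
    rewrite ifT; last by lia.
    rewrite Kr; first by congr (nth 0 x _); lia.
    + by lia.
    + by lia.
  - rewrite /straight /= !updE /= K0 K1 !ifN; try by lia.
    by rewrite Kr //; lia.
have [|H0 H1 Hbs Hrs] := Hs (K - 2); first by lia.
have -> : m = straight [:: IAdd 0 0 1; IConst 1 K] (straight (save_code (K - 2)) m1).
  by rewrite /m /prelude /m1 -!straight_cat -!catA.
move: H0 H1 Hbs Hrs; set mk := straight (save_code _) _ => H0 H1 Hbs Hrs.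
rewrite /straight /= /free_base; split=> [||i Hi|r r1 r2|r Hr].
- by rewrite !updE /= H0 H1; lia.
- by rewrite !updE.
- by rewrite !updE !ifN ?Hbs; lia.
- by rewrite !updE !ifN ?Hrs //; lia.
- rewrite !updE !ifN ?Hrs; try by lia.
  by rewrite nth_default //; lia.
Qed.

End Prelude.

(** * Pure expressions *)

Fixpoint pure (e : expr) : bool :=
  match e with
  | Var _ | Cst _ => true
  | Glb _ | Read _ | Lg _ => false
  | Add a b | Sub a b | Let a b => pure a && pure b
  | Ite a b c | App2 a b c | Rec a b c => [&& pure a, pure b & pure c]
  end.

Notation peval e env := (eval 0 (fun=> 0) e env).
Notation pcost e env := (cost 0 (fun=> 0) e env).

Lemma eval_pure K M e env : pure e -> eval K M e env = peval e env.
Proof.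
elim: e env => //= [a IHa b IHb|a IHa b IHb|c IHc a IHa b IHb|a IHa b IHb
  |f IHf a IHa b IHb|c IHc b IHb s IHs] env.
- by case/andP=> Ha Hb; rewrite IHa ?IHb.
- by case/andP=> Ha Hb; rewrite IHa ?IHb.
- by case/and3P=> Hc Ha Hb; rewrite IHc ?IHa ?IHb.
- by case/andP=> Ha Hb; rewrite IHa ?IHb.
- by case/and3P=> Hf Ha Hb; rewrite IHa ?IHb ?IHf.
- case/and3P=> Hc Hb Hs; rewrite IHc ?IHb //.
  by apply: eq_iteri => i y; rewrite IHs.
Qed.

Lemma cost_pure K M e env : pure e -> cost K M e env = pcost e env.
Proof.
elim: e env => //= [a IHa b IHb|a IHa b IHb|c IHc a IHa b IHb|a IHa b IHb
  |f IHf a IHa b IHb|c IHc b IHb s IHs] env.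
- by case/andP=> Ha Hb; rewrite IHa ?IHb.
- by case/andP=> Ha Hb; rewrite IHa ?IHb.
- by case/and3P=> Hc Ha Hb; rewrite IHc ?IHa ?IHb ?(eval_pure _ _ _ Hc).
- by case/andP=> Ha Hb; rewrite IHa ?IHb ?(eval_pure _ _ _ Ha).
- by case/and3P=> Hf Ha Hb; rewrite IHa ?IHb ?IHf ?(eval_pure _ _ _ Ha) ?(eval_pure _ _ _ Hb).
- case/and3P=> Hc Hb Hs; rewrite IHc ?IHb ?(eval_pure _ _ _ Hc) //; congr (_ + _).
  apply: eq_bigr => i _; rewrite IHs ?(eval_pure _ _ _ Hb) //.
  by rewrite (eq_iteri (fun i y => eval_pure K M [:: y, i & env] Hs)).
Qed.

Definition same_env (n : nat) (env env' : seq nat) :=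
  forall i, i < n -> nth 0 env i = nth 0 env' i.

Lemma same_env_cons n v env env' : same_env n env env' ->
  same_env n.+1 (v :: env) (v :: env').
Proof. by move=> H [|i] //= Hi; apply: H. Qed.

Lemma eval_env K M g n e env env' : wf g n e -> same_env n env env' ->
  eval K M e env = eval K M e env'.
Proof.
elim: e n env env' => //= [i|a IHa|a IHa b IHb|a IHa b IHb|c IHc a IHa b IHb|a IHa b IHb
  |f IHf a IHa b IHb|c IHc b IHb s IHs|a IHa] n env env'.
- by move=> Hi; apply.
- by move=> Ha He; rewrite (IHa n env env').
- by case/andP=> Ha Hb He; rewrite (IHa n env env') ?(IHb n env env').
- by case/andP=> Ha Hb He; rewrite (IHa n env env') ?(IHb n env env').
- by case/and3P=> Hc Ha Hb He; rewrite (IHa n env env') ?(IHb n env env') ?(IHc n env env').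
- case/andP=> Ha Hb He; rewrite (IHa n env env') //.
  by apply: IHb Hb _; apply: same_env_cons.
- by case/and3P=> Hf Ha Hb He; rewrite (IHa n env env') ?(IHb n env env').
- case/and3P=> Hc Hb Hs He; rewrite (IHc n env env') ?(IHb n env env') //.
  by apply: eq_iteri => i y; apply: IHs Hs _; do 2 apply: same_env_cons.
- by move=> Ha He; rewrite (IHa n env env').
Qed.

Lemma cost_env K M g n e env env' : wf g n e -> same_env n env env' ->
  cost K M e env = cost K M e env'.
Proof.
elim: e n env env' => //= [a IHa|a IHa b IHb|a IHa b IHb|c IHc a IHa b IHb|a IHa b IHb
  |f IHf a IHa b IHb|c IHc b IHb s IHs|a IHa] n env env'.
- by move=> Ha He; rewrite (IHa n env env').
- by case/andP=> Ha Hb He; rewrite (IHa n env env') ?(IHb n env env').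
- by case/andP=> Ha Hb He; rewrite (IHa n env env') ?(IHb n env env').
- case/and3P=> Hc Ha Hb He; rewrite (eval_env _ _ Hc He).
  by rewrite (IHa n env env') ?(IHb n env env') ?(IHc n env env').
- case/andP=> Ha Hb He; rewrite (IHa n env env') // (eval_env _ _ Ha He).
  by rewrite (IHb _ _ _ Hb (same_env_cons _ He)).
- case/and3P=> Hf Ha Hb He; rewrite (IHa n env env') ?(IHb n env env') //.
  by rewrite (eval_env _ _ Ha He) (eval_env _ _ Hb He).
- case/and3P=> Hc Hb Hs He; rewrite (IHc n env env') ?(IHb n env env') //.
  rewrite (eval_env _ _ Hc He) (eval_env _ _ Hb He); congr (_ + _).
  apply: eq_bigr => i _; congr (_ + _).
  set u := iteri _ _ _; set u' := iteri _ _ _.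
  have -> : u = u'.
    by apply: eq_iteri => k y; apply: eval_env Hs _; do 2 apply: same_env_cons.
  by apply: IHs Hs _; do 2 apply: same_env_cons.
- by move=> Ha He; rewrite (IHa n env env') // (eval_env _ _ Ha He).
Qed.

Lemma same_env1 v env env' : same_env 1 (v :: env) (v :: env').
Proof. by case. Qed.

Lemma peval1 e v env : wf 0 1 e -> peval e (v :: env) = peval e [:: v].
Proof. by move=> He; apply: eval_env He (@same_env1 _ _ _). Qed.

Lemma pure_computable e (f : nat -> nat) : pure e -> wf 0 1 e ->
  (forall n, peval e [:: n] = f n) -> computable_fun f.
Proof.
move=> He Hw Hf; pose K := 2 + regs e.
exists (comp K e [:: 1] 2 0 ++ move 1 2 ++ [:: IHalt]) => n.
set P := _ ++ _; have : code_at P 0 P by [].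
rewrite {2}/P => /code_at_cat [Hc] /code_at_cat [Hm] /code_at_cons [Hh _].
have [|||t [m [Ht Hx Hv Hm']]] :=
  @comp_ok K 0 e [:: 1] 2 0 P (init [:: n]).2 [:: n] Hw erefl isT _ _ Hc _ => //.
  by case.
exists (t + 2); rewrite execD Hx (@exec_straight P _ (move 1 2)) //=.
split; first by rewrite /halted /= in Hh *; rewrite Hh.
have m0 : m 0 = 1 by rewrite Hm'.
rewrite /output [X in iota 0 X](_ : _ = 1); last by rewrite /straight /= !updE.
by rewrite /= /straight /= !updE /= Hv eval_pure ?Hf.
Qed.

(** * Functions on encodable types computed by pure expressions *)

Definition cpair (a b : nat) : nat := 2 ^ a * b.*2.+1.

Lemma cpair_gt0 a b : 0 < cpair a b.
Proof. by rewrite /cpair muln_gt0 expn_gt0. Qed.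

(** The second factor of the code is odd, so its 2-adic valuation is [a]; injectivity and the
    decoder [fstE] both rest on this. *)
Lemma dvdn_cpair a b i : (2 ^ i %| cpair a b) = (i <= a).
Proof.
rewrite pfactor_dvdn ?cpair_gt0 // lognM ?expn_gt0 // pfactorK //.
by rewrite (@lognE 2 b.*2.+1) /= dvdn2 /= odd_double addn0.
Qed.

Lemma cpair_inj a b a' b' : cpair a b = cpair a' b' -> a = a' /\ b = b'.
Proof.
move=> E; have Ea : a = a'.
  apply/eqP; rewrite eqn_leq -(dvdn_cpair a' b') -E dvdn_cpair leqnn /=.
  by rewrite -(dvdn_cpair a b) E dvdn_cpair leqnn.
split=> //; move: E; rewrite Ea /cpair => /eqP.
by rewrite eqn_pmul2l ?expn_gt0 // eqSS => /eqP /double_inj.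
Qed.

Lemma cpair_ltl a b : a < cpair a b.
Proof. by apply: leq_trans (ltn_expl a (isT : 1 < 2)) _; rewrite leq_pmulr. Qed.

Lemma cpair_ltr a b : b < cpair a b.
Proof.
apply: leq_trans (_ : b.*2.+1 <= _); first by rewrite ltnS -addnn leq_addr.
by rewrite leq_pmull ?expn_gt0.
Qed.

Lemma leq_cpair a b a' b' : a <= a' -> b <= b' -> cpair a b <= cpair a' b'.
Proof. by move=> Ha Hb; rewrite leq_mul ?leq_pexp2l // ltnS leq_double. Qed.

(** * Codes of data by natural numbers *)

Class encodable (T : Type) := Encodable { enc : T -> nat; enc_inj : injective enc }.

#[export] Instance enc_nat : encodable nat := Encodable (@inj_id nat).

Lemma nat_of_bool_inj : injective nat_of_bool.
Proof. by case; case. Qed.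
#[export] Instance enc_bool : encodable bool := Encodable nat_of_bool_inj.

Section EncPair.
Context {A B : Type} {encA : encodable A} {encB : encodable B}.
Definition pair_enc (z : A * B) : nat := cpair (enc z.1) (enc z.2).
Lemma pair_enc_inj : injective pair_enc.
Proof. by case=> a b [a' b'] /cpair_inj /= [/(@enc_inj A) -> /(@enc_inj B) ->]. Qed.
#[export] Instance enc_pair : encodable (A * B) := Encodable pair_enc_inj.
End EncPair.

Section EncSeq.
Context {A : Type} {encA : encodable A}.
(** Since [cpair] is never 0, the value 0 is free for the empty list, and a test for zero is a test
    for emptiness. *)
Fixpoint seq_enc (s : seq A) : nat :=
  if s is y :: r then cpair (enc y) (seq_enc r) else 0.
Lemma seq_enc_inj : injective seq_enc.
Proof.
elim=> [|y s IH] [|y' s'] //=.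
- by move=> /esym/eqP; rewrite eqn0Ngt cpair_gt0.
- by move=> /eqP; rewrite eqn0Ngt cpair_gt0.
- by case/cpair_inj=> /(@enc_inj A) -> /IH ->.
Qed.
#[export] Instance enc_seq : encodable (seq A) := Encodable seq_enc_inj.
(** The code of a list can thus serve as the number of rounds of a loop running through the list. *)
Lemma size_enc (s : seq A) : size s <= enc s.
Proof. by elim: s => //= y s IH; apply: leq_ltn_trans IH (cpair_ltr _ _). Qed.
End EncSeq.

Definition computes {A B : Type} {encA : encodable A} {encB : encodable B}
    (e : expr) (f : A -> B) : Prop :=
  [/\ pure e, wf 0 1 e & forall x, peval e [:: enc x] = enc (f x)].

(** Primitive recursive functions on coded data: [Rec] is primitive recursion with parameters. *)
Definition prf {A B : Type} {encA : encodable A} {encB : encodable B}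
  (f : A -> B) : Prop := exists e, computes e f.

(** * Arithmetic and decoding by primitive recursion *)

Definition prim2 (h : nat -> nat -> nat) : Prop :=
  exists e, [/\ pure e, wf 0 2 e & forall a b, peval e [:: a; b] = h a b].

Lemma iteriS T n (f : nat -> T -> T) x : iteri n.+1 f x = f n (iteri n f x).
Proof. by []. Qed.

Lemma prim2_add : prim2 addn.
Proof. by exists (Add (Var 0) (Var 1)). Qed.

Lemma prim2_sub : prim2 subn.
Proof. by exists (Sub (Var 0) (Var 1)). Qed.

Definition mulE := Rec (Var 1) (Cst 0) (Add (Var 0) (Var 2)).

Lemma mulE_eval K M a b : eval K M mulE [:: a; b] = a * b.
Proof.
rewrite /=; elim: b => [|b IH]; first by rewrite muln0.
by rewrite iteriS IH mulnS addnC.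
Qed.

Lemma prim2_mul : prim2 muln.
Proof. by exists mulE; split=> // a b; exact: mulE_eval. Qed.

Definition pow2E := Rec (Var 0) (Cst 1) (Add (Var 0) (Var 0)).

Lemma pow2E_eval K M a env : eval K M pow2E (a :: env) = 2 ^ a.
Proof.
rewrite /=; elim: a => // a IH.
by rewrite iteriS /= IH expnS mul2n addnn.
Qed.

Definition pairE :=
  App2 mulE (Let (Var 0) pow2E) (Add (Add (Var 1) (Var 1)) (Cst 1)).

Lemma pairE_eval K M a b : eval K M pairE [:: a; b] = cpair a b.
Proof.
rewrite -[LHS]/(eval K M mulE [:: eval K M pow2E [:: a; a; b]; b + b + 1]).
by rewrite mulE_eval pow2E_eval /cpair addnn addn1.
Qed.

Lemma prim2_pair : prim2 cpair.
Proof. by exists pairE; split=> // a b; exact: pairE_eval. Qed.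

(** The remainder is found by counting up to [a] and returning to 0 at each multiple of [b]. The
    time is linear in the value [a], affordable for numbers bounded in terms of [m] but not for vote
    counts. *)
Definition modE := Rec (Var 0) (Cst 0)
  (Ite (Sub (Var 3) (Add (Var 0) (Cst 1))) (Add (Var 0) (Cst 1)) (Cst 0)).

Lemma modE_eval K M a b : 0 < b -> eval K M modE [:: a; b] = a %% b.
Proof.
move=> b0; rewrite /=; elim: a => [|a IH]; first by rewrite mod0n.
rewrite iteriS IH -[a.+1]addn1 -(modnDml a) /=.
have := ltn_pmod a b0; move: (a %% b) => r; rewrite leq_eqVlt addn1 => /orP[/eqP E|Hlt].
  by rewrite E subnn modnn.
by rewrite ifN ?modn_small //; lia.
Qed.

Definition divE := Rec (Var 0) (Cst 0)
  (Ite (App2 modE (Add (Var 1) (Cst 1)) (Var 3)) (Var 0) (Add (Var 0) (Cst 1))).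

Lemma divE_eval K M a b : 0 < b -> eval K M divE [:: a; b] = a %/ b.
Proof.
move=> b0; elim: a => [|a IH]; first by rewrite div0n.
rewrite -[LHS]/(if eval K M modE [:: a + 1; b] == 0
  then eval K M divE [:: a; b] + 1 else eval K M divE [:: a; b]) IH modE_eval //.
by rewrite addn1 divnS // /dvdn; case: eqP => _; rewrite ?addn1 ?add1n ?add0n.
Qed.

(** Keeps the last [i + 1] for which [2 ^ (i + 1)] divides the code. The code itself is a sufficient
    search bound, since [a < cpair a b]. *)
Definition fstE := Rec (Var 0) (Cst 0)
  (Ite (App2 modE (Var 2) (Let (Add (Var 1) (Cst 1)) pow2E)) (Var 0) (Add (Var 1) (Cst 1))).

Lemma fstE_eval K M a b env : eval K M fstE (cpair a b :: env) = a.
Proof.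
set c := cpair a b.
rewrite -[LHS]/(iteri c (fun i acc => if eval K M modE [:: c;
   eval K M pow2E [:: i + 1, acc, i, c & env]] == 0 then i + 1 else acc) 0).
have -> : iteri c (fun i acc => if eval K M modE [:: c;
   eval K M pow2E [:: i + 1, acc, i, c & env]] == 0 then i + 1 else acc) 0 =
   iteri c (fun i acc => if i < a then i.+1 else acc) 0.
  apply: eq_iteri => i y; rewrite pow2E_eval modE_eval ?expn_gt0 // addn1.
  by rewrite -/(dvdn _ _) dvdn_cpair.
have H k : iteri k (fun i acc => if i < a then i.+1 else acc) 0 = minn k a.
  elim: k => [|k IH]; first by rewrite min0n.
  by rewrite iteriS IH; case: ifP; lia.
by rewrite H; apply/minn_idPr/ltnW/cpair_ltl.
Qed.

Definition sndE :=
  App2 divE (Var 0) (Let (Add (Let (Var 0) fstE) (Cst 1)) pow2E).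

Lemma sndE_eval K M a b env : eval K M sndE (cpair a b :: env) = b.
Proof.
set c := cpair a b.
rewrite -[LHS]/(eval K M divE [:: c; eval K M pow2E
  [:: eval K M fstE [:: c, c & env] + 1, c & env]]).
rewrite fstE_eval pow2E_eval divE_eval ?expn_gt0 // /c /cpair addn1 expnS mulnC.
by rewrite divnMr ?expn_gt0 // divn2 /= uphalf_double.
Qed.

Lemma wf_mono g n k e : n <= k -> wf g n e -> wf g k e.
Proof.
elim: e n k => //= [i|a IHa b IHb|a IHa b IHb|c IHc a IHa b IHb|a IHa b IHb
  |f IHf a IHa b IHb|c IHc b IHb s IHs] n k nk.
- by move=> H; apply: leq_trans nk.
- by case/andP=> /(IHa _ _ nk) -> /(IHb _ _ nk) ->.
- by case/andP=> /(IHa _ _ nk) -> /(IHb _ _ nk) ->.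
- by case/and3P=> /(IHc _ _ nk) -> /(IHa _ _ nk) -> /(IHb _ _ nk) ->.
- by case/andP=> /(IHa _ _ nk) -> /(IHb n.+1 k.+1 nk) ->.
- by case/and3P=> -> /(IHa _ _ nk) -> /(IHb _ _ nk) ->.
- by case/and3P=> /(IHc _ _ nk) -> /(IHb _ _ nk) -> /(IHs n.+2 k.+2 nk) ->.
Qed.

(** * Closure properties of primitive recursive functions *)

Section Closure.
Context {X : Type} {encX : encodable X}.

Lemma prf_ext {B : Type} {encB : encodable B} (f f' : X -> B) : f =1 f' -> prf f -> prf f'.
Proof. by move=> H [e [p w E]]; exists e; split=> // x; rewrite E H. Qed.

Lemma prf_cst {B : Type} {encB : encodable B} (c : B) : prf (fun _ : X => c).
Proof. by exists (Cst (enc c)). Qed.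

Lemma prf_id : prf (fun x : X => x).
Proof. by exists (Var 0). Qed.

Lemma prf_comp {A B : Type} {encA : encodable A} {encB : encodable B}
  (g : A -> B) (f : X -> A) : prf g -> prf f -> prf (fun x => g (f x)).
Proof.
move=> [eg [pg wg Eg]] [ef [pf wf_ Ef]]; exists (Let ef eg); split=> /=.
- by rewrite pf pg.
- by rewrite wf_ (wf_mono _ wg).
- by move=> x; rewrite peval1 ?Ef ?Eg.
Qed.

Lemma prf_op2 h (f f' : X -> nat) : prim2 h -> prf f -> prf f' ->
  prf (fun x => h (f x) (f' x)).
Proof.
move=> [eh [ph wh Eh]] [e [p w E]] [e' [p' w' E']]; exists (App2 eh e e').
by split=> [||x] /=; rewrite ?ph ?p ?p' ?wh ?w ?w' ?E ?E' ?Eh.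
Qed.

Lemma prf_add (f f' : X -> nat) : prf f -> prf f' -> prf (fun x => f x + f' x).
Proof. exact: prf_op2 prim2_add. Qed.

Lemma prf_sub (f f' : X -> nat) : prf f -> prf f' -> prf (fun x => f x - f' x).
Proof. exact: prf_op2 prim2_sub. Qed.

Lemma prf_mul (f f' : X -> nat) : prf f -> prf f' -> prf (fun x => f x * f' x).
Proof. exact: prf_op2 prim2_mul. Qed.

Lemma prf_succ (f : X -> nat) : prf f -> prf (fun x => (f x).+1).
Proof.
by move=> Hf; apply: prf_ext (prf_add Hf (prf_cst 1)) => x; rewrite addn1.
Qed.

Lemma prf_if {B : Type} {encB : encodable B} (c : X -> bool) (f f' : X -> B) :
  prf c -> prf f -> prf f' -> prf (fun x => if c x then f x else f' x).
Proof.
move=> [ec [pc wc Ec]] [e [p w E]] [e' [p' w' E']]; exists (Ite ec e e').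
split=> [||x] /=; rewrite ?pc ?p ?p' ?wc ?w ?w' ?E ?E' ?Ec //.
by case: (c x).
Qed.

Lemma prf_leq (f f' : X -> nat) : prf f -> prf f' -> prf (fun x => f x <= f' x).
Proof.
move=> [e [p w E]] [e' [p' w' E']]; exists (Ite (Sub e e') (Cst 0) (Cst 1)).
by split=> [||x] /=; rewrite ?p ?p' ?w ?w' ?E ?E' //= subn_eq0; case: leq.
Qed.

Lemma prf_negb (f : X -> bool) : prf f -> prf (fun x => ~~ f x).
Proof. by move=> Hf; apply: prf_ext (prf_if Hf (prf_cst false) (prf_cst true)). Qed.

Lemma prf_andb (f f' : X -> bool) : prf f -> prf f' -> prf (fun x => f x && f' x).
Proof. by move=> Hf Hf'; apply: prf_ext (prf_if Hf Hf' (prf_cst false)). Qed.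

Lemma prf_orb (f f' : X -> bool) : prf f -> prf f' -> prf (fun x => f x || f' x).
Proof. by move=> Hf Hf'; apply: prf_ext (prf_if Hf (prf_cst true) Hf'). Qed.

Lemma prf_enc {B : Type} {encB : encodable B} (f : X -> B) : prf f -> prf (fun x => enc (f x)).
Proof. by []. Qed.

Lemma prf_eq {B : eqType} {encB : encodable B} (f f' : X -> B) :
  prf f -> prf f' -> prf (fun x => f x == f' x).
Proof.
move=> Hf Hf'; apply: prf_ext (prf_andb (prf_leq (prf_enc Hf) (prf_enc Hf'))
  (prf_leq (prf_enc Hf') (prf_enc Hf))) => x.
by rewrite -eqn_leq; apply/eqP/eqP => [/(@enc_inj B)|->].
Qed.

Lemma prf_bool (f : X -> bool) : prf f -> prf (fun x => nat_of_bool (f x)).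
Proof. by []. Qed.

Lemma prf_pair {A B : Type} {encA : encodable A} {encB : encodable B}
  (f : X -> A) (f' : X -> B) : prf f -> prf f' -> prf (fun x => (f x, f' x)).
Proof. by move=> Hf Hf'; have := prf_op2 prim2_pair (prf_enc Hf) (prf_enc Hf'). Qed.

Lemma prf_fst {A B : Type} {encA : encodable A} {encB : encodable B}
  (f : X -> A * B) : prf f -> prf (fun x => (f x).1).
Proof.
move=> Hf; apply: (prf_comp (g := fst)) Hf; exists fstE; split=> // -[a b].
exact: fstE_eval.
Qed.

Lemma prf_snd {A B : Type} {encA : encodable A} {encB : encodable B}
  (f : X -> A * B) : prf f -> prf (fun x => (f x).2).
Proof.
move=> Hf; apply: (prf_comp (g := snd)) Hf; exists sndE; split=> // -[a b].
exact: sndE_eval.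
Qed.

Lemma prf_iteri {B : Type} {encB : encodable B} (n : X -> nat) (b : X -> B)
    (h : X -> nat -> B -> B) :
  prf (fun z : X * (nat * B) => h z.1 z.2.1 z.2.2) -> prf n -> prf b ->
  prf (fun x => iteri (n x) (h x) (b x)).
Proof.
move=> [eh [ph wh Eh]] [en [pn wn En]] [eb [pb wb Eb]].
exists (Rec en eb (Let (App2 pairE (Var 2) (App2 pairE (Var 1) (Var 0))) eh)).
split; rewrite ?[pure _]/= ?[wf _ _ _]/= ?ph ?pn ?pb ?wn ?wb ?(wf_mono _ wh) // => x.
have E : forall k, iteri k (fun i acc => peval
    (Let (App2 pairE (Var 2) (App2 pairE (Var 1) (Var 0))) eh) [:: acc; i; enc x])
    (enc (b x)) = enc (iteri k (h x) (b x)).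
  elim=> // k IH; rewrite !iteriS IH -[LHS]/(peval eh [:: peval pairE
    [:: enc x; peval pairE [:: k; enc (iteri k (h x) (b x))]],
    enc (iteri k (h x) (b x)), k & [:: enc x]]).
  rewrite !pairE_eval peval1 //.
  exact: (Eh (x, (k, iteri k (h x) (b x)))).
by rewrite -[LHS]/(iteri (peval en [:: enc x]) _ (peval eb [:: enc x])) En Eb E.
Qed.

Lemma prf_cons {A : Type} {encA : encodable A} (f : X -> A) (s : X -> seq A) :
  prf f -> prf s -> prf (fun x => f x :: s x).
Proof. by move=> Hf Hs; have := prf_op2 prim2_pair (prf_enc Hf) (prf_enc Hs). Qed.

Lemma prf_case {A B : Type} {encA : encodable A} {encB : encodable B}
    (s : X -> seq A) (f : X -> A -> seq A -> B) (f0 : X -> B) :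
  prf (fun z : X * (A * seq A) => f z.1 z.2.1 z.2.2) -> prf s -> prf f0 ->
  prf (fun x => if s x is y :: r then f x y r else f0 x).
Proof.
move=> [e [p w E]] [es [ps ws Es]] [e0 [p0 w0 E0]].
exists (Let es (Ite (Var 0) (Let (App2 pairE (Var 1) (Var 0)) e) (Let (Var 1) e0))).
split=> [||x]; first by rewrite /= p ps p0.
  by rewrite /= ws !(wf_mono (k := 3) _ (n := 1)).
rewrite -[LHS]/(let v := peval es [:: enc x] in if v == 0
  then peval e0 [:: enc x, v & [:: enc x]]
  else peval e [:: peval pairE [:: enc x; v], v & [:: enc x]]) Es.
case: (s x) => [|y r]; first by rewrite -[LHS]/(peval e0 [:: enc x, 0 & [:: enc x]]) peval1.
cbv zeta; rewrite ifN; last by rewrite -lt0n cpair_gt0.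
by rewrite peval1 // pairE_eval (E (x, (y, r))).
Qed.

End Closure.

Ltac prf_hook := fail.
Ltac prf_step := first
  [ apply: prf_cst | apply: prf_id | prf_hook
  | apply: prf_fst | apply: prf_snd | apply: prf_pair | apply: prf_cons
  | apply: prf_add | apply: prf_sub | apply: prf_mul | apply: prf_succ
  | apply: prf_leq | apply: prf_eq | apply: prf_andb | apply: prf_orb | apply: prf_negb
  | apply: prf_case | apply: prf_if | apply: prf_iteri | apply: prf_bool ].
Ltac prf_tac := repeat (prf_step; cbv beta).

Section ListFoldl.
Context {X : Type} {encX : encodable X}.
Context {A B : Type} {encA : encodable A} {encB : encodable B}.
Implicit Types (s : X -> seq A).

Lemma prf_foldl (h : X -> B -> A -> B) (b : X -> B) s :
  prf (fun z : X * (B * A) => h z.1 z.2.1 z.2.2) -> prf b -> prf s ->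
  prf (fun x => foldl (h x) (b x) (s x)).
Proof.
move=> Hh Hb Hs.
pose step x (st : B * seq A) := if st.2 is y :: r then (h x st.1 y, r) else st.
have Hstep : prf (fun z : X * (nat * (B * seq A)) => step z.1 z.2.2).
  apply: prf_case; [|by prf_tac..].
  apply: prf_pair; last by prf_tac.
  by apply: (prf_comp (f := fun z : (X * (nat * (B * seq A))) * (A * seq A) =>
    (z.1.1, (z.1.2.2.1, z.2.1)))) Hh _; prf_tac.
(* The state pairs the accumulator with the rest of the list. The number of rounds is the code of
   the list, at least its length, and the surplus rounds meet an empty list and change nothing. *)
apply: prf_ext (prf_fst (prf_iteri (h := fun x _ st => step x st) Hstep
  (prf_enc Hs) (prf_pair Hb Hs))) => x.
have E k : iteri k (fun _ => step x) (b x, s x) = (foldl (h x) (b x) (take k (s x)), drop k (s x)).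
  elim: k => [|k IH]; first by rewrite take0 drop0.
  rewrite iteriS IH /step /=; case E: (drop k (s x)) => [|y r].
    have Hk : size (s x) <= k by rewrite -subn_eq0 -size_drop E.
    by rewrite !take_oversize ?drop_oversize //; apply: leqW.
  have Hk : k < size (s x) by rewrite -subn_gt0 -size_drop E.
  move: E; rewrite (drop_nth y Hk) => -[E1 E2].
  by rewrite (take_nth y Hk) E1 -cats1 foldl_cat -E2.
by rewrite E /= take_oversize // size_enc.
Qed.

End ListFoldl.

Section ListRev.
Context {X A : Type} {encX : encodable X} {encA : encodable A}.

Lemma prf_rev (s : X -> seq A) : prf s -> prf (fun x => rev (s x)).
Proof.
move=> Hs; apply: (prf_ext (f := fun x => foldl (fun r y => y :: r) [::] (s x))) => [x|].
  by rewrite -[s x]revK foldl_rev revK; elim: (rev (s x)) => //= y r ->.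
by apply: prf_foldl => //; prf_tac.
Qed.

End ListRev.

Section ListFoldr.
Context {X : Type} {encX : encodable X}.
Context {A B : Type} {encA : encodable A} {encB : encodable B}.
Implicit Types (s : X -> seq A).

Lemma prf_foldr (h : X -> A -> B -> B) (b : X -> B) s :
  prf (fun z : X * (A * B) => h z.1 z.2.1 z.2.2) -> prf b -> prf s ->
  prf (fun x => foldr (h x) (b x) (s x)).
Proof.
move=> Hh Hb Hs; apply: (prf_ext (f := fun x => foldl (fun r y => h x y r) (b x) (rev (s x)))) => [x|].
  by rewrite foldl_rev.
apply: prf_foldl; [|by []|exact: prf_rev].
by apply: (prf_comp (f := fun z : X * (B * A) => (z.1, (z.2.2, z.2.1)))) Hh _; prf_tac.
Qed.

End ListFoldr.

Section ListOps.
Context {X : Type} {encX : encodable X}.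
Context {A B : Type} {encA : encodable A} {encB : encodable B}.
Implicit Types (s : X -> seq A).

Lemma prf_map (h : X -> A -> B) s : prf (fun z : X * A => h z.1 z.2) -> prf s ->
  prf (fun x => map (h x) (s x)).
Proof.
move=> Hh Hs; apply: (prf_ext (f := fun x => foldr (fun y r => h x y :: r) [::] (s x))) => [x|].
  by elim: (s x) => //= y r ->.
apply: prf_foldr => //; last by prf_tac.
apply: prf_cons; last by prf_tac.
by apply: (prf_comp (f := fun z : X * (A * seq B) => (z.1, z.2.1))) Hh _; prf_tac.
Qed.

Lemma prf_filter (h : X -> A -> bool) s : prf (fun z : X * A => h z.1 z.2) -> prf s ->
  prf (fun x => filter (h x) (s x)).
Proof.
move=> Hh Hs; apply: (prf_ext (f := fun x =>
  foldr (fun y r => if h x y then y :: r else r) [::] (s x))) => [x|].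
  by elim: (s x) => //= y r ->.
apply: prf_foldr => //; last by prf_tac.
apply: prf_if; [|by prf_tac..].
by apply: (prf_comp (f := fun z : X * (A * seq A) => (z.1, z.2.1))) Hh _; prf_tac.
Qed.

Lemma prf_all (h : X -> A -> bool) s : prf (fun z : X * A => h z.1 z.2) -> prf s ->
  prf (fun x => all (h x) (s x)).
Proof.
move=> Hh Hs; apply: (prf_ext (f := fun x => foldr (fun y r => h x y && r) true (s x))) => [x|].
  by elim: (s x) => //= y r ->.
apply: prf_foldr => //; last by prf_tac.
apply: prf_andb; [|by prf_tac..].
by apply: (prf_comp (f := fun z : X * (A * bool) => (z.1, z.2.1))) Hh _; prf_tac.
Qed.

Lemma prf_has (h : X -> A -> bool) s : prf (fun z : X * A => h z.1 z.2) -> prf s ->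
  prf (fun x => has (h x) (s x)).
Proof.
move=> Hh Hs; apply: (prf_ext (f := fun x => foldr (fun y r => h x y || r) false (s x))) => [x|].
  by elim: (s x) => //= y r ->.
apply: prf_foldr => //; last by prf_tac.
apply: prf_orb; [|by prf_tac..].
by apply: (prf_comp (f := fun z : X * (A * bool) => (z.1, z.2.1))) Hh _; prf_tac.
Qed.

Lemma prf_size s : prf s -> prf (fun x => size (s x)).
Proof.
move=> Hs; apply: (prf_ext (f := fun x => foldr (fun _ r => r.+1) 0 (s x))) => [x|].
  by elim: (s x) => //= y r ->.
by apply: prf_foldr => //; prf_tac.
Qed.

Lemma prf_cat s s' : prf s -> prf s' -> prf (fun x => s x ++ s' x).
Proof.
move=> Hs Hs'; apply: (prf_ext (f := fun x => foldr cons (s' x) (s x))) => [x|].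
  by elim: (s x) => //= y r ->.
by apply: prf_foldr => //; prf_tac.
Qed.

Lemma prf_nth (d : X -> A) s (n : X -> nat) : prf d -> prf s -> prf n ->
  prf (fun x => nth (d x) (s x) (n x)).
Proof.
move=> Hd Hs Hn; apply: (prf_ext (f := fun x =>
  if iteri (n x) (fun _ r => if r is y :: r' then r' else [::]) (s x) is y :: r
  then y else d x)) => [x|]; last by prf_tac.
have -> k : iteri k (fun _ r => if r is y :: r' then r' else [::]) (s x) = drop k (s x).
  elim: k => [|k IH]; first by rewrite drop0.
  by rewrite iteriS IH -add1n -drop_drop; case: drop => //= y r; rewrite drop0.
case E: (drop (n x) (s x)) => [|y r].
  by rewrite nth_default // -subn_eq0 -size_drop E.
by rewrite -[n x]addn0 -nth_drop E.
Qed.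

Lemma prf_iter (h : X -> B -> B) (n : X -> nat) (b : X -> B) :
  prf (fun z : X * B => h z.1 z.2) -> prf n -> prf b ->
  prf (fun x => iter (n x) (h x) (b x)).
Proof.
move=> Hh Hn Hb; apply: (prf_ext (f := fun x => iteri (n x) (fun _ => h x) (b x))) => [x|].
  by elim: (n x) => // k IH; rewrite iteriS IH.
apply: prf_iteri => //.
by apply: (prf_comp (f := fun z : X * (nat * B) => (z.1, z.2.2))) Hh _; prf_tac.
Qed.

Lemma prf_minn (f f' : X -> nat) : prf f -> prf f' -> prf (fun x => minn (f x) (f' x)).
Proof. by move=> Hf Hf'; rewrite /minn; prf_tac. Qed.

Lemma prf_iota (f n : X -> nat) : prf f -> prf n -> prf (fun x => iota (f x) (n x)).
Proof.
move=> Hf Hn; apply: (prf_ext (f := fun x => rev (iteri (n x) (fun i r => f x + i :: r) [::]))) => [x|].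
  elim: (n x) => // k IH; rewrite iteriS rev_cons IH -[k.+1]addn1 iotaD cats1 //.
apply: prf_rev; apply: prf_iteri; [|by prf_tac..].
apply: prf_cons; last by prf_tac.
apply: prf_add; last by prf_tac.
by apply: (prf_comp (g := f)) => //; prf_tac.
Qed.

Lemma prf_half (f : X -> nat) : prf f -> prf (fun x => (f x)./2).
Proof.
move=> Hf; apply: (prf_comp (g := half)) Hf; exists (App2 divE (Var 0) (Cst 2)).
by split=> // x; rewrite -divn2 -(divE_eval 0 (fun=> 0) x (b := 2)).
Qed.

Lemma prf_exp2 (f : X -> nat) : prf f -> prf (fun x => 2 ^ f x).
Proof.
move=> Hf; apply: (prf_comp (g := fun n => 2 ^ n)) Hf; exists pow2E.
by split=> // x; exact: pow2E_eval.
Qed.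

Lemma prf_expn (f : X -> nat) k : prf f -> prf (fun x => f x ^ k).
Proof.
move=> Hf; elim: k => [|k IH]; first by apply: prf_ext (prf_cst 1).
by apply: prf_ext (prf_mul Hf IH) => x; rewrite expnS.
Qed.

End ListOps.

Section ListNested.
Context {X : Type} {encX : encodable X}.

Lemma prf_flatten {A : Type} {encA : encodable A} (s : X -> seq (seq A)) :
  prf s -> prf (fun x => flatten (s x)).
Proof.
move=> Hs; apply: prf_foldr => //; last by prf_tac.
by apply: prf_cat; prf_tac.
Qed.

Lemma prf_sumn (s : X -> seq nat) : prf s -> prf (fun x => sumn (s x)).
Proof. by move=> Hs; apply: prf_foldr => //; prf_tac. Qed.

Lemma prf_mem {A : eqType} {encA : encodable A} (f : X -> A) (s : X -> seq A) :
  prf f -> prf s -> prf (fun x => f x \in s x).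
Proof.
move=> Hf Hs; apply: (prf_ext (f := fun x => has (fun y => y == f x) (s x))) => [x|].
  by rewrite -[has _ _]/(has (pred1 (f x)) (s x)) has_pred1.
apply: prf_has => //; apply: prf_eq; first by prf_tac.
by apply: (prf_comp (g := f)) => //; prf_tac.
Qed.

Lemma prf_index {A : eqType} {encA : encodable A} (f : X -> A) (s : X -> seq A) :
  prf f -> prf s -> prf (fun x => index (f x) (s x)).
Proof.
move=> Hf Hs; apply: (prf_ext (f := fun x =>
  foldr (fun y r => if y == f x then 0 else r.+1) 0 (s x))) => [x|].
  by elim: (s x) => //= y r ->.
apply: prf_foldr => //; last by prf_tac.
apply: prf_if; [|by prf_tac..]; apply: prf_eq; first by prf_tac.
by apply: (prf_comp (g := f)) => //; prf_tac.
Qed.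

Lemma prf_allpairs {A A' B : Type} {encA : encodable A} {encA' : encodable A'}
    {encB : encodable B} (h : X -> A -> A' -> B) (s : X -> seq A) (s' : X -> A -> seq A') :
  prf (fun z : (X * A) * A' => h z.1.1 z.1.2 z.2) -> prf s ->
  prf (fun z : X * A => s' z.1 z.2) ->
  prf (fun x => [seq h x y z | y <- s x, z <- s' x y]).
Proof.
move=> Hh Hs Hs'; apply: prf_flatten; apply: prf_map => //.
by apply: prf_map.
Qed.

End ListNested.

Ltac prf_list := first
  [ apply: prf_allpairs | apply: prf_map | apply: prf_filter | apply: prf_all | apply: prf_has
  | apply: prf_size | apply: prf_cat | apply: prf_nth | apply: prf_iter | apply: prf_minn
  | apply: prf_iota | apply: prf_half | apply: prf_exp2 | apply: prf_flatten | apply: prf_sumn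
  | apply: prf_mem | apply: prf_index | apply: prf_foldl | apply: prf_foldr | apply: prf_rev ].
Ltac prf_hook ::= prf_list.

(** * Running time of pure expressions *)

Definition bounds (n : nat) (e : expr) (b : nat -> nat) : Prop :=
  [/\ prf b, {homo b : x y / x <= y}, forall x, x <= b x &
      forall x env, (forall i, i < n -> nth 0 env i <= x) ->
        peval e env <= b x /\ pcost e env <= b x].

(** Value and cost are bounded together, because the cost of [Let], [App2] and [Rec] depends on
    intermediate values. That the bound is again [prf] makes the final [f] computable. *)
Lemma pure_bounds n e : pure e -> wf 0 n e -> exists b, bounds n e b.
Proof.
elim: e n => //= [i|c|a IHa b IHb|a IHa b IHb|c IHc a IHa b IHb|a IHa b IHb
  |f IHf a IHa b IHb|c IHc b IHb s IHs] n.
- move=> _ Hi; exists (fun x => x + 2); split=> [|x y|x|x env H]; [by prf_tac|lia..|].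
  by have := H i Hi; rewrite /=; lia.
- move=> _ _; exists (fun x => x + c + 1); split=> [|x y|x|x env H]; [by prf_tac|lia..|].
  by rewrite /=; lia.
- case/andP=> pa pb /andP[wa wb].
  have [Ba [Ra Ma Ia Ha]] := IHa n pa wa; have [Bb [Rb Mb Ib Hb]] := IHb n pb wb.
  exists (fun x => Ba x + Bb x + 1); split=> [|x y xy|x|x env H].
  + by apply: prf_add; [apply: prf_add|prf_tac].
  + by rewrite !leq_add ?Ma ?Mb.
  + by have := Ia x; lia.
  + by have := Ha x env H; have := Hb x env H => /=; lia.
- case/andP=> pa pb /andP[wa wb].
  have [Ba [Ra Ma Ia Ha]] := IHa n pa wa; have [Bb [Rb Mb Ib Hb]] := IHb n pb wb.
  exists (fun x => Ba x + Bb x + 1); split=> [|x y xy|x|x env H].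
  + by apply: prf_add; [apply: prf_add|prf_tac].
  + by rewrite !leq_add ?Ma ?Mb.
  + by have := Ia x; lia.
  + by have := Ha x env H; have := Hb x env H => /=; lia.
- case/and3P=> pc pa pb /and3P[wc wa wb].
  have [Bc [Rc Mc Ic Hc]] := IHc n pc wc.
  have [Ba [Ra Ma Ia Ha]] := IHa n pa wa; have [Bb [Rb Mb Ib Hb]] := IHb n pb wb.
  exists (fun x => Bc x + Ba x + Bb x + 3); split=> [|x y xy|x|x env H].
  + by apply: prf_add; [apply: prf_add; [apply: prf_add|]|prf_tac].
  + by rewrite !leq_add ?Ma ?Mb ?Mc.
  + by have := Ia x; lia.
  + have := Ha x env H; have := Hb x env H; have := Hc x env H => /=.
    by case: ifP; lia.
- case/andP=> pa pb /andP[wa wb].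
  have [Ba [Ra Ma Ia Ha]] := IHa n pa wa; have [Bb [Rb Mb Ib Hb]] := IHb n.+1 pb wb.
  exists (fun x => Bb (Ba x) + Ba x + 2); split=> [|x y xy|x|x env H].
  + by apply: prf_add; [apply: prf_add => //; apply: prf_comp|prf_tac].
  + by rewrite !leq_add ?Ma ?Mb ?Ma.
  + by have := Ia x; lia.
  + have [Ha1 Ha2] := Ha x env H.
    have := Hb (Ba x) (peval a env :: env); case=> [[|i] //= Hi|].
      by apply: leq_trans (H i Hi) (Ia x).
    by move=> /=; lia.
- case/and3P=> pf pa pb /and3P[wf_ wa wb].
  have [Bf [Rf Mf If Hf]] := IHf 2 pf wf_.
  have [Ba [Ra Ma Ia Ha]] := IHa n pa wa; have [Bb [Rb Mb Ib Hb]] := IHb n pb wb.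
  exists (fun x => Bf (Ba x + Bb x) + Ba x + Bb x + 2); split=> [|x y xy|x|x env H].
  + apply: prf_add; [do 2 apply: prf_add => //; apply: (prf_comp (g := Bf)) => //|prf_tac].
    exact: prf_add.
  + by rewrite !leq_add ?Ma ?Mb //; apply: Mf; rewrite leq_add ?Ma ?Mb.
  + by have := Ia x; lia.
  + have [Ha1 Ha2] := Ha x env H; have [Hb1 Hb2] := Hb x env H.
    have := Hf (Ba x + Bb x) [:: peval a env; peval b env]; case=> [[|[|i]] //= Hi|]; try lia.
    by move=> /=; lia.
- case/and3P=> pc pb ps /and3P[wc wb ws].
  have [Bc [Rc Mc Ic Hc]] := IHc n pc wc; have [Bb [Rb Mb Ib Hb]] := IHb n pb wb.
  have [Bs [Rs Ms Is Hs]] := IHs n.+2 ps ws.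
  (* After [k] rounds everything visible to the step is at most the [k]-fold iterate of its bound,
     started at a number dominating the loop count, the initial value and the environment. *)
  pose it k y := iter k Bs y.
  have itS k y : it k y <= it k.+1 y by rewrite /it iterS Is.
  have it_mono k k' y y' : k <= k' -> y <= y' -> it k y <= it k' y'.
    move=> Hk Hy; apply: (@leq_trans (it k y')).
      by rewrite /it; elim: (k) => //= j Hj; apply: Ms.
    by rewrite -(subnK Hk) addnC; elim: (k' - k) => [|j Hj]; rewrite ?addn0 // addnS;
       apply: leq_trans Hj (itS _ _).
  have it_ge k y : y <= it k y by apply: (it_mono 0 k y y).
  exists (fun x => Bc x + Bb x + 5 + Bc x * (it (Bc x) (Bc x + Bb x) + 8)
                   + it (Bc x) (Bc x + Bb x)).
  have Rit : prf (fun x => it (Bc x) (Bc x + Bb x)).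
    apply: prf_iter => //; last exact: prf_add.
    by apply: (prf_comp (g := Bs)) => //; prf_tac.
  split=> [|x y xy|x|x env H].
  + apply: prf_add => //; apply: prf_add.
      by apply: prf_add; [apply: prf_add|prf_tac].
    by apply: prf_mul => //; apply: prf_add => //; prf_tac.
  + have Hit : it (Bc x) (Bc x + Bb x) <= it (Bc y) (Bc y + Bb y).
      by apply: it_mono; rewrite ?leq_add ?Mc ?Mb.
    by rewrite !leq_add ?leq_mul ?leq_add ?Mc ?Mb.
  + by have := Ic x; lia.
  + have [Hc1 Hc2] := Hc x env H; have [Hb1 Hb2] := Hb x env H.
    rewrite [peval _ _]/= [pcost _ _]/=.
    set N := peval c env in Hc1 *; set b0 := peval b env in Hb1 *.
    set F := fun k => iteri k (fun i acc => peval s [:: acc, i & env]) b0.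
    set y0 := Bc x + Bb x.
    have Henv k : k <= N -> F k <= it k y0 ->
        forall i, i < n.+2 -> nth 0 [:: F k, k & env] i <= it k y0.
      move=> Hk HF [|[|i]] //= Hi; apply: leq_trans (it_ge k y0); rewrite /y0.
        by lia.
      by have := H i Hi; have := Ic x; lia.
    have HF k : k <= N -> F k <= it k y0.
      elim: k => [|k IHk] Hk; first by rewrite -[F 0]/b0 -[it 0 y0]/y0 /y0; lia.
      rewrite -[F k.+1]/(peval s [:: F k, k & env]) /it iterS.
      have [Hv _] := Hs (it k y0) [:: F k, k & env] (Henv k (ltnW Hk) (IHk (ltnW Hk))).
      exact: Hv.
    have HN : it N y0 <= it (Bc x) y0 by apply: it_mono.
    split; first by have := HF N (leqnn N); rewrite /F; lia.
    have : \sum_(i < N) (pcost s [:: F i, \val i & env] + 8) <= N * (it (Bc x) y0 + 8).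
      rewrite -[X in X * _]card_ord -sum_nat_const leq_sum // => i _.
      rewrite leq_add2r; have Hi := ltn_ord i.
      have [_ H2] := Hs (it i y0) _ (Henv i (ltnW Hi) (HF i (ltnW Hi))).
      apply: leq_trans H2 _; rewrite -[Bs _]/(it i.+1 y0); apply: it_mono => //; lia.
    move=> Hsum; have : N * (it (Bc x) y0 + 8) <= Bc x * (it (Bc x) y0 + 8) by rewrite leq_mul.
    by move: Hsum; rewrite /F /=; lia.
Qed.

Lemma computes_bound {A B : Type} {encA : encodable A} {encB : encodable B} e (f : A -> B) :
  computes e f -> exists b, [/\ prf b, {homo b : x y / x <= y}, forall x, x <= b x &
    forall x N, enc x <= N -> enc (f x) <= b N /\
      forall K M env, cost K M e (enc x :: env) <= b N].
Proof.
move=> [p w E]; have [b [Rb Mb Ib Hb]] := pure_bounds p w.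
exists b; split=> // x N Hx.
have [|H1 H2] := Hb N [:: enc x]; first by case.
split=> [|K M env]; first by rewrite -E.
by rewrite cost_pure // (cost_env _ _ w (@same_env1 _ _ [::])).
Qed.

Lemma pure2_bound e : pure e -> wf 0 2 e ->
  exists b, [/\ prf b, {homo b : x y / x <= y}, forall x, x <= b x &
    forall x y N K M, x <= N -> y <= N -> cost K M e [:: x; y] <= b N].
Proof.
move=> p w; have [b [Rb Mb Ib Hb]] := pure_bounds p w.
exists b; split=> // x y N K M Hx Hy; rewrite cost_pure //.
by have [|_] := Hb N [:: x; y]; first by case=> [|[|]].
Qed.

Lemma prf_computable (f : nat -> nat) : prf f -> computable_fun f.
Proof. by move=> [e [p w E]]; apply: pure_computable p w E. Qed.

(** * Deciding linear sign conditions digit by digit *)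

Definition words (q n : nat) : seq (seq nat) :=
  iter n (fun ws => [seq a :: w | a <- iota 0 q, w <- ws]) [:: [::]].

Lemma mem_words q n w : (w \in words q n) = (size w == n) && all (fun a => a < q) w.
Proof.
elim: n w => [|n IH] w; first by rewrite /words /= inE; case: w.
rewrite /words iterS -/(words q n); case: w => [|a w] /=.
  by apply/allpairsPdep => -[a [w []]].
rewrite eqSS andbCA -IH; apply/allpairsPdep/andP => [[a' [w' [Ha Hw [-> ->]]]]|[Ha Hw]].
  by rewrite mem_iota in Ha.
by exists a, w; rewrite mem_iota.
Qed.

Definition lin (J : nat) (c x : nat -> nat) : nat :=
  sumn [seq x j * c j | j <- iota 0 J].

Lemma lin_ext J c c' x x' : (forall j, j < J -> c j = c' j) -> (forall j, j < J -> x j = x' j) ->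
  lin J c x = lin J c' x'.
Proof.
move=> Hc Hx; rewrite /lin; congr sumn; apply/eq_in_map => j; rewrite mem_iota /= => Hj.
by rewrite Hc ?Hx.
Qed.

Lemma lin_double J c x e : lin J c (fun j => x j + x j + e j) = lin J c x + lin J c x + lin J c e.
Proof.
rewrite /lin; elim: (iota 0 J) => //= j r ->.
by rewrite !mulnDl; lia.
Qed.

Lemma lin_le J c c' x : (forall j, j < J -> x j <= 1) -> (forall j, j < J -> c j <= c') ->
  lin J c x <= c' * J.
Proof.
move=> Hx Hc; rewrite /lin -[X in _ * X](size_iota 0 J).
have : all (fun j => j < J) (iota 0 J) by apply/allP => j; rewrite mem_iota.
elim: (iota 0 J) => //= j r IH /andP[Hj Hr]; rewrite mulnS leq_add ?IH //.
by rewrite -[c']mul1n leq_mul ?Hx ?Hc.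
Qed.

Section Automaton.
Variables (R J B : nat) (P M : nat -> nat -> nat).
Hypotheses (HP : forall r x, (forall j, j < J -> x j <= 1) -> lin J (P r) x < B)
           (HM : forall r x, (forall j, j < J -> x j <= 1) -> lin J (M r) x <= B).

(* The digits of a state are the values [p - q] of the linear forms, clipped
   to [-B, B] and shifted by [B]; truncated subtraction does the lower clip. *)
Definition trans (s sg e : seq nat) : seq nat :=
  [seq minn (B + B) (nth 0 s r + nth 0 s r + nth 0 sg r + lin J (P r) (nth 0 e)
                     - (B + lin J (M r) (nth 0 e))) | r <- iota 0 R].

(** The new set is filtered out of the list of all states instead of being collected as an image;
    its code then never exceeds the code of that list ([seq_enc_filter]), however many digits are
    read. *)
Definition next (S : seq (seq nat)) (sg : seq nat) : seq (seq nat) :=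
  [seq s' <- words (B + B + 1) R |
     has (fun s => has (fun e => s' == trans s sg e) (words 2 J)) S].

Definition clip (beta x : nat -> nat) : seq nat :=
  [seq minn (B + B) (B + beta r + lin J (P r) x - lin J (M r) x) | r <- iota 0 R].

Lemma nextP S sg s' :
  reflect (exists s e, [/\ s \in S, e \in words 2 J & s' = trans s sg e]) (s' \in next S sg).
Proof.
rewrite mem_filter; apply: (iffP andP) => [[/hasP [s Hs /hasP [e He /eqP E]] _]|].
  by exists s, e.
case=> s [e [Hs He E]]; split.
  by apply/hasP; exists s => //; apply/hasP; exists e => //; rewrite E.
rewrite mem_words E size_map size_iota eqxx; apply/allP => y /mapP [r _ ->].
by rewrite addn1 ltnS geq_minl.
Qed.

Lemma bits_word e j : e \in words 2 J -> nth 0 e j <= 1.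
Proof.
rewrite mem_words => /andP[_ /allP H]; have [Hj|Hj] := ltnP j (size e).
  by rewrite -ltnS H // mem_nth.
by rewrite nth_default.
Qed.

(** Why clipping is harmless: a value of at least [B] passes to at least [2 * B - B = B], and one of
    at most [-B] to at most [-2 * B + 1 + (B - 1) = -B]. The strict inequality in [HP] leaves room
    for the digit from [sg]. *)
Lemma trans_clip beta x sg e : (forall r, nth 0 sg r <= 1) -> e \in words 2 J ->
  trans (clip beta x) sg e =
  clip (fun r => beta r + beta r + nth 0 sg r) (fun j => x j + x j + nth 0 e j).
Proof.
move=> Hs He; apply/eq_in_map => r; rewrite mem_iota /= => Hr.
rewrite !(nth_map 0) ?size_iota // nth_iota // add0n !lin_double.
have Hp := HP r (fun j _ => bits_word j He); have Hm := HM r (fun j _ => bits_word j He).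
move: (lin _ _ (nth 0 e)) (lin _ _ (nth 0 e)) Hp Hm => a b Hp Hm.
move: (lin _ _ x) (lin _ _ x) => p q; have := Hs r; lia.
Qed.

Lemma reachable_states (sig : nat -> seq nat) (beta : nat -> nat -> nat) L :
  (forall i r, nth 0 (sig i) r <= 1) -> (forall r, r < R -> beta 0 r = 0) ->
  (forall i r, i < L -> r < R -> beta i.+1 r = beta i r + beta i r + nth 0 (sig i) r) ->
  forall s, s \in iteri L (fun i S => next S (sig i)) [:: nseq R B] <->
    exists x, (forall j, j < J -> x j < 2 ^ L) /\ s = clip (beta L) x.
Proof.
move=> Hsig H0; elim: L => [|L IH] Hb s.
  (* Before any digit is read all numbers are 0, so each form has value 0, represented by [B]. *)
  have E x : (forall j, j < J -> x j < 1) -> clip (beta 0) x = nseq R B.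
    move=> Hx; rewrite -[R in RHS](size_iota 0 R) -[LHS]/(map _ _).
    have : all (fun r => r < R) (iota 0 R) by apply/allP => r; rewrite mem_iota.
    elim: (iota 0 R) => //= r t IH /andP[Hr /IH ->]; congr (_ :: _).
    have Z c : lin J c x = 0.
      have := @lin_le J c 0 x; rewrite mul0n /lin.
      rewrite (_ : sumn _ = sumn [seq x j * 0 | j <- iota 0 J]).
        by move=> _; elim: (iota 0 J) => //= j u ->; rewrite muln0.
      congr sumn; apply/eq_in_map => j; rewrite mem_iota => Hj.
      by have := Hx j Hj; case: (x j).
    by rewrite H0 // !Z; lia.
  rewrite inE; split=> [/eqP ->|[x [Hx ->]]]; last by rewrite E.
  by exists (fun _ => 0); split=> //; rewrite E.
rewrite iteriS; split=> [/nextP [s1 [e [Hs1 He ->]]]|[x [Hx ->]]].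
  have [x [Hx ->]] := (IH (fun i r Hi => Hb i r (ltnW Hi)) s1).1 Hs1.
  exists (fun j => x j + x j + nth 0 e j); split=> [j Hj|].
    by have := Hx j Hj; have := bits_word j He; rewrite expnS; lia.
  rewrite trans_clip //; apply/eq_in_map => r; rewrite mem_iota => Hr.
  by rewrite Hb.
(* The last digits guessed are the parities of [x], and the preceding state belongs to its
   halves. *)
apply/nextP; exists (clip (beta L) (fun j => (x j)./2)), (mkseq (fun j => nat_of_bool (odd (x j))) J).
have He : mkseq (fun j => nat_of_bool (odd (x j))) J \in words 2 J.
  rewrite mem_words size_mkseq eqxx; apply/allP => a /mapP [j _ ->].
  by case: odd.
split=> //.
  apply/(IH (fun i r Hi => Hb i r (ltnW Hi))); exists (fun j => (x j)./2); split=> // j Hj.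
  by have := Hx j Hj; rewrite expnS; have := odd_double_half (x j); lia.
rewrite trans_clip //; apply/eq_in_map => r; rewrite mem_iota => Hr.
have Ex j : j < J -> (x j)./2 + (x j)./2 + nth 0 (mkseq (fun j => nat_of_bool (odd (x j))) J) j = x j.
  by move=> Hj; rewrite nth_mkseq // addnn addnC odd_double_half.
rewrite Hb //; congr (minn _ (_ + _ - _)); apply: lin_ext => // j Hj; by rewrite Ex.
Qed.

End Automaton.

(** * Ranked pairs from comparisons of majority margins *)

Import Order.TTheory GRing.Theory Num.Theory.

Section GenericRankedPairs.
Variables (lt : nat * nat -> nat * nat -> bool).
Variables (tau : seq nat) (pi : seq (nat * nat)) (m : nat).

Definition swap (q : nat * nat) := (q.2, q.1).

(** Comparison of maxima: [max q < max r] holds iff one of the two weights of [r] exceeds both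
    weights of [q]. *)
Definition wlt (q r : nat * nat) : bool :=
  (lt q r && lt (swap q) r) || (lt q (swap r) && lt (swap q) (swap r)).

Definition gle (q r : nat * nat) : bool :=
  wlt r q || [&& ~~ wlt q r, ~~ wlt r q & index q pi <= index r pi].

(** An insertion sort made of folds and filters only, operations under which [prf] is closed. *)
Definition isort : seq (nat * nat) :=
  foldr (fun q s => [seq r <- s | ~~ gle q r] ++ q :: [seq r <- s | gle q r]) [::] pi.

(** The margin of a candidate against itself is 0, so comparing with [(q.1, q.1)] gives the sign of
    a margin; comparisons of margins are all that ranked pairs needs. *)
Definition gorient (q : nat * nat) : nat * nat :=
  if lt (q.1, q.1) (q.1, q.2) then (q.1, q.2)
  else if lt (q.1, q.1) (q.2, q.1) then (q.2, q.1)
  else if index q.1 tau < index q.2 tau then (q.1, q.2) else (q.2, q.1).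

Definition gstep (R : seq (nat * nat)) (q : nat * nat) : seq (nat * nat) :=
  if implied R q.1 q.2 then R else gorient q :: R.

Definition gfixed : seq (nat * nat) := foldl gstep [::] isort.

Definition gwin : seq nat :=
  [seq c <- iota 0 m | all (fun d => (d == c) || (d \in reachable gfixed c)) (iota 0 m)].

End GenericRankedPairs.

(** * Correctness of insertion sort *)

Lemma foldr_insert_perm (T : eqType) (r : rel T) (l : seq T) :
  perm_eq (foldr (fun q s => [seq y <- s | ~~ r q y] ++ q :: [seq y <- s | r q y]) [::] l) l.
Proof.
elim: l => //= q l IH; rewrite perm_catC /= perm_cons.
by apply: perm_trans IH; rewrite perm_filterC.
Qed.

(** The relation [r'] actually used needs to agree with the total preorder [r] on the list only:
    margins are compared correctly just for indices below [m]. *)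
Lemma foldr_insert_sorted (T : eqType) (r r' : rel T) (l : seq T) :
  total r -> transitive r -> {in l &, r' =2 r} ->
  sorted r (foldr (fun q s => [seq y <- s | ~~ r' q y] ++ q :: [seq y <- s | r' q y]) [::] l).
Proof.
move=> Htot Htr; elim: l => //= q l IH Hr.
have {}IH := IH (fun y z Hy Hz => Hr y z (mem_behead (s := q :: l) Hy) (mem_behead (s := q :: l) Hz)).
set s := foldr _ _ _ in IH *.
have Hs y : y \in s -> r' q y = r q y.
  by rewrite (perm_mem (foldr_insert_perm r' l)) => Hy; rewrite Hr ?mem_head // inE Hy orbT.
rewrite (sorted_pairwise Htr) pairwise_cat /= -!(sorted_pairwise Htr) !sorted_filter // !andbT.
have H2 : all (r q) [seq y <- s | r' q y].
  by apply/allP => y; rewrite mem_filter => /andP[H Hy]; rewrite -Hs.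
rewrite H2 /= andbT; apply/allrelP => y z; rewrite mem_filter => /andP[Hq Hy].
have Hyq : r y q by have := Htot y q; rewrite -[r q y]Hs // (negPf Hq) orbF.
by rewrite inE => /predU1P[->|/(allP H2)] //; apply: Htr.
Qed.

(** * Invariance of ranked pairs under renaming of candidates *)

Section Naturality.
Variables (f : nat -> nat) (f_inj : injective f).
Definition fp (q : nat * nat) := (f q.1, f q.2).

Lemma succs_map R S : succs (map fp R) (map f S) = map f (succs R S).
Proof.
rewrite /succs map_cat filter_map -!map_comp; congr (_ ++ _).
by rewrite (eq_filter (a2 := fun e => e.1 \in S)) // => e /=; rewrite mem_map.
Qed.

Lemma reachable_map R x : reachable (map fp R) (f x) = map f (reachable R x).
Proof.
rewrite /reachable size_map; elim: (size R) => //= n ->; exact: succs_map.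
Qed.

Lemma implied_map R a b : implied (map fp R) (f a) (f b) = implied R a b.
Proof. by rewrite /implied !reachable_map !mem_map. Qed.

Variables (tbc : seq nat -> seq nat) (tbp : seq nat -> seq (nat * nat)).
Variables (C : seq nat) (V : seq (seq nat)) (m : nat).
Variables (lt : nat * nat -> nat * nat -> bool) (tau : seq nat) (pi : seq (nat * nat)).
Hypotheses (HC : C = map f (iota 0 m)) (Htau : tbc C = map f tau) (Hpi : tbp C = map fp pi).
Hypothesis pi_lt : forall q, q \in pi -> (q.1 < m) && (q.2 < m).
Hypothesis pi_uniq : uniq [seq upair q | q <- tbp C].
Hypothesis Hlt : forall a b c d, a < m -> b < m -> c < m -> d < m ->
  lt (a, b) (c, d) = (D V (f a) (f b) < D V (f c) (f d))%R.

Lemma D_diag a : D V a a = 0%R.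
Proof. by rewrite /D subrr. Qed.

Lemma wlt_weight q r : q \in pi -> r \in pi ->
  wlt lt q r = (rp_weight V (fp q) < rp_weight V (fp r))%R.
Proof.
move=> /pi_lt /andP[q1 q2] /pi_lt /andP[r1 r2].
case: q r q1 q2 r1 r2 => [a b] [c d] /= a1 b1 c1 d1.
by rewrite /wlt /rp_weight /swap /= !Hlt // lt_max !gt_max.
Qed.

Lemma orient_map q : q \in pi -> rp_orient tbc C V (fp q) = fp (gorient lt tau q).
Proof.
move=> /pi_lt; case: q => a b /= /andP[a1 b1].
rewrite /gorient /= !Hlt // D_diag Htau !index_map //.
by do 3 case: ifP => //.
Qed.

(** The listed pairs are distinct even up to orientation, so the rank of an unordered pair is its
    position. *)
Lemma rank_index q : q \in pi -> rp_rank tbp C (fp q) = index q pi.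
Proof.
move=> Hq; rewrite /rp_rank; move: pi_uniq; rewrite Hpi -map_comp => Hu.
have Hi : index q pi < size pi by rewrite index_mem.
rewrite -[upair (fp q)]/((upair \o fp) q) -{1}(nth_index (0, 0) Hq).
rewrite -(nth_map _ (0, 0)) // index_uniq //.
by rewrite size_map.
Qed.

(** Both sides are sorted arrangements of the same pairs, and ties are broken by position, so the
    order is antisymmetric on them; the sorted list is then unique, whatever the algorithm. *)
Lemma pairs_map : rp_pairs tbp C V = map fp (isort lt pi).
Proof.
rewrite /rp_pairs Hpi sort_map; congr map.
set le1 := relpre fp _.
have Htot : total le1.
  move=> q r; rewrite /le1 /=; case: (ltgtP (rp_weight V (fp q)) (rp_weight V (fp r))) => //= _.
  exact: leq_total.
have Htr : transitive le1.
  move=> q p r; rewrite /le1 /=.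
  case: (ltgtP (rp_weight V (fp q)) (rp_weight V (fp p))) => //= [H1 _|H1 R1].
    case/orP=> [H2|/andP[/eqP -> _]]; last by rewrite H1.
    by rewrite (lt_trans H2 H1).
  rewrite -H1; case/orP=> [-> //|/andP[-> R2]]; rewrite (leq_trans R1 R2) orbT //.
have Hle : {in pi &, gle lt pi =2 le1}.
  move=> q r Hq Hr; rewrite /gle /le1 /= !wlt_weight // !rank_index //.
  by case: ltgtP.
apply: (@sorted_eq_in _ le1).
- by move=> q p r _ _ _; apply: Htr.
- move=> q r; rewrite !mem_sort => Hq Hr; rewrite -!Hle // /gle !wlt_weight //.
  case: ltgtP => //= _; rewrite -eqn_leq => /eqP E.
  by rewrite -(nth_index (0, 0) Hq) E nth_index.
- exact: sort_sorted.
- exact: foldr_insert_sorted.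
- by rewrite perm_sort perm_sym; apply: foldr_insert_perm.
Qed.

Lemma fixed_map : rp_fixed tbc tbp C V = map fp (gfixed lt tau pi).
Proof.
rewrite /rp_fixed pairs_map /gfixed.
have : {subset isort lt pi <= pi} by move=> q; rewrite (perm_mem (foldr_insert_perm _ _)).
rewrite -[X in foldl _ X (map _ _)]/(map fp [::]).
elim: (isort lt pi) [::] => //= q s IH R Hs.
have -> : rp_step tbc C V (map fp R) (fp q) = map fp (gstep lt tau R q).
  rewrite /rp_step /gstep [implied _ _ _]implied_map; case: ifP => // _.
  by rewrite orient_map // Hs ?mem_head.
by apply: IH => r Hr; apply: Hs; rewrite inE Hr orbT.
Qed.

Lemma winners_map : rp_winners tbc tbp C V = map f (gwin lt tau pi m).
Proof.
rewrite /rp_winners /gwin fixed_map HC filter_map; congr map.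
apply: eq_filter => c /=; rewrite all_map; apply: eq_all => d /=.
by rewrite inj_eq // reachable_map mem_map.
Qed.

End Naturality.

(** * Bribery as a system of linear sign conditions *)

Definition perms (m : nat) : seq (seq nat) := [seq w <- words m m | uniq w].

Definition moves (m : nat) : seq (seq nat * seq nat) :=
  [seq (u, w) | u <- perms m, w <- perms m].

(* Linear forms in the numbers of voters making each move [(u, w)] from vote
   [u] to vote [w]: label [0 :: u] is (voters with vote [u]) - (moves away
   from [u]), label [1] is [k] - (moves changing the vote), and label
   [2; a; b; c; d] is [D a b - D c d] after the bribery. *)
Definition labels (m : nat) : seq (seq nat) :=
  [seq 0 :: u | u <- perms m] ++ [:: 1] :: [seq 2 :: q | q <- words m 4].

(** Positive and negative coefficients are kept in two natural-valued functions. In a margin row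
    [prefers] with [d] above [c] counts positively, because [D c d] is subtracted. *)
Definition gain (l : seq nat) (z : seq nat * seq nat) : nat :=
  if nth 0 l 0 == 2 then
    prefers z.2 (nth 0 l 1) (nth 0 l 2) + prefers z.2 (nth 0 l 4) (nth 0 l 3)
  else 0.

Definition loss (l : seq nat) (z : seq nat * seq nat) : nat :=
  if nth 0 l 0 == 0 then nat_of_bool (l == 0 :: z.1)
  else if nth 0 l 0 == 1 then nat_of_bool (z.1 != z.2)
  else prefers z.2 (nth 0 l 2) (nth 0 l 1) + prefers z.2 (nth 0 l 3) (nth 0 l 4).

Definition nmoves (m : nat) : nat := size (moves m).
(** All coefficients are at most 2, so on 0/1 digits a form is at most twice the number of moves,
    strictly below this [B]. *)
Definition width (m : nat) : nat := nmoves m + nmoves m + 2.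

Definition rowP (m r j : nat) : nat :=
  gain (nth [::] (labels m) r) (nth ([::], [::]) (moves m) j).
Definition rowM (m r j : nat) : nat :=
  loss (nth [::] (labels m) r) (nth ([::], [::]) (moves m) j).

Definition digit (m : nat) (s l : seq nat) : nat := nth 0 s (index l (labels m)).

Definition margin_lt (m : nat) (s : seq nat) (q r : nat * nat) : bool :=
  digit m s [:: 2; q.1; q.2; r.1; r.2] < width m.

Definition goal_pred (constructive unique : bool) (W : seq nat) (p : nat) : bool :=
  if constructive then win_pred unique W p else ~~ win_pred unique W p.

(** States are shifted by [width m]: equality with it says that a form vanishes, so all voters of
    type [u] are assigned a new vote, and [>=] says that the budget form is nonnegative. *)
Definition good_state (constructive unique : bool) (m : nat) (tau : seq nat)
    (pi : seq (nat * nat)) (p : nat) (s : seq nat) : bool :=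
  [&& all (fun u => digit m s (0 :: u) == width m) (perms m),
      width m <= digit m s [:: 1] &
      goal_pred constructive unique (gwin (margin_lt m s) tau pi m) p].

Lemma gain_le l z : gain l z <= 2.
Proof. by rewrite /gain; case: eqP => // _; do 2 case: prefers. Qed.

Lemma loss_le l z : loss l z <= 2.
Proof.
rewrite /loss; case: ifP => _; first by case: eqP.
by case: ifP => _; [case: eqP | do 2 case: prefers].
Qed.

Lemma rowP_lt m r x : (forall j, j < nmoves m -> x j <= 1) ->
  lin (nmoves m) (rowP m r) x < width m.
Proof.
move=> Hx; have := @lin_le (nmoves m) (rowP m r) 2 x Hx (fun j _ => gain_le _ _).
by rewrite /width; lia.
Qed.

Lemma rowM_le m r x : (forall j, j < nmoves m -> x j <= 1) ->
  lin (nmoves m) (rowM m r) x <= width m.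
Proof.
move=> Hx; have := @lin_le (nmoves m) (rowM m r) 2 x Hx (fun j _ => loss_le _ _).
by rewrite /width; lia.
Qed.

Lemma uniq_words q n : uniq (words q n).
Proof.
elim: n => // n IH; rewrite /words iterS -/(words q n); apply: allpairs_uniq => //.
  exact: iota_uniq.
by move=> [a w] [a' w'] _ _ /= [-> ->].
Qed.

Lemma uniq_perms m : uniq (perms m).
Proof. exact/filter_uniq/uniq_words. Qed.

Lemma uniq_moves m : uniq (moves m).
Proof. by apply: allpairs_uniq; rewrite ?uniq_perms // => -[u w] [u' w'] _ _ [-> ->]. Qed.

Lemma mem_moves m u w : ((u, w) \in moves m) = (u \in perms m) && (w \in perms m).
Proof.
apply/allpairsP/andP => [[[u' w'] /= [Hu Hw [-> ->]]] //|[Hu Hw]].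
by exists (u, w).
Qed.

Lemma mem_perms m w : (w \in perms m) = perm_eq w (iota 0 m).
Proof.
rewrite mem_filter mem_words; apply/idP/idP => [/and3P[Hu /eqP Hs /allP Ha]|Hp].
  have Hsub : {subset w <= iota 0 m} by move=> a /Ha; rewrite mem_iota.
  have [|_ E] := uniq_min_size Hu Hsub; first by rewrite size_iota Hs.
  by apply: uniq_perm => //; apply: iota_uniq.
rewrite (perm_uniq Hp) iota_uniq (perm_size Hp) size_iota eqxx /=.
by apply/allP => a; rewrite (perm_mem Hp) mem_iota.
Qed.

(** The naming of indices is continued beyond [C] by numbers larger than all candidates, to obtain
    an injection on all of [nat] as [Naturality] requires. *)
Definition name_of (C : seq nat) (i : nat) : nat :=
  if i < size C then nth 0 C i else (sumn C + i).+1.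

Lemma leq_sumn_mem (s : seq nat) a : a \in s -> a <= sumn s.
Proof.
elim: s => //= b s IH; rewrite inE => /predU1P[->|/IH H]; first exact: leq_addr.
exact: leq_trans H (leq_addl _ _).
Qed.

Section Names.
Variables (C : seq nat).
Hypothesis uC : uniq C.
Local Notation m := (size C).
Local Notation f := (name_of C).
Local Notation idx := (fun a => index a C).

Lemma name_of_inj : injective f.
Proof.
have H i : i < m -> nth 0 C i <= sumn C by move=> Hi; apply: leq_sumn_mem; rewrite mem_nth.
move=> i j; rewrite /name_of; case: ltnP => Hi; case: ltnP => Hj; last by lia.
- by move/eqP; rewrite nth_uniq // => /eqP.
- by move=> E; have := H i Hi; lia.
- by move=> E; have := H j Hj; lia.
Qed.

Lemma map_name_iota : C = map f (iota 0 m).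
Proof.
rewrite -[LHS](mkseq_nth 0); apply/eq_in_map => i; rewrite mem_iota /= => Hi.
by rewrite /name_of Hi.
Qed.

Lemma name_index a : a \in C -> f (idx a) = a.
Proof. by move=> Ha; rewrite /name_of index_mem Ha nth_index. Qed.

Lemma map_name_index s : {subset s <= C} -> map f (map idx s) = s.
Proof.
move=> Hs; rewrite -map_comp -[RHS]map_id; apply/eq_in_map => a /Hs Ha /=.
exact: name_index.
Qed.

Lemma index_name i : i < m -> idx (f i) = i.
Proof. by move=> Hi; rewrite /name_of Hi index_uniq. Qed.

Lemma vote_perms v : is_vote C v -> map idx v \in perms m.
Proof.
rewrite /is_vote mem_perms => /(perm_map idx) H; apply: perm_trans H _.
suff <- : map idx (map f (iota 0 m)) = iota 0 m by rewrite -map_name_iota.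
rewrite -map_comp -[RHS]map_id; apply/eq_in_map => i; rewrite mem_iota /= => Hi.
by rewrite index_name.
Qed.

Lemma perms_vote w : w \in perms m -> is_vote C (map f w).
Proof. by rewrite mem_perms /is_vote {3}map_name_iota => /(perm_map f). Qed.

Lemma vote_sub v : is_vote C v -> {subset v <= C}.
Proof. by move=> /perm_mem H a; rewrite H. Qed.

End Names.

(** * Realising move counts by voters *)

Lemma sum_count (T : eqType) (s Z : seq T) (c : T -> nat) : uniq s -> {subset Z <= s} ->
  \sum_(y <- s) count_mem y Z * c y = \sum_(y <- Z) c y.
Proof.
move=> Hu; elim: Z => [|z Z IH] Hs; first by rewrite big_nil big1.
rewrite big_cons -IH => [|y Hy]; last by apply: Hs; rewrite inE Hy orbT.
under eq_bigr do rewrite /= mulnDl.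
rewrite big_split /=; congr (_ + _).
rewrite (bigD1_seq z) ?Hs ?mem_head //= eqxx mul1n big1 ?addn0 // => y /negPf.
by rewrite eq_sym => ->.
Qed.

(** Voters are served one at a time: the row sum of the first voter's vote [v] is positive, so some
    [x v w0] is; that voter gets [w0], this entry drops by 1, and all row sums fit the remaining
    voters. *)
Lemma transport (T : eqType) (U V : seq T) (x : T -> T -> nat) :
  uniq U -> {subset V <= U} ->
  (forall u, u \in U -> \sum_(w <- U) x u w = count_mem u V) ->
  exists W, [/\ size W = size V, {subset W <= U} &
    forall u w, u \in U -> w \in U -> count_mem (u, w) (zip V W) = x u w].
Proof.
move=> Hu; elim: V x => [|v V IH] x HV Hx.
  exists [::]; split=> // u w Hu1 Hw; have := Hx u Hu1.
  rewrite (bigD1_seq w) //=; lia.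
have Hv : v \in U by apply: HV; rewrite mem_head.
have [w0 Hw0 Hpos] : exists2 w0, w0 \in U & 0 < x v w0.
  apply/hasP; rewrite -[has _ _]negbK -all_predC; apply/negP => /allP H.
  have := Hx v Hv; rewrite /= eqxx big_seq big1 // => w /H /=; lia.
pose x' u w := x u w - ((u == v) && (w == w0)).
have [|u Hu1|W [HW1 HW2 HW3]] := IH x'.
- by move=> y Hy; apply: HV; rewrite inE Hy orbT.
- have := Hx u Hu1; rewrite /= /x'; case: (u =P v) => [->|uv] /=; last first.
    rewrite eq_sym (negPf (introN eqP uv)) add0n => <-.
    by apply: eq_bigr => w _; rewrite subn0.
  rewrite eqxx (bigD1_seq w0) //= => E.
  rewrite (bigD1_seq w0) //= eqxx.
  rewrite (eq_bigr (x v)) => [|w /negPf ->]; last by rewrite subn0.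
  by lia.
exists (w0 :: W); split=> [|w|u w Hu1 Hw] /=; first by rewrite HW1.
  by rewrite inE => /predU1P[->|/HW2].
rewrite HW3 // /x' xpair_eqE (eq_sym v) (eq_sym w0).
case: (u =P v) => [->|] /=; last by rewrite subn0.
by case: (w =P w0) => [->|] /=; [rewrite subnKC | rewrite subn0].
Qed.

Lemma lin_moves m c x :
  lin (nmoves m) (fun j => c (nth ([::], [::]) (moves m) j)) x =
  \sum_(z <- moves m) x (index z (moves m)) * c z.
Proof.
rewrite /lin sumnE big_map (big_nth ([::], [::])) /index_iota subn0 /nmoves.
apply: eq_big_seq => j; rewrite mem_iota /= => Hj.
by rewrite index_uniq // uniq_moves.
Qed.

(** * Equivalence of briberies and good final states *)

Section Bribery.
Variables (tbc : seq nat -> seq nat) (tbp : seq nat -> seq (nat * nat)).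
Variables (C : seq nat) (V : seq (seq nat)) (p k : nat).
Hypotheses (Htbc : valid_tbc tbc) (Htbp : valid_tbp tbp).
Hypotheses (uC : uniq C) (pC : p \in C) (HV : all (is_vote C) V).
Variables (constructive unique : bool).
Local Notation m := (size C).
Local Notation f := (name_of C).
Local Notation idx := (fun a => index a C).
Local Notation z0 := (([::], [::]) : seq nat * seq nat).

Definition tau_of : seq nat := map idx (tbc C).
Definition pi_of : seq (nat * nat) := [seq (idx q.1, idx q.2) | q <- tbp C].
Definition types : seq (seq nat) := map (map idx) V.
(** Constant terms of the linear forms in the order of [labels]: voters of each type, then the
    budget; the margin rows take the default 0. *)
Definition supply (r : nat) : nat :=
  nth 0 ([seq count_mem u types | u <- perms m] ++ [:: k]) r.
Definition final_state (x : nat -> nat) : seq nat :=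
  clip (size (labels m)) (nmoves m) (width m) (rowP m) (rowM m) supply x.
Definition good (s : seq nat) : bool :=
  good_state constructive unique m tau_of pi_of (idx p) s.

Lemma tbc_map : tbc C = map f tau_of.
Proof. by rewrite /tau_of map_name_index // => a; rewrite (perm_mem (Htbc uC)). Qed.

Lemma tbp_mem q : q \in tbp C -> (q.1 \in C) && (q.2 \in C).
Proof.
move=> Hq; have : upair q \in cpairs C.
  by rewrite -(perm_mem (Htbp uC)) map_f.
case/allpairsPdep=> a [b [Ha]]; rewrite mem_filter => /andP[_ Hb].
case: q {Hq} => c d /= [E1 E2]; move: Ha Hb; rewrite -E1 -E2.
by rewrite /minn /maxn; case: ifP => _ -> ->.
Qed.

Lemma tbp_map : tbp C = map (fp f) pi_of.
Proof.
rewrite /pi_of -map_comp -[LHS]map_id; apply/eq_in_map => -[a b] /tbp_mem /= /andP[Ha Hb].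
by rewrite /fp /= !name_index.
Qed.

Lemma tbp_uniq : uniq [seq upair q | q <- tbp C].
Proof.
rewrite (perm_uniq (Htbp uC)); apply: allpairs_uniq_dep => //.
  by move=> a _; apply: filter_uniq.
by move=> [a b] [c d] _ _ /= [-> ->].
Qed.

Lemma pi_of_lt q : q \in pi_of -> (q.1 < m) && (q.2 < m).
Proof. by case/mapP=> r /tbp_mem /andP[H1 H2] -> /=; rewrite !index_mem H1 H2. Qed.

Lemma types_sub : {subset types <= perms m}.
Proof. by move=> u /mapP [v Hv ->]; apply: vote_perms => //; apply: (allP HV). Qed.

Lemma index_label0 u : u \in perms m -> index (0 :: u) (labels m) = index u (perms m).
Proof.
move=> Hu; rewrite /labels index_cat map_f // index_map //.
by move=> a b [].
Qed.

Lemma notin_label0 a u : 0 < a -> (a :: u) \notin [seq 0 :: u | u <- perms m].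
Proof. by move=> Ha; apply/negP => /mapP [w _ [E _]]; rewrite E in Ha. Qed.

Lemma digit_final x l : l \in labels m -> digit m (final_state x) l =
  minn (width m + width m) (width m + supply (index l (labels m)) +
    \sum_(z <- moves m) x (index z (moves m)) * gain l z -
    \sum_(z <- moves m) x (index z (moves m)) * loss l z).
Proof.
move=> Hl; have Hi : index l (labels m) < size (labels m) by rewrite index_mem.
rewrite /digit /final_state /clip (nth_map 0) ?size_iota // nth_iota // add0n.
by rewrite /rowP /rowM nth_index // !lin_moves.
Qed.

Lemma supply0 u : u \in perms m -> supply (index (0 :: u) (labels m)) = count_mem u types.
Proof.
move=> Hu; rewrite index_label0 // /supply nth_cat size_map index_mem Hu.
by rewrite (nth_map [::]) ?index_mem // nth_index.
Qed.

Lemma supply1 : supply (index [:: 1] (labels m)) = k.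
Proof.
rewrite /labels index_cat (negPf (notin_label0 _ _)) //= addn0 /supply nth_cat !size_map ltnn.
by rewrite subnn.
Qed.

Lemma supply2 q : supply (index (2 :: q) (labels m)) = 0.
Proof.
rewrite /labels index_cat (negPf (notin_label0 _ _)) // /supply nth_cat !size_map.
move: [seq 2 :: q | q <- words m 4] => t /=; rewrite ifF; last by lia.
by rewrite nth_default //=; lia.
Qed.

Lemma label0 u : u \in perms m -> 0 :: u \in labels m.
Proof. by move=> Hu; rewrite mem_cat map_f. Qed.

Lemma label1 : [:: 1] \in labels m.
Proof. by rewrite mem_cat inE eqxx orbT. Qed.

Lemma label2 a b c d : a < m -> b < m -> c < m -> d < m -> [:: 2; a; b; c; d] \in labels m.
Proof.
move=> Ha Hb Hc Hd; rewrite mem_cat inE; apply/orP; right; apply/orP; right.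
by apply/mapP; exists [:: a; b; c; d] => //; rewrite mem_words /= Ha Hb Hc Hd.
Qed.

Lemma loss0_sum x u : u \in perms m ->
  \sum_(z <- moves m) x (index z (moves m)) * loss (0 :: u) z =
  \sum_(w <- perms m) x (index (u, w) (moves m)).
Proof.
move=> Hu; rewrite {1}/moves big_allpairs_dep /= (bigD1_seq u) ?uniq_perms //=.
rewrite [X in _ + X]big1 ?addn0 => [|u' /negPf Hu'].
  by apply: eq_bigr => w _; rewrite /loss /= eqxx muln1.
by rewrite big1 // => w _; rewrite /loss /= eqseq_cons eqxx /= eq_sym Hu' muln0.
Qed.

Definition move_counts (W : seq (seq nat)) (j : nat) : nat :=
  count_mem (nth z0 (moves m) j) (zip types W).

Section Bribed.
Variables (W : seq (seq nat)).
Hypotheses (sW : size W = size V) (HW : {subset W <= perms m}).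
Local Notation Z := (zip types W).

Lemma zip_moves : {subset Z <= moves m}.
Proof.
move=> [u w] H; rewrite mem_moves types_sub ?HW //.
  have : w \in unzip2 Z by apply/mapP; exists (u, w).
  by rewrite unzip2_zip // /types size_map sW.
have : u \in unzip1 Z by apply/mapP; exists (u, w).
by rewrite unzip1_zip // /types size_map sW.
Qed.

Lemma sum_move_counts c :
  \sum_(z <- moves m) move_counts W (index z (moves m)) * c z = \sum_(z <- Z) c z.
Proof.
rewrite -(sum_count c (uniq_moves m) zip_moves).
by apply: eq_big_seq => z Hz; rewrite /move_counts nth_index.
Qed.

Lemma digit_counts l : l \in labels m -> digit m (final_state (move_counts W)) l =
  minn (width m + width m) (width m + supply (index l (labels m)) +
    \sum_(z <- Z) gain l z - \sum_(z <- Z) loss l z).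
Proof. by move=> Hl; rewrite digit_final // !sum_move_counts. Qed.

Lemma sum_zip2 (c : seq nat -> nat) : \sum_(z <- Z) c z.2 = \sum_(w <- W) c w.
Proof. by rewrite -(big_map snd xpredT c) -/(unzip2 Z) unzip2_zip // size_map sW. Qed.

Lemma sum_prefers a b : \sum_(w <- W) (prefers w a b : nat) = count (fun w => prefers w a b) W.
Proof. by rewrite -sumn_count sumnE big_map. Qed.

Lemma count_prefers_map a b :
  count (fun v => prefers v (f a) (f b)) (map (map f) W) = count (fun w => prefers w a b) W.
Proof.
rewrite count_map; apply: eq_count => w /=.
by rewrite /prefers !index_map //; apply: name_of_inj.
Qed.

Lemma margin_counts a b c d : a < m -> b < m -> c < m -> d < m ->
  margin_lt m (final_state (move_counts W)) (a, b) (c, d) =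
  (D (map (map f) W) (f a) (f b) < D (map (map f) W) (f c) (f d))%R.
Proof.
move=> Ha Hb Hc Hd; rewrite /margin_lt digit_counts ?label2 // supply2 /gain /loss /=.
rewrite !big_split /= !(sum_zip2 (fun w => prefers w _ _)) !sum_prefers.
rewrite /D !count_prefers_map.
move: (count _ W) (count _ W) (count _ W) (count _ W) => n1 n2 n3 n4.
by rewrite /width; lia.
Qed.

Lemma good_counts : good (final_state (move_counts W)) =
  (count (fun z => z.1 != z.2) Z <= k) &&
  goal_pred constructive unique (rp_winners tbc tbp C (map (map f) W)) p.
Proof.
rewrite /good /good_state; have -> : all (fun u => digit m (final_state (move_counts W)) (0 :: u)
    == width m) (perms m).
  apply/allP => u Hu; rewrite digit_counts ?label0 // supply0 //.
  rewrite big1 // addn0 (_ : \sum_(z <- Z) _ = count_mem u types) ?addnK; last first.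
    rewrite /loss /= -[types in RHS](unzip1_zip (t := W)); last by rewrite size_map sW.
    rewrite count_map -sumn_count sumnE big_map; apply: eq_bigr => z _ /=.
    by rewrite eqseq_cons eqxx eq_sym.
  by rewrite (minn_idPr (leq_addr _ _)).
rewrite digit_counts ?label1 // supply1 big1 // addn0 /=; congr andb.
  rewrite (_ : \sum_(z <- Z) _ = count (fun z => z.1 != z.2) Z).
    by move: (count _ _) => n; rewrite /width; lia.
  by rewrite -sumn_count sumnE big_map.
rewrite (winners_map (@name_of_inj C uC) (map_name_iota C) tbc_map tbp_map pi_of_lt tbp_uniq
  margin_counts).
rewrite /goal_pred /win_pred; have Ep : p = f (idx p) by rewrite name_index.
have E1 w : (map f w == [:: p]) = (w == [:: idx p]).
  by rewrite {1}Ep -[[:: f _]]/(map f [:: idx p]) (inj_eq (inj_map (@name_of_inj C uC))).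
have E2 w : (p \in map f w) = (idx p \in w).
  by rewrite {1}Ep (mem_map (@name_of_inj C uC)).
by rewrite E1 E2.
Qed.

End Bribed.

Lemma bribery_states L : size V < 2 ^ L ->
  bribery_yes tbc tbp constructive unique C V p k <->
  exists x, (forall j, j < nmoves m -> x j < 2 ^ L) /\ good (final_state x).
Proof.
move=> HL; split=> [[V' [[sV' HV' Hk] Hwin]]|[x [_ Hgood]]].
  pose W := map (map idx) V'.
  have sW : size W = size V by rewrite size_map sV'.
  have HW : {subset W <= perms m}.
    by move=> w /mapP [v Hv ->]; apply: vote_perms => //; apply: (allP HV').
  have EV' : map (map f) W = V'.
    rewrite -map_comp -[RHS]map_id; apply/eq_in_map => v Hv /=.
    by rewrite map_name_index //; apply: vote_sub; apply: (allP HV').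
  exists (move_counts W); split=> [j _|].
    apply: leq_ltn_trans (count_size _ _) _.
    by rewrite size_zip sW size_map minnn.
  rewrite good_counts // EV'; apply/andP; split; last first.
    by move: Hwin; rewrite /goal_pred; case: (constructive).
  apply: leq_trans Hk; rewrite count_map /types /W.
  have : all (fun z => (z.1 \in V) && (z.2 \in V')) (zip V V').
    apply/allP => -[v v'] H /=; apply/andP; split.
      rewrite -(unzip1_zip (s := V) (t := V')) ?sV' //; by apply/mapP; exists (v, v').
    rewrite -(unzip2_zip (s := V) (t := V')) ?sV' //; by apply/mapP; exists (v, v').
  have -> : zip (map (map idx) V) (map (map idx) V') =
            [seq (map idx z.1, map idx z.2) | z <- zip V V'].
    by elim: (V) (V') => [|v s IH] [|v' s'] //=; rewrite IH.
  rewrite count_map; elim: (zip V V') => //= z s IH /andP[_ /IH]; apply: leq_add.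
  by case: (z.1 =P z.2) => [->|]; rewrite ?eqxx //= leq_b1.
have [Hsup _ _] := and3P Hgood.
(* The rows labelled by votes vanish in a good state, which is the row-sum hypothesis of
   [transport]. Clipping cannot hide an imbalance, since [width m] is positive. *)
have [|W [sW HW Hcnt]] := transport (x := fun u w => x (index (u, w) (moves m)))
    (uniq_perms m) types_sub.
  move=> u Hu; have /eqP := allP Hsup u Hu.
  rewrite digit_final ?label0 // supply0 // loss0_sum //.
  rewrite [X in _ + _ + X]big1 ?addn0 => [|z _]; last by rewrite /gain muln0.
  by move: (\sum_(w <- _) _) (count_mem _ _) => a b; rewrite /width; lia.
rewrite size_map in sW.
have Ex : final_state x = final_state (move_counts W).
  apply/eq_in_map => r _; have E j : j < nmoves m -> x j = move_counts W j.
    move=> Hj; have := mem_nth z0 Hj; rewrite /move_counts.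
    case Ez: (nth z0 (moves m) j) => [u w]; rewrite mem_moves => /andP[Hu Hw].
    by rewrite Hcnt // -Ez index_uniq // uniq_moves.
  by congr (minn _ (_ + _ - _)); apply: lin_ext.
move: Hgood; rewrite Ex good_counts // => /andP[Hk Hwin].
exists (map (map f) W); split; last first.
  by move: Hwin; rewrite /goal_pred; case: (constructive).
split; first by rewrite size_map.
  by apply/allP => v /mapP [w Hw ->]; apply: perms_vote; apply: HW.
apply: leq_trans Hk; rewrite count_map /types.
have -> : zip V (map (map f) W) = [seq (map f z.1, map f z.2) | z <- zip types W].
  rewrite /types; elim: (V) (W) (allP HV) => [|v s IH] [|w t] //= H.
  rewrite IH => [|v' Hv']; last by apply: H; rewrite inE Hv' orbT.
  by rewrite map_name_index //; apply: vote_sub; apply: H; rewrite mem_head.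
rewrite count_map; apply: sub_count => z /=.
by apply: contra => /eqP ->.
Qed.

End Bribery.

(** * The decision procedure is primitive recursive in the number of candidates *)

Section Apply.
Context {X A B C D E : Type} {encX : encodable X} {encA : encodable A} {encB : encodable B}.
Context {encC : encodable C} {encD : encodable D} {encE : encodable E}.

Lemma prf_ap1 (F : A -> B) (a : X -> A) : prf F -> prf a -> prf (fun x => F (a x)).
Proof. exact: prf_comp. Qed.

Lemma prf_ap2 (F : A -> B -> C) (a : X -> A) (b : X -> B) :
  prf (fun z : A * B => F z.1 z.2) -> prf a -> prf b -> prf (fun x => F (a x) (b x)).
Proof. by move=> HF Ha Hb; apply: (prf_comp (f := fun x => (a x, b x))) HF _; prf_tac. Qed.

Lemma prf_ap3 (F : A -> B -> C -> D) (a : X -> A) (b : X -> B) (c : X -> C) :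
  prf (fun z : A * B * C => F z.1.1 z.1.2 z.2) -> prf a -> prf b -> prf c ->
  prf (fun x => F (a x) (b x) (c x)).
Proof. by move=> HF Ha Hb Hc; apply: (prf_comp (f := fun x => (a x, b x, c x))) HF _; prf_tac. Qed.

Lemma prf_ap4 (F : A -> B -> C -> D -> E) (a : X -> A) (b : X -> B) (c : X -> C) (d : X -> D) :
  prf (fun z : A * B * C * D => F z.1.1.1 z.1.1.2 z.1.2 z.2) ->
  prf a -> prf b -> prf c -> prf d -> prf (fun x => F (a x) (b x) (c x) (d x)).
Proof.
move=> HF Ha Hb Hc Hd.
by apply: (prf_comp (f := fun x => (a x, b x, c x, d x))) HF _; prf_tac.
Qed.

End Apply.

Lemma prf_uniq {X : Type} {T : eqType} {encX : encodable X} {encT : encodable T} (s : X -> seq T) :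
  prf s -> prf (fun x => uniq (s x)).
Proof.
(* The fold has to carry the suffix already processed along with the answer, since each element is
   tested against it. *)
move=> Hs; apply: (prf_ext (f := fun x => (foldr (fun y (r : bool * seq T) =>
  ((y \notin r.2) && r.1, y :: r.2)) (true, [::]) (s x)).1)) => [x|]; last by prf_tac.
have -> : foldr (fun y (r : bool * seq T) => ((y \notin r.2) && r.1, y :: r.2)) (true, [::]) (s x)
  = (uniq (s x), s x) by elim: (s x) => //= y r ->.
by [].
Qed.

Lemma prf_words : prf (fun z : nat * nat => words z.1 z.2).
Proof. by rewrite /words; prf_tac. Qed.

Lemma prf_perms : prf perms.
Proof.
by rewrite /perms; apply: prf_filter; [apply: prf_uniq; prf_tac | apply: (prf_ap2 prf_words); prf_tac].
Qed.

Ltac prf_hook ::= first [ apply: prf_uniq | apply: (prf_ap2 prf_words) | apply: (prf_ap1 prf_perms) | prf_list ].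

Lemma prf_moves : prf moves.
Proof. by rewrite /moves; prf_tac. Qed.

Lemma prf_labels : prf labels.
Proof. by rewrite /labels; prf_tac. Qed.

Lemma prf_nmoves : prf nmoves.
Proof. by rewrite /nmoves; apply: prf_size; exact: prf_moves. Qed.

Ltac prf_hook ::= first [ apply: prf_uniq | apply: (prf_ap2 prf_words) | apply: (prf_ap1 prf_perms)
  | apply: (prf_ap1 prf_moves) | apply: (prf_ap1 prf_labels) | apply: (prf_ap1 prf_nmoves) | prf_list ].

Lemma prf_width : prf width.
Proof. by rewrite /width; prf_tac. Qed.

Lemma prf_prefers : prf (fun z : seq nat * nat * nat => prefers z.1.1 z.1.2 z.2).
Proof. by rewrite /prefers; prf_tac. Qed.

Ltac prf_hook ::= first [ apply: prf_uniq | apply: (prf_ap2 prf_words) | apply: (prf_ap1 prf_perms)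
  | apply: (prf_ap1 prf_moves) | apply: (prf_ap1 prf_labels) | apply: (prf_ap1 prf_nmoves)
  | apply: (prf_ap1 prf_width) | apply: (prf_ap3 prf_prefers) | prf_list ].

Lemma prf_gain : prf (fun z : seq nat * (seq nat * seq nat) => gain z.1 z.2).
Proof. by rewrite /gain; prf_tac. Qed.

Lemma prf_loss : prf (fun z : seq nat * (seq nat * seq nat) => loss z.1 z.2).
Proof. by rewrite /loss; prf_tac. Qed.

Definition next_states (m : nat) (S : seq (seq nat)) (sg : seq nat) : seq (seq nat) :=
  next (size (labels m)) (nmoves m) (width m) (rowP m) (rowM m) S sg.

Definition step_state (m : nat) (s sg e : seq nat) : seq nat :=
  trans (size (labels m)) (nmoves m) (width m) (rowP m) (rowM m) s sg e.

Ltac prf_hook ::= first [ apply: prf_uniq | apply: (prf_ap2 prf_words) | apply: (prf_ap1 prf_perms)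
  | apply: (prf_ap1 prf_moves) | apply: (prf_ap1 prf_labels) | apply: (prf_ap1 prf_nmoves)
  | apply: (prf_ap1 prf_width) | apply: (prf_ap3 prf_prefers)
  | apply: (prf_ap2 prf_gain) | apply: (prf_ap2 prf_loss) | prf_list ].

Lemma prf_step_state : prf (fun z : nat * seq nat * seq nat * seq nat =>
  step_state z.1.1.1 z.1.1.2 z.1.2 z.2).
Proof. by rewrite /step_state /trans /lin /rowP /rowM; prf_tac. Qed.

Lemma prf_next_states : prf (fun z : nat * seq (seq nat) * seq nat =>
  next_states z.1.1 z.1.2 z.2).
Proof.
apply: (prf_ext (f := fun z : nat * seq (seq nat) * seq nat =>
  [seq s' <- words (width z.1.1 + width z.1.1 + 1) (size (labels z.1.1)) |
     has (fun s => has (fun e => s' == step_state z.1.1 s z.2 e) (words 2 (nmoves z.1.1))) z.1.2])).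
  by [].
apply: prf_filter; last by prf_tac.
apply: prf_has; last by prf_tac.
apply: prf_has; last by prf_tac.
apply: prf_eq; first by prf_tac.
by apply: (prf_ap4 prf_step_state); prf_tac.
Qed.

Definition start_states (m : nat) : seq (seq nat) := [:: nseq (size (labels m)) (width m)].

Lemma prf_start_states : prf start_states.
Proof.
apply: (prf_ext (f := fun m => [:: iter (size (labels m)) (cons (width m)) [::]])).
  by move=> m; rewrite /start_states; congr [:: _]; elim: size => //= n ->.
by prf_tac.
Qed.

Lemma prf_digit : prf (fun z : nat * seq nat * seq nat => digit z.1.1 z.1.2 z.2).
Proof. by rewrite /digit; prf_tac. Qed.

Lemma prf_margin_lt : prf (fun z : nat * seq nat * (nat * nat) * (nat * nat) =>
  margin_lt z.1.1.1 z.1.1.2 z.1.2 z.2).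
Proof. by rewrite /margin_lt; apply: prf_leq; [apply: prf_succ; apply: (prf_ap3 prf_digit)|]; prf_tac. Qed.

(** A comparison relation has no code, so it is passed as the pair of [m] and the state that
    determines it. *)
Definition state_gle (s : nat * seq nat) (pi : seq (nat * nat)) (q r : nat * nat) : bool :=
  gle (margin_lt s.1 s.2) pi q r.

Lemma prf_wlt : prf (fun z : (nat * seq nat) * (nat * nat) * (nat * nat) =>
  wlt (margin_lt z.1.1.1 z.1.1.2) z.1.2 z.2).
Proof.
rewrite /wlt /swap.
by apply: prf_orb; apply: prf_andb; apply: (prf_ap4 prf_margin_lt); prf_tac.
Qed.

Lemma prf_gle : prf (fun z : (nat * seq nat) * seq (nat * nat) * (nat * nat) * (nat * nat) =>
  state_gle z.1.1.1 z.1.1.2 z.1.2 z.2).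
Proof.
rewrite /state_gle /gle.
apply: prf_orb; first by apply: (prf_ap3 (F := fun s : nat * seq nat => wlt (margin_lt s.1 s.2)) prf_wlt); prf_tac.
apply: prf_andb; first by apply: prf_negb; apply: (prf_ap3 (F := fun s : nat * seq nat => wlt (margin_lt s.1 s.2)) prf_wlt); prf_tac.
apply: prf_andb; first by apply: prf_negb; apply: (prf_ap3 (F := fun s : nat * seq nat => wlt (margin_lt s.1 s.2)) prf_wlt); prf_tac.
by prf_tac.
Qed.

Definition state_sort (s : nat * seq nat) (pi : seq (nat * nat)) :=
  isort (margin_lt s.1 s.2) pi.

Lemma prf_sort : prf (fun z : (nat * seq nat) * seq (nat * nat) => state_sort z.1 z.2).
Proof.
apply: prf_foldr; [|by prf_tac..].
apply: prf_cat; last apply: prf_cons; first 1 last.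
- by prf_tac.
- by apply: prf_filter; last prf_tac; apply: (prf_ap4 prf_gle); prf_tac.
- by apply: prf_filter; last prf_tac; apply: prf_negb; apply: (prf_ap4 prf_gle); prf_tac.
Qed.

Definition state_orient (s : nat * seq nat) (tau : seq nat) (q : nat * nat) :=
  gorient (margin_lt s.1 s.2) tau q.

Lemma prf_orient : prf (fun z : (nat * seq nat) * seq nat * (nat * nat) =>
  state_orient z.1.1 z.1.2 z.2).
Proof.
rewrite /state_orient /gorient; apply: prf_if.
- by apply: (prf_ap4 prf_margin_lt); prf_tac.
- by prf_tac.
apply: prf_if.
- by apply: (prf_ap4 prf_margin_lt); prf_tac.
- by prf_tac.
apply: prf_if; [apply: prf_leq; [apply: prf_succ|] | |]; by prf_tac.
Qed.

Lemma prf_reachable : prf (fun z : seq (nat * nat) * nat => reachable z.1 z.2).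
Proof. by rewrite /reachable /succs; prf_tac. Qed.

Lemma prf_implied : prf (fun z : seq (nat * nat) * nat * nat => implied z.1.1 z.1.2 z.2).
Proof.
rewrite /implied; apply: prf_orb; apply: prf_mem; try by prf_tac.
all: by apply: (prf_ap2 prf_reachable); prf_tac.
Qed.

Definition state_fixed (s : nat * seq nat) (tau : seq nat) (pi : seq (nat * nat)) :=
  gfixed (margin_lt s.1 s.2) tau pi.

Lemma prf_fixed : prf (fun z : (nat * seq nat) * seq nat * seq (nat * nat) =>
  state_fixed z.1.1 z.1.2 z.2).
Proof.
apply: prf_foldl; [|by prf_tac|by apply: (prf_ap2 prf_sort); prf_tac].
apply: prf_if; first by apply: (prf_ap3 prf_implied); prf_tac.
  by prf_tac.
by apply: prf_cons; last prf_tac; apply: (prf_ap3 prf_orient); prf_tac.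
Qed.

Definition state_win (s : nat * seq nat) (tau : seq nat) (pi : seq (nat * nat)) :=
  gwin (margin_lt s.1 s.2) tau pi s.1.

Lemma prf_win : prf (fun z : (nat * seq nat) * seq nat * seq (nat * nat) =>
  state_win z.1.1 z.1.2 z.2).
Proof.
apply: prf_filter; last by prf_tac.
apply: prf_all; last by prf_tac.
apply: prf_orb; first by prf_tac.
apply: prf_mem; first by prf_tac.
apply: (prf_ap2 prf_reachable); last by prf_tac.
by apply: (prf_ap3 prf_fixed); prf_tac.
Qed.

Definition pairup (l : seq nat) : seq (nat * nat) :=
  [seq (nth 0 l (i + i), nth 0 l (i + i + 1)) | i <- iota 0 (size l)./2].

Lemma pairup_flatten (s : seq (nat * nat)) : pairup (flatten [seq [:: q.1; q.2] | q <- s]) = s.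
Proof.
have Hs : size (flatten [seq [:: q.1; q.2] | q <- s]) = (size s).*2.
  by elim: s => //= q s ->.
rewrite /pairup Hs doubleK; apply: (@eq_from_nth _ (0, 0)); rewrite size_map size_iota // => i Hi.
rewrite (nth_map 0) ?size_iota // nth_iota // add0n.
elim: s i {Hs} Hi => //= -[a b] s IH [|i] //= Hi.
by rewrite -[RHS]IH // addnS addSn.
Qed.

Definition accept (constructive unique : bool) (S : seq (seq nat)) (d : nat * nat)
    (tau pi : seq nat) : bool :=
  has (fun s => good_state constructive unique d.1 tau (pairup pi) d.2 s) S.

Lemma prf_accept constructive unique :
  prf (fun z : seq (seq nat) * (nat * nat) * seq nat * seq nat =>
    accept constructive unique z.1.1.1 z.1.1.2 z.1.2 z.2).
Proof.
apply: prf_has; last by prf_tac.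
rewrite /good_state; apply: prf_andb.
  apply: prf_all; last by prf_tac.
  by apply: prf_eq; [apply: (prf_ap3 prf_digit)|]; prf_tac.
apply: prf_andb; first by apply: prf_leq; [|apply: (prf_ap3 prf_digit)]; prf_tac.
have Hwin : prf (fun z : seq (seq nat) * (nat * nat) * seq nat * seq nat * seq nat =>
    gwin (margin_lt z.1.1.1.2.1 z.2) z.1.1.2 (pairup z.1.2) z.1.1.1.2.1).
  apply: (prf_ap3 (F := state_win) (a := fun z : seq (seq nat) * (nat * nat) * seq nat * seq nat * seq nat =>
    (z.1.1.1.2.1, z.2)) prf_win); rewrite /pairup; by prf_tac.
rewrite /goal_pred /win_pred; case: constructive; case: unique.
- by apply: prf_eq; [exact: Hwin | prf_tac].
- by apply: prf_mem; [prf_tac | exact: Hwin].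
- by apply: prf_negb; apply: prf_eq; [exact: Hwin | prf_tac].
- by apply: prf_negb; apply: prf_mem; [prf_tac | exact: Hwin].
Qed.

(** * Polynomial running time from bounded loop counts *)

Section LoopBound.
Variables (K Y : nat).

(** Values may be far larger than [Y]; only the numbers of rounds are restricted, including the
    rounds hidden in [Lg]. *)
Fixpoint loops_le (M : memory) (e : expr) (env : seq nat) : Prop :=
  match e with
  | Var _ | Cst _ | Glb _ => True
  | Read a => loops_le M a env
  | Lg a => loops_le M a env /\ lg (eval K M a env) <= Y
  | Add a b | Sub a b => loops_le M a env /\ loops_le M b env
  | Ite c a b => loops_le M c env /\
      (if eval K M c env == 0 then loops_le M b env else loops_le M a env)
  | Let a b => loops_le M a env /\ loops_le M b (eval K M a env :: env)
  | App2 f a b => [/\ loops_le M a env, loops_le M b env &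
      loops_le M f [:: eval K M a env; eval K M b env]]
  | Rec n b s => [/\ loops_le M n env, loops_le M b env, eval K M n env <= Y &
      forall i, i < eval K M n env -> loops_le M s
        [:: iteri i (fun i acc => eval K M s [:: acc, i & env]) (eval K M b env), i & env]]
  end.

Fixpoint degree (e : expr) : nat :=
  match e with
  | Var _ | Cst _ | Glb _ => 1
  | Read a => degree a + 1
  | Lg a => degree a + 2
  | Add a b | Sub a b | Let a b => degree a + degree b + 1
  | Ite a b c | App2 a b c => degree a + degree b + degree c + 1
  | Rec a b c => degree a + degree b + degree c + 2
  end.

(** Converse use of the cost: each round is charged, so the total cost of a pure call bounds all of
    its loop counts. *)
Lemma cost_loops M e env : cost K M e env <= Y -> loops_le M e env.
Proof.
elim: e env => //= [a IHa|a IHa b IHb|a IHa b IHb|c IHc a IHa b IHb|a IHa b IHb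
  |f IHf a IHa b IHb|n IHn b IHb s IHs|a IHa] env H.
- by apply: IHa; lia.
- by split; [apply: IHa|apply: IHb]; lia.
- by split; [apply: IHa|apply: IHb]; lia.
- split; first by apply: IHc; lia.
  by move: H; case: ifP => _ H; [apply: IHb|apply: IHa]; lia.
- by split; [apply: IHa|apply: IHb]; lia.
- by split; [apply: IHa|apply: IHb|apply: IHf]; lia.
- move: H; set S := \sum_(i < _) _ => H.
  have HS : S <= Y by lia.
  split; [apply: IHn; lia|apply: IHb; lia| |].
    apply: leq_trans HS; rewrite -[X in X <= _]muln1 -[X in X * _]card_ord -sum_nat_const.
    by rewrite leq_sum // => i _; lia.
  move=> i Hi; apply: IHs; apply: leq_trans HS.
  by rewrite /S (bigD1 (Ordinal Hi)) //=; lia.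
- by split; [apply: IHa; lia|lia].
Qed.

Definition ev (M : memory) (env : seq nat) (e : expr) (v : nat) : Prop :=
  eval K M e env = v /\ loops_le M e env.

Variables (M : memory).
Implicit Types (env : seq nat) (a b c : expr).

Lemma ev_eq env a v v' : ev M env a v -> v = v' -> ev M env a v'.
Proof. by move=> H <-. Qed.

Lemma ev_var env i : ev M env (Var i) (nth 0 env i).
Proof. by []. Qed.

Lemma ev_cst env n : ev M env (Cst n) n.
Proof. by []. Qed.

Lemma ev_glb env i v : M i = v -> ev M env (Glb i) v.
Proof. by []. Qed.

Lemma ev_read env a v : ev M env a v -> ev M env (Read a) (M (K + v)).
Proof. by case=> <- H. Qed.

Lemma ev_add env a b u v : ev M env a u -> ev M env b v -> ev M env (Add a b) (u + v).
Proof. by case=> <- Ha [<- Hb]. Qed.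

Lemma ev_sub env a b u v : ev M env a u -> ev M env b v -> ev M env (Sub a b) (u - v).
Proof. by case=> <- Ha [<- Hb]. Qed.

Lemma ev_ite env c a b u v : ev M env c u -> (u != 0 -> ev M env a v) ->
  (u = 0 -> ev M env b v) -> ev M env (Ite c a b) v.
Proof.
case=> E Hc Ha Hb; rewrite /ev /= E; case: eqP => u0.
  by case: (Hb u0) => H1 H2.
by case: (Ha (introN eqP u0)) => H1 H2.
Qed.

Lemma ev_let env a b u v : ev M env a u -> ev M (u :: env) b v -> ev M env (Let a b) v.
Proof. by case=> E Ha [<- Hb]; split; rewrite /= E. Qed.

Lemma ev_app2 env f a b u v w : ev M env a u -> ev M env b v -> ev M [:: u; v] f w ->
  ev M env (App2 f a b) w.
Proof. by case=> Ea Ha [Eb Hb] [<- Hf]; split; rewrite /= Ea Eb. Qed.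

Lemma ev_rec env n b s N (F : nat -> nat) : ev M env n N -> N <= Y -> ev M env b (F 0) ->
  (forall i, i < N -> ev M [:: F i, i & env] s (F i.+1)) -> ev M env (Rec n b s) (F N).
Proof.
case=> En Hn HN [Eb Hb] Hs.
have E i : i <= N -> iteri i (fun i acc => eval K M s [:: acc, i & env]) (eval K M b env) = F i.
  elim: i => [|i IH] Hi; first by rewrite -Eb.
  by rewrite iteriS (IH (ltnW Hi)); case: (Hs i Hi).
split=> /=; first by rewrite En E.
rewrite En; split=> // i Hi; rewrite (E i (ltnW Hi)).
by case: (Hs i Hi).
Qed.

Lemma ev_lg env a v : ev M env a v -> lg v <= Y -> ev M env (Lg a) (lg v).
Proof. by case=> <- Ha Hl. Qed.

Lemma ev_call {A B : Type} {encA : encodable A} {encB : encodable B} env a e (f : A -> B) x :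
  computes e f -> ev M env a (enc x) -> cost K M e (enc x :: env) <= Y ->
  ev M env (Let a e) (enc (f x)).
Proof.
move=> [p w E] Ha Hc; apply: ev_let Ha _; split; last exact: cost_loops.
by rewrite eval_pure // peval1 // E.
Qed.

Lemma ev_pair env a b u v : cost K M pairE [:: u; v] <= Y ->
  ev M env a u -> ev M env b v -> ev M env (App2 pairE a b) (cpair u v).
Proof.
move=> Hc Ha Hb; apply: ev_app2 Ha Hb _; split; last exact: cost_loops.
by rewrite pairE_eval.
Qed.

Lemma ev_mul env a b u v : ev M env a u -> ev M env b v -> v <= Y ->
  ev M env (App2 mulE a b) (u * v).
Proof.
by move=> Ha Hb Hv; apply: ev_app2 Ha Hb _; split; first exact: mulE_eval.
Qed.

Lemma ev_pow2 env a u : ev M env a u -> u <= Y -> ev M env (Let a pow2E) (2 ^ u).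
Proof.
by move=> Ha Hu; apply: ev_let Ha _; split; first exact: pow2E_eval.
Qed.

Definition eqE (a b : expr) : expr := Sub (Cst 1) (Add (Sub a b) (Sub b a)).

Lemma ev_eqE env a b u v : ev M env a u -> ev M env b v -> ev M env (eqE a b) (u == v).
Proof.
move=> Ha Hb; apply: ev_eq; first by do ![apply: ev_sub|apply: ev_add|apply: ev_cst|eassumption].
by case: eqP => [->|]; lia.
Qed.

(** A list is built by prefixing, so its last element comes first: round [i] adds the element at
    position [N - 1 - i]. *)
Lemma ev_list env n b s N (F : nat -> nat) (l : seq nat) : ev M env n N -> N <= Y ->
  ev M env b (enc l) ->
  (forall i acc, i < N -> acc = enc ([seq F j | j <- iota (N - i) i] ++ l) ->
     ev M [:: acc, i & env] s (cpair (F (N - 1 - i)) acc)) ->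
  ev M env (Rec n b s) (enc ([seq F j | j <- iota 0 N] ++ l)).
Proof.
move=> Hn HN Hb Hs.
rewrite -[iota 0 N in X in ev _ _ _ X](_ : iota (N - N) N = _); last by rewrite subnn.
apply: (ev_rec (F := fun i => enc ([seq F j | j <- iota (N - i) i] ++ l))) => // i Hi.
apply: ev_eq (Hs i _ Hi erefl) _.
have -> : iota (N - i.+1) i.+1 = (N - 1 - i) :: iota (N - i) i.
  by rewrite /= -subnDA add1n; congr (_ :: iota _ _); lia.
by [].
Qed.

End LoopBound.

Section DegreeBound.
Variables (K Y : nat).
Hypothesis Y16 : 16 <= Y.

Lemma expY_mono a b : a <= b -> Y ^ a <= Y ^ b.
Proof. by move=> ab; rewrite leq_pexp2l //; lia. Qed.

Lemma expY_gt0 a : 0 < Y ^ a.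
Proof. by rewrite expn_gt0; apply/orP; left; lia. Qed.

(** [degree] adds the degrees of all subexpressions and leaves one spare factor [Y], two for loops,
    one of which pays for the rounds; [16 <= Y] absorbs the additive constants. *)
Lemma cost_degree M e env : loops_le K Y M e env -> cost K M e env <= Y ^ degree e.
Proof.
elim: e env => /= [i|c|i|a IHa|a IHa b IHb|a IHa b IHb|c IHc a IHa b IHb|a IHa b IHb
  |f IHf a IHa b IHb|n IHn b IHb s IHs|a IHa] env.
- by rewrite expn1; lia.
- by rewrite expn1; lia.
- by rewrite expn1; lia.
- by move=> /IHa Ha; rewrite addn1 expnS; have := expY_gt0 (degree a); nia.
- move=> [/IHa Ha /IHb Hb]; rewrite (addn1 (degree a + degree b)) expnS.
  have := expY_mono (leq_addr (degree b) (degree a)).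
  have := expY_mono (leq_addl (degree a) (degree b)).
  have := expY_gt0 (degree a + degree b); nia.
- move=> [/IHa Ha /IHb Hb]; rewrite (addn1 (degree a + degree b)) expnS.
  have := expY_mono (leq_addr (degree b) (degree a)).
  have := expY_mono (leq_addl (degree a) (degree b)).
  have := expY_gt0 (degree a + degree b); nia.
- move=> [/IHc Hc Hab]; rewrite addn1 expnS.
  set w := degree c + degree a + degree b.
  have Ec : Y ^ degree c <= Y ^ w by apply: expY_mono; rewrite /w; lia.
  have Ea : Y ^ degree a <= Y ^ w by apply: expY_mono; rewrite /w; lia.
  have Eb : Y ^ degree b <= Y ^ w by apply: expY_mono; rewrite /w; lia.
  have := expY_gt0 w; move: Hab; case: ifP => _ => [/IHb|/IHa]; nia.
- move=> [/IHa Ha /IHb Hb]; rewrite (addn1 (degree a + degree b)) expnS.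
  have := expY_mono (leq_addr (degree b) (degree a)).
  have := expY_mono (leq_addl (degree a) (degree b)).
  have := expY_gt0 (degree a + degree b); nia.
- move=> [/IHa Ha /IHb Hb /IHf Hf]; rewrite addn1 expnS.
  set w := degree f + degree a + degree b.
  have Ec : Y ^ degree f <= Y ^ w by apply: expY_mono; rewrite /w; lia.
  have Ea : Y ^ degree a <= Y ^ w by apply: expY_mono; rewrite /w; lia.
  have Eb : Y ^ degree b <= Y ^ w by apply: expY_mono; rewrite /w; lia.
  have := expY_gt0 w; nia.
- move=> [/IHn Hn /IHb Hb HN Hs]; rewrite addn2 !expnS.
  set w := degree n + degree b + degree s.
  have En : Y ^ degree n <= Y ^ w by apply: expY_mono; rewrite /w; lia.
  have Eb : Y ^ degree b <= Y ^ w by apply: expY_mono; rewrite /w; lia.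
  have Es : Y ^ degree s <= Y ^ w by apply: expY_mono; rewrite /w; lia.
  have Hsum : \sum_(i < eval K M n env) (cost K M s [:: iteri i (fun i acc =>
      eval K M s [:: acc, i & env]) (eval K M b env), val i & env] + 8) <= Y * (Y ^ w + 8).
    apply: (@leq_trans (\sum_(i < eval K M n env) (Y ^ w + 8))).
      rewrite leq_sum // => i _; rewrite leq_add2r; apply: leq_trans Es.
      by apply: IHs; apply: Hs.
    by rewrite sum_nat_const card_ord leq_mul2r HN orbT.
  have W0 := expY_gt0 w; move: Hsum; rewrite /=; set T := (X in X <= _) => Hsum.
  have : 16 * (Y * Y ^ w) <= Y * (Y * Y ^ w) by rewrite leq_mul2r Y16 orbT.
  have : Y * 1 <= Y * Y ^ w by rewrite leq_mul2l W0 orbT.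
  have : 16 * Y ^ w <= Y * Y ^ w by rewrite leq_mul2r Y16 orbT.
  by rewrite mulnDr in Hsum; lia.
- move=> [/IHa Ha Hl]; rewrite addn2 !expnS.
  have W0 := expY_gt0 (degree a); set w := Y ^ degree a in Ha W0 *.
  have : 16 * (Y * w) <= Y * (Y * w) by rewrite leq_mul2r Y16 orbT.
  have : Y * 1 <= Y * w by rewrite leq_mul2l W0 orbT.
  have : 16 * w <= Y * w by rewrite leq_mul2r Y16 orbT.
  by lia.
Qed.

End DegreeBound.

(** Prefixing [a <= q] turns a code [t < w] into [2 ^ a * (2 * t + 1) < 2 ^ q.+1 * w], so each
    element contributes [q.+1] to the exponent. *)
Lemma seq_enc_lt (s : seq nat) q n : all (fun a => a <= q) s -> size s <= n ->
  enc s < 2 ^ (q.+1 * n).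
Proof.
elim: s n => [|a s IH] n /=; first by rewrite expn_gt0.
case/andP=> Ha Hs; case: n => // n Hn; have H : seq_enc s < 2 ^ (q.+1 * n) by apply: IH.
rewrite [q.+1 * n.+1]mulnS expnD (expnS 2 q) /cpair.
have Hq : 2 ^ a <= 2 ^ q by rewrite leq_exp2l.
have Ha0 : 0 < 2 ^ a by rewrite expn_gt0.
move: (seq_enc s) (2 ^ (q.+1 * n)) H => t w H.
apply: (@leq_trans (2 ^ a * (2 * w))); first by rewrite ltn_mul2l Ha0 /=; lia.
by rewrite -mulnA mulnCA leq_mul2l leq_mul2r Hq !orbT.
Qed.

Lemma seq_enc_filter {A : Type} {encA : encodable A} (s : seq A) (P : pred A) :
  enc (filter P s) <= enc s.
Proof.
elim: s => //= y s IH; case: ifP => _; first exact: leq_cpair.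
exact: leq_trans IH (ltnW (cpair_ltr _ _)).
Qed.

(** * The bribery program *)

(* Registers: 0 first cell of the simulated memories, 1 number of registers,
   2 number of candidates, 3 list of preference orders, 4 its length,
   5 number of vote entries, 6 number of binary digits, 7 reachable states,
   8 and 9 the tie-breaking orders, 10 the distinguished candidate. *)
Definition inputE (e : expr) : expr :=
  Ite (Sub (Glb 1) (Add e (Cst 1)))
    (Read (Sub (Add (Add (Glb 0) e) (Cst 1)) (Add (Glb 1) (Glb 1))))
    (Read (Sub (Add e (Cst 1)) (Glb 1))).

(** [Read] and [fill_code] add [K] to an address, which is why register 1 is subtracted. *)
Definition sim_addrE (j : nat) (e : expr) : expr :=
  Sub (Add (Glb 0) (Add (Add e e) (Cst j))) (Glb 1).

Definition simE (j : nat) (e : expr) : expr := Read (sim_addrE j e).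

Definition indexE (e : expr) : expr :=
  Let e (Rec (Glb 2) (Cst 0)
    (Ite (eqE (inputE (Add (Var 1) (Cst 1))) (Var 2)) (Var 1) (Var 0))).

Definition strideE (b : bool) : expr := if b then Add (Glb 2) (Cst 1) else Glb 2.

Definition posE (b : bool) (e o : expr) : expr :=
  Add (Add (Glb 2) (Cst 4)) (Add (App2 mulE e (strideE b)) o).

Definition voteE (b : bool) (e : expr) : expr :=
  Let e (Rec (Glb 2) (Cst 0) (App2 pairE
    (indexE (inputE (posE b (Var 2) (Sub (Sub (Glb 2) (Cst 1)) (Var 1))))) (Var 0))).

Definition multE (b : bool) (e : expr) : expr :=
  if b then inputE (posE b e (Glb 2)) else Cst 1.

Definition totalE (b : bool) : expr :=
  Add (inputE (Add (Glb 2) (Cst 2)))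
      (Rec (Glb 5) (Cst 0) (Add (Var 0) (multE b (Var 1)))).

Definition countE (b : bool) (u : expr) : expr :=
  Let u (Rec (Glb 5) (Cst 0)
    (Add (Var 0) (Ite (eqE (voteE b (Var 1)) (Var 2)) (multE b (Var 1)) (Cst 0)))).

(* Variable 0 modulo 2 ^ (variable 1), by subtracting the higher powers. *)
Definition modpE : expr :=
  Rec (Sub (Glb 6) (Var 1)) (Var 0)
    (Let (Let (Sub (Sub (Glb 6) (Cst 1)) (Var 1)) pow2E)
      (Ite (Sub (Var 0) (Var 1)) (Var 1) (Sub (Var 1) (Var 0)))).

(** Digit [j] of [n] is 1 iff [2 ^ j] is at most the remainder of [n] modulo [2 ^ (j + 1)]. *)
Definition bitE : expr :=
  Ite (Sub (Let (Var 1) pow2E) (App2 modpE (Var 0) (Add (Var 1) (Cst 1)))) (Cst 0) (Cst 1).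

Definition symbolE (b : bool) (nthE i : expr) : expr :=
  Let (Sub (Sub (Glb 6) (Cst 1)) i)
    (Rec (Glb 4) (App2 pairE (App2 bitE (inputE (Add (Glb 2) (Cst 2))) (Var 0)) (Cst 0))
      (App2 pairE
        (App2 bitE (countE b (Let (App2 pairE (Glb 3) (Sub (Sub (Glb 4) (Cst 1)) (Var 1))) nthE))
                   (Var 2)) (Var 0))).

Definition statesE (b : bool) (nthE startE nextE : expr) : expr :=
  Rec (Glb 6) (Let (Glb 2) startE)
    (Let (App2 pairE (App2 pairE (Glb 2) (Var 0)) (symbolE b nthE (Var 1))) nextE).

Definition tauE : expr :=
  Rec (Glb 2) (Cst 0) (App2 pairE (indexE (simE 0 (Sub (Glb 2) (Var 1)))) (Var 0)).

Definition piE : expr :=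
  Rec (simE 1 (Cst 0)) (Cst 0)
    (App2 pairE (indexE (simE 1 (Sub (simE 1 (Cst 0)) (Var 1)))) (Var 0)).

Definition decideE (acceptE : expr) : expr :=
  Let (App2 pairE (App2 pairE (App2 pairE (Glb 7) (App2 pairE (Glb 2) (Glb 10))) (Glb 8))
        (Glb 9)) acceptE.

(** The input begins with the number of candidates followed by [C], which is the initial memory of a
    run on [C]; these [m + 1] numbers are copied into both simulated memories. *)
Definition fill_countE : expr := Add (inputE (Cst 0)) (Cst 1).

Definition candidateE : expr := indexE (inputE (Add (Glb 2) (Cst 1))).

Section MainCode.
Variables (K : nat) (b : bool) (QC QP : program).
Variables (permsE sizeE nthE startE nextE acceptE : expr).

Definition main_code : nat -> seq instr :=
  cseq (fill_code K 11 fill_countE (sim_addrE 0 (Var 0)) (inputE (Var 0)))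
 (cseq (fill_code K 11 fill_countE (sim_addrE 1 (Var 0)) (inputE (Var 0)))
 (cseq (sim_code 11 0 QC)
 (cseq (sim_code 11 1 QP)
 (cseq (set_code K 11 2 (inputE (Cst 0)))
 (cseq (set_code K 11 3 (Let (Glb 2) permsE))
 (cseq (set_code K 11 4 (Let (Glb 3) sizeE))
 (cseq (set_code K 11 5 (inputE (Add (Glb 2) (Cst 3))))
 (cseq (set_code K 11 6 (Lg (totalE b)))
 (cseq (set_code K 11 7 (statesE b nthE startE nextE))
 (cseq (set_code K 11 8 tauE)
 (cseq (set_code K 11 9 piE)
 (cseq (set_code K 11 10 candidateE)
       (set_code K 11 0 (decideE acceptE)))))))))))))).

Definition main_regs : nat :=
  regs fill_countE + (regs (sim_addrE 0 (Var 0)) + (regs (sim_addrE 1 (Var 0)) +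
  (regs (inputE (Var 0)) + (regs (inputE (Cst 0)) + (regs (Let (Glb 2) permsE) +
  (regs (Let (Glb 3) sizeE) + (regs (inputE (Add (Glb 2) (Cst 3))) +
  (regs (Lg (totalE b)) + (regs (statesE b nthE startE nextE) + (regs tauE + (regs piE +
  (regs candidateE + regs (decideE acceptE))))))))))))).

Definition fill_time (Y j : nat) : nat :=
  Y ^ degree fill_countE + 3 +
  Y * (Y ^ degree (sim_addrE j (Var 0)) + Y ^ degree (inputE (Var 0)) + 9).

Definition main_time (Y TC TP : nat) : nat :=
  fill_time Y 0 + (fill_time Y 1 + ((11 * TC + 11) + ((11 * TP + 11) +
  ((Y ^ degree (inputE (Cst 0)) + 2) + ((Y ^ degree (Let (Glb 2) permsE) + 2) +
  ((Y ^ degree (Let (Glb 3) sizeE) + 2) + ((Y ^ degree (inputE (Add (Glb 2) (Cst 3))) + 2) +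
  ((Y ^ degree (Lg (totalE b)) + 2) + ((Y ^ degree (statesE b nthE startE nextE) + 2) +
  ((Y ^ degree tauE + 2) + ((Y ^ degree piE + 2) + ((Y ^ degree candidateE + 2) +
  (Y ^ degree (decideE acceptE) + 2))))))))))))).

End MainCode.

Lemma wf_glb g g' n e : g <= g' -> wf g n e -> wf g' n e.
Proof.
move=> gg; elim: e n => //= [i|a IHa b IHb|a IHa b IHb|c IHc a IHa b IHb|a IHa b IHb
  |f IHf a IHa b IHb|c IHc b IHb s IHs] n.
- by move=> H; apply: leq_trans gg.
- by case/andP=> /IHa -> /IHb ->.
- by case/andP=> /IHa -> /IHb ->.
- by case/and3P=> /IHc -> /IHa -> /IHb ->.
- by case/andP=> /IHa -> /IHb ->.
- by case/and3P=> /IHf -> /IHa -> /IHb ->.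
- by case/and3P=> /IHc -> /IHb -> /IHs ->.
Qed.

Lemma computes_wf {A B : Type} {encA : encodable A} {encB : encodable B} e (f : A -> B) :
  computes e f -> forall g n, wf g n.+1 e.
Proof.
by move=> [_ w _] g n; apply: (wf_glb (leq0n g)); apply: wf_mono w.
Qed.

(* Common form of the two input models; without the flag the multiplicities
   are all 1 and not part of the input. *)
Definition input_of (b : bool) (C : seq nat) (Es : seq (seq nat * nat)) (p k : nat) : seq nat :=
  [:: size C] ++ C ++ [:: p; k; size Es] ++
  flatten [seq vm.1 ++ (if b then [:: vm.2] else [::]) | vm <- Es].

Definition voters_of (Es : seq (seq nat * nat)) : seq (seq nat) :=
  flatten [seq nseq vm.2 vm.1 | vm <- Es].

Lemma nth_flatten_uniform (ss : seq (seq nat)) q e l : all (fun s => size s == q) ss ->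
  e < size ss -> l < q -> nth 0 (flatten ss) (e * q + l) = nth 0 (nth [::] ss e) l.
Proof.
elim: ss e => //= s ss IH [|e] /andP[/eqP Hs Hss] He Hl; first by rewrite nth_cat Hs Hl.
rewrite nth_cat Hs mulSn ltnNge -addnA leq_addr /=.
by rewrite addKn IH.
Qed.

Lemma rev_lt i n : i < n -> n - 1 - i < n.
Proof. by lia. Qed.

Lemma modn_double r w : r < 2 * w -> r %% w = if w <= r then r - w else r.
Proof.
move=> Hr; case: leqP => wr; last by rewrite modn_small.
by rewrite -[in LHS](subnK wr) modnDr modn_small //; lia.
Qed.

Lemma divn_double r w : 0 < w -> r < 2 * w -> r %/ w = (w <= r).
Proof.
move=> w0 Hr; case: leqP => wr; last by rewrite divn_small.
by rewrite -[in LHS](subnK wr) divnDr // divnn w0 divn_small //; lia.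
Qed.

(** * Binary digits in polynomial time *)

Section Digits.
Variables (K Y L : nat).
Hypothesis LY : L <= Y.
Local Notation ev := (ev K Y).

(** Vote counts are too large for the counting loop of [modE]. Here [i] rounds reduce [n] modulo
    [2 ^ (L - i)], and each round subtracts the next lower power at most once. *)
Lemma ev_modp M n j : M 6 = L -> n < 2 ^ L -> j <= L -> ev M [:: n; j] modpE (n %% 2 ^ j).
Proof.
move=> H6 Hn Hj.
rewrite -[j in 2 ^ j](subKn Hj).
apply: (ev_rec (F := fun i => n %% 2 ^ (L - i))).
- exact: ev_sub (ev_glb _ _ _ H6) (ev_var _ _ _ _ 1).
- by lia.
- by rewrite subn0 modn_small //; exact: ev_var.
move=> i Hi; apply: (ev_let (u := 2 ^ (L - i.+1))).
  rewrite (_ : L - i.+1 = L - 1 - i); last by lia.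
  apply: ev_pow2; last by lia.
  apply: ev_sub; [exact: ev_sub (ev_glb _ _ _ H6) (ev_cst _ _ _ _ 1) | exact: (ev_var _ _ _ _ 1)].
have E : 2 ^ (L - i) = 2 * 2 ^ (L - i.+1) by rewrite -expnS; congr (_ ^ _); lia.
have Hlt : n %% 2 ^ (L - i) < 2 * 2 ^ (L - i.+1) by rewrite -E ltn_pmod // expn_gt0.
have -> : n %% 2 ^ (L - i.+1) = n %% 2 ^ (L - i) %% 2 ^ (L - i.+1).
  by rewrite modn_dvdm // E dvdn_mull.
rewrite [_ %% 2 ^ (L - i.+1)]modn_double //; clear E Hlt; move: (n %% 2 ^ (L - i)) (2 ^ (L - i.+1)) => r w.
apply: ev_ite; first exact: ev_sub (ev_var _ _ _ _ 0) (ev_var _ _ _ _ 1).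
  move=> /= Hne; rewrite ifN; first exact: (ev_var _ _ _ _ 1).
  by rewrite -subn_eq0.
move=> /= /eqP; rewrite subn_eq0 => ->.
exact: ev_sub (ev_var _ _ _ _ 1) (ev_var _ _ _ _ 0).
Qed.

Lemma ev_bit M n j : M 6 = L -> n < 2 ^ L -> j < L ->
  ev M [:: n; j] bitE ((n %/ 2 ^ j) %% 2).
Proof.
move=> H6 Hn Hj; have W0 : 0 < 2 ^ j by rewrite expn_gt0.
have Hlt : n %% (2 * 2 ^ j) < 2 * 2 ^ j by rewrite ltn_pmod // muln_gt0.
have E : n %% (2 * 2 ^ j) = n %% 2 ^ (j + 1) by rewrite addn1 expnS.
rewrite modn_divl divn_double // E.
apply: ev_ite; first apply: ev_sub.
- by apply: (@ev_pow2 K Y M [:: n; j] (Var 1) j) => //; lia.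
- apply: ev_app2 (ev_modp H6 Hn _); [exact: ev_var | | ].
    exact: ev_add (ev_var _ _ _ _ 1) (ev_cst _ _ _ _ 1).
  by rewrite /= addn1.
- by rewrite /= subn_eq0 => /negPf ->.
- by move=> /= /eqP; rewrite subn_eq0 => ->.
Qed.

End Digits.

(** * Values and loop counts of the program's expressions *)

Section Evaluation.
Variables (K Y : nat) (x : seq nat).
Variables (b : bool) (C : seq nat) (Es : seq (seq nat * nat)) (p k : nat).
Hypothesis (Hx : x = input_of b C Es p k).
Hypotheses (uC : uniq C) (pC : p \in C) (HE : all (is_vote C) (map fst Es)).
Hypothesis (Hb1 : ~~ b -> all (fun vm => vm.2 == 1) Es).
Local Notation m := (size C).
Local Notation idx := (fun a => index a C).
Local Notation sb := (save_base K x).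
Local Notation bb := (free_base K x).
Local Notation ev := (ev K Y).

Lemma size_input : size x = m + 4 + (\sum_(vm <- Es) (m + b)).
Proof.
rewrite Hx !size_cat /= size_flatten /shape sumnE !big_map.
rewrite [X in 3 + X](_ : _ = \sum_(vm <- Es) (m + b)); first by lia.
apply: eq_big_seq => vm Hvm; rewrite size_cat; have := allP HE vm.1 (map_f _ Hvm).
by rewrite /is_vote => /perm_size ->; case: (b).
Qed.

Lemma input_head i : i <= m -> nth 0 x i = nth 0 (m :: C) i.
Proof.
rewrite Hx; case: i => [|i] //= Hi.
by rewrite nth_cat Hi.
Qed.

Lemma input_p : nth 0 x (m + 1) = p.
Proof. by rewrite Hx addn1 /= nth_cat ltnn subnn. Qed.

Lemma input_k : nth 0 x (m + 2) = k.
Proof. by rewrite Hx addn2 /= nth_cat ltnNge leqnSn subSnn. Qed.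

Lemma input_nv : nth 0 x (m + 3) = size Es.
Proof.
by rewrite Hx addnS addn2 /= nth_cat ifN; [rewrite (_ : _ - _ = 2) //; lia | lia].
Qed.

Lemma entry_size : all (fun s => size s == m + b)
  [seq vm.1 ++ (if b then [:: vm.2] else [::]) | vm <- Es].
Proof.
apply/allP => s /mapP [vm Hvm ->]; rewrite size_cat.
have := allP HE vm.1 (map_f _ Hvm).
by rewrite /is_vote => /perm_size ->; case: (b).
Qed.

Lemma input_entry e l : e < size Es -> l < m + b ->
  nth 0 x (m + 4 + (e * (m + b) + l)) =
  nth 0 ((nth ([::], 0) Es e).1 ++ (if b then [:: (nth ([::], 0) Es e).2] else [::])) l.
Proof.
move=> He Hl; transitivity (nth 0 (flatten
    [seq vm.1 ++ (if b then [:: vm.2] else [::]) | vm <- Es]) (e * (m + b) + l)); last first.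
  by rewrite nth_flatten_uniform ?entry_size ?size_map // (nth_map ([::], 0)).
rewrite Hx /input_of; move: (flatten _) (e * (m + b) + l) => s i.
rewrite !nth_cat [size [:: m]]/= [size [:: p; k; size Es]]/= !ifN; try by lia.
by congr nth; lia.
Qed.

Lemma vote_size e : e < size Es -> size (nth ([::], 0) Es e).1 = m.
Proof.
move=> He; have := allP HE (nth ([::], 0) Es e).1 (map_f _ (mem_nth _ He)).
by rewrite /is_vote => /perm_size.
Qed.

Lemma input_vote e l : e < size Es -> l < m ->
  nth 0 x (m + 4 + (e * (m + b) + l)) = nth 0 (nth ([::], 0) Es e).1 l.
Proof.
move=> He Hl; rewrite input_entry //; last by lia.
by rewrite nth_cat vote_size // Hl.
Qed.

Lemma input_mult e : e < size Es -> b ->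
  nth 0 x (m + 4 + (e * (m + b) + m)) = (nth ([::], 0) Es e).2.
Proof.
move=> He Hb; rewrite input_entry //; last by rewrite Hb; lia.
by rewrite nth_cat vote_size // ltnn subnn Hb.
Qed.

Definition input_at (M : memory) : Prop :=
  [/\ M 0 = bb, M 1 = K,
      forall i, i < K - 1 -> M (sb + i) = nth 0 x i
    & forall r, K <= r -> r < sb -> M r = nth 0 x r.-1].

Hypotheses (K12 : 12 <= K).

Lemma size_x_gt0 : 0 < size x.
Proof. by rewrite size_input; lia. Qed.

Lemma input_at_agree M M' : input_at M ->
  (forall r, (r < 2) || (K <= r) && (r < bb) -> M' r = M r) -> input_at M'.
Proof.
have Hs := save_base_ge (ltnW (leq_trans (isT : 2 < 12) K12)) size_x_gt0.
move=> [H0 H1 H2 H3] H; split=> [||i Hi|r Hr1 Hr2].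
- by rewrite H.
- by rewrite H.
- by rewrite H ?H2 // /free_base; lia.
- by rewrite H ?H3 // /free_base; lia.
Qed.

Lemma ev_input M env e i : input_at M -> i < size x -> ev M env e i ->
  ev M env (inputE e) (nth 0 x i).
Proof.
have Hs := save_base_ge (ltnW (leq_trans (isT : 2 < 12) K12)) size_x_gt0.
move=> [H0 H1 H2 H3] Hi He; apply: ev_ite.
- by apply: ev_sub; [apply: ev_glb H1 | apply: ev_add He (ev_cst _ _ _ _ 1)].
(* Here [i + 1 < K], so the original cell is now a register and the saved copy is read, at
   [sb + i = bb + i + 1 - K]. As [Read] adds [K], register 1 is subtracted twice. *)
- move=> Hne; apply: ev_eq; first apply: ev_read; first apply: ev_sub.
  + apply: ev_add (ev_cst _ _ _ _ 1); exact: (ev_add (ev_glb _ _ _ H0) He).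
  + exact: (ev_add (ev_glb _ _ _ H1) (ev_glb _ _ _ H1)).
  rewrite -H2; last by lia.
  by congr (M _); rewrite /free_base; lia.
- move=> E; apply: ev_eq; first apply: ev_read; first apply: ev_sub.
  + exact: (ev_add He (ev_cst _ _ _ _ 1)).
  + exact: ev_glb H1.
  rewrite -[i in RHS]/(i.+1.-1) -H3; try by lia.
  by congr (M _); lia.
Qed.

Lemma ev_sim_addr M env j e i : input_at M -> ev M env e i ->
  ev M env (sim_addrE j e) (bb + (i + i + j) - K).
Proof.
move=> [H0 H1 _ _] He; apply: ev_sub; last exact: ev_glb H1.
apply: ev_add (ev_add (ev_add He He) (ev_cst _ _ _ _ j)).
exact: ev_glb H0.
Qed.

Lemma ev_sim M env j e i : input_at M -> ev M env e i ->
  ev M env (simE j e) (M (cell bb j i)).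
Proof.
have Hs := save_base_ge (ltnW (leq_trans (isT : 2 < 12) K12)) size_x_gt0.
move=> HM He; apply: ev_eq (ev_read (ev_sim_addr j HM He)) _.
by congr (M _); rewrite /cell /free_base; lia.
Qed.

Hypotheses (mY : m + 1 <= Y).

Lemma ev_index M env e c : input_at M -> M 2 = m -> c \in C -> ev M env e c ->
  ev M env (indexE e) (idx c).
Proof.
move=> HM H2 Hc He; apply: ev_let He _.
rewrite -[idx c](_ : (fun i => if idx c < i then idx c else 0) m = _); last by rewrite /= index_mem Hc.
apply: (ev_rec (F := fun i => if idx c < i then idx c else 0)) => //; first by lia.
move=> i Hi; apply: ev_ite.
- apply: ev_eqE; last exact: ev_var.
  apply: (ev_input (i := i + 1)) => //; by rewrite size_input; lia.
- rewrite input_head; last by lia.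
  rewrite addn1 /= eqb0 negbK => /eqP E.
  apply: ev_eq; first exact: (ev_var _ _ _ _ 1).
  by rewrite /= -E index_uniq // ltnSn.
- rewrite input_head; last by lia.
  rewrite addn1 /= => /eqP; rewrite eqb0 => /eqP E.
  apply: ev_eq; first exact: (ev_var _ _ _ _ 0).
  rewrite /= ltnS (leq_eqVlt (idx c) i); case: (idx c =P i) => //= Ei.
  by case: E; rewrite -Ei nth_index.
Qed.

Lemma ev_stride M env : M 2 = m -> ev M env (strideE b) (m + b).
Proof.
move=> H2; rewrite /strideE; case: (b); last by rewrite addn0; apply: ev_glb.
exact: ev_add (ev_glb _ _ _ H2) (ev_cst _ _ _ _ 1).
Qed.

Lemma ev_pos M env e o i l : M 2 = m -> ev M env e i -> ev M env o l ->
  ev M env (posE b e o) (m + 4 + (i * (m + b) + l)).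
Proof.
move=> H2 He Ho; apply: ev_add; first exact: ev_add (ev_glb _ _ _ H2) (ev_cst _ _ _ _ 4).
apply: ev_add Ho; apply: ev_mul => //; first exact: ev_stride.
by move: mY; case: (b) => /=; lia.
Qed.

Lemma pos_lt e l : e < size Es -> l < m + b -> m + 4 + (e * (m + b) + l) < size x.
Proof.
move=> He Hl; rewrite size_input big_const_seq count_predT iter_addn_0 [(m + b) * _]mulnC.
have : e.+1 * (m + b) <= size Es * (m + b) by rewrite leq_mul2r He orbT.
by rewrite mulSn; lia.
Qed.

Variable (N : nat).
Hypothesis pairY : forall M u v, u <= N -> v <= N -> cost K M pairE [:: u; v] <= Y.
Hypothesis mN : m <= N.
Hypothesis listN : forall s : seq nat, all (fun a => a <= m) s ->
  size s <= m + 2 * (m * m) -> enc s <= N.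

Lemma index_list_le (s : seq nat) : {subset s <= C} -> size s <= m + 2 * (m * m) ->
  enc (map idx s) <= N.
Proof.
move=> Hs Hsz; apply: listN; last by rewrite size_map.
by apply/allP => a /mapP [c /Hs Hc ->]; rewrite ltnW // index_mem.
Qed.

(** The length bound [m + 2 * (m * m)] covers votes and the candidate order, of length [m], as well
    as the flattened pair order, of length at most [2 * (m * m)]. *)
Lemma ev_index_list M env n s (l : seq nat) : input_at M -> M 2 = m ->
  {subset l <= C} -> size l <= m + 2 * (m * m) -> size l <= Y -> ev M env n (size l) ->
  (forall i acc, i < size l -> ev M [:: acc, i & env] s (nth 0 l (size l - 1 - i))) ->
  ev M env (Rec n (Cst 0) (App2 pairE (indexE s) (Var 0))) (enc (map idx l)).
Proof.
move=> HM H2 Hl Hsz HY Hn Hs.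
have -> : map idx l = [seq idx (nth 0 l j) | j <- iota 0 (size l)] ++ [::].
  by rewrite cats0 -[in LHS](mkseq_nth 0 l) -map_comp.
apply: (@ev_list K Y M env n _ _ (size l) (fun j => idx (nth 0 l j)) [::]) => // i acc Hi Eacc.
have Hnth : nth 0 l (size l - 1 - i) \in C by apply: Hl; rewrite mem_nth // rev_lt.
apply: ev_pair.
- apply: pairY; first by apply: leq_trans mN; rewrite ltnW // index_mem.
  rewrite Eacc cats0.
  have -> : [seq idx (nth 0 l j) | j <- iota (size l - i) i] = map idx (drop (size l - i) l).
    transitivity (map idx [seq nth 0 l j | j <- iota (size l - i) i]); first by rewrite -map_comp.
    congr map; rewrite -[RHS](mkseq_nth 0) size_drop subKn 1?ltnW //.
    rewrite /mkseq -[size l - i]addn0 iotaDl -map_comp addn0.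
    by apply: eq_map => j; rewrite /= nth_drop.
  apply: index_list_le; first by move=> a /mem_drop /Hl.
  by rewrite size_drop; lia.
- by apply: ev_index => //; apply: Hs.
- exact: ev_var.
Qed.

Lemma ev_vote M env e i : input_at M -> M 2 = m -> i < size Es -> ev M env e i ->
  ev M env (voteE b e) (enc (map idx (nth ([::], 0) Es i).1)).
Proof.
move=> HM H2 Hi He; apply: ev_let He _.
have Hv : is_vote C (nth ([::], 0) Es i).1 by apply: (allP HE); rewrite map_f ?mem_nth.
have Hsz := vote_size Hi.
apply: ev_index_list => //; rewrite ?Hsz.
- exact: vote_sub Hv.
- exact: leq_addr.
- by lia.
- exact: ev_glb.
move=> l acc Hl; rewrite -input_vote //; last by lia.
apply: ev_input => //; first by apply: pos_lt => //; lia.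
apply: ev_pos => //; apply: ev_sub; last exact: (ev_var _ _ _ _ 1).
exact: ev_sub (ev_glb _ _ _ H2) (ev_cst _ _ _ _ 1).
Qed.

Lemma ev_mult M env e i : input_at M -> M 2 = m -> i < size Es -> ev M env e i ->
  ev M env (multE b e) (nth ([::], 0) Es i).2.
Proof.
move=> HM H2 Hi He; rewrite /multE; have [Hb|Hb] := boolP b.
  rewrite -[in X in posE X]Hb -input_mult //; apply: ev_input => //.
    by apply: pos_lt => //; rewrite Hb; lia.
  by apply: ev_pos => //; apply: ev_glb.
apply: ev_eq; first exact: ev_cst.
by apply/esym/eqP; apply: (allP (Hb1 Hb)); rewrite mem_nth.
Qed.

(** The budget, all vote counts and all move counts are at most this number, so its length [L]
    suffices for all digit expansions. *)
Definition total : nat := k + \sum_(vm <- Es) vm.2.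

Hypothesis EY : size Es <= Y.

Lemma sum_take (F : seq nat * nat -> nat) i : i < size Es ->
  \sum_(vm <- take i.+1 Es) F vm = \sum_(vm <- take i Es) F vm + F (nth ([::], 0) Es i).
Proof. by move=> Hi; rewrite (take_nth ([::], 0)) // -cats1 big_cat big_seq1. Qed.

Lemma ev_total M : input_at M -> M 2 = m -> M 5 = size Es -> ev M [::] (totalE b) total.
Proof.
move=> HM H2 H5; apply: ev_add.
  rewrite -input_k; apply: ev_input => //; first by rewrite size_input; lia.
  exact: ev_add (ev_glb _ _ _ H2) (ev_cst _ _ _ _ 2).
rewrite -[in X in ev _ _ _ X](take_size Es).
apply: (ev_rec (F := fun i => \sum_(vm <- take i Es) vm.2)) => //.
  by rewrite take0 big_nil; apply: ev_cst.
move=> i Hi; rewrite sum_take //.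
by apply: ev_add; [exact: ev_var | apply: ev_mult => //; exact: (ev_var _ _ _ _ 1)].
Qed.

Definition votes_for (u : seq nat) : nat := count_mem u (map (map idx) (voters_of Es)).

Lemma votes_for_sum u :
  votes_for u = \sum_(vm <- Es) (if map idx vm.1 == u then vm.2 else 0).
Proof.
rewrite /votes_for /voters_of; elim: (Es) => [|vm s IH]; first by rewrite big_nil.
rewrite big_cons /= map_cat count_cat IH; congr (_ + _).
by rewrite map_nseq count_nseq /=; case: eqP => _; rewrite ?mul1n ?mul0n.
Qed.

Lemma ev_count M env e u : input_at M -> M 2 = m -> M 5 = size Es -> ev M env e (enc u) ->
  ev M env (countE b e) (votes_for u).
Proof.
move=> HM H2 H5 He; apply: ev_let He _.
rewrite votes_for_sum -[in X in ev _ _ _ X](take_size Es).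
apply: (ev_rec (F := fun i => \sum_(vm <- take i Es) (if map idx vm.1 == u then vm.2 else 0))) => //.
  by rewrite take0 big_nil; apply: ev_cst.
move=> i Hi; rewrite sum_take //; apply: ev_add; first exact: ev_var.
apply: ev_ite.
- by apply: ev_eqE; [apply: (ev_vote (i := i)) | exact: (ev_var _ _ _ _ 2)].
- rewrite eqb0 negbK => /eqP E; rewrite (_ : map idx _ = u) ?eqxx; last exact: (@enc_inj (seq nat) _ _ _ E).
  by apply: ev_mult => //; exact: (ev_var _ _ _ _ 1).
- move/eqP; rewrite eqb0 => /eqP E; rewrite ifN; first exact: ev_cst.
  by apply/eqP => E'; apply: E; rewrite /= E'.
Qed.

Variable (L : nat).
Hypotheses (LY : L <= Y) (totalL : total < 2 ^ L).

Lemma votes_for_le u : votes_for u <= total.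
Proof.
rewrite votes_for_sum /total; apply: leq_trans (leq_addl _ _).
by rewrite leq_sum // => vm _; case: ifP.
Qed.

(** Digits are numbered from the most significant one, in their order of reading. *)
Definition digit_of (n i : nat) : nat := (n %/ 2 ^ (L - 1 - i)) %% 2.

Definition symbol (i : nat) : seq nat :=
  [seq digit_of (votes_for u) i | u <- perms m] ++ [:: digit_of k i].

Lemma digit_of_le n i : digit_of n i <= 1.
Proof. by rewrite -ltnS ltn_pmod. Qed.

Hypothesis symbolN : forall s : seq nat, all (fun a => a <= 1) s ->
  size s <= (size (perms m)).+1 -> enc s <= N.
Hypotheses (permsN : enc (perms m) <= N) (permsY : size (perms m) <= Y).

Variables (nthE startE nextE : expr).
Hypothesis nthE_ok : computes nthE (fun z : seq (seq nat) * nat => nth [::] z.1 z.2).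
Hypothesis nthY : forall M env i, i < size (perms m) ->
  cost K M nthE (enc (perms m, i) :: env) <= Y.

Definition state_regs (M : memory) : Prop :=
  [/\ M 2 = m, M 3 = enc (perms m), M 4 = size (perms m), M 5 = size Es & M 6 = L].

Lemma ev_symbol M env e i : input_at M -> state_regs M -> i < L -> ev M env e i ->
  ev M env (symbolE b nthE e) (enc (symbol i)).
Proof.
move=> HM [H2 H3 H4 H5 H6] Hi He.
apply: (ev_let (u := L - 1 - i)).
  exact: ev_sub (ev_sub (ev_glb _ _ _ H6) (ev_cst _ _ _ _ 1)) He.
have HjL : L - 1 - i < L by move: Hi; clear; lia.
have bit1 : forall n, n %/ 2 ^ (L - 1 - i) %% 2 <= N.
  move=> n; have -> : n %/ 2 ^ (L - 1 - i) %% 2 = digit_of n i by [].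
  have := @symbolN [:: digit_of n i]; rewrite /= digit_of_le => /(_ isT isT).
  by apply: leq_trans; apply: ltnW; apply: cpair_ltl.
have Hbit n : n <= total -> ev M [:: n; L - 1 - i] bitE (digit_of n i).
  by move=> Hn; exact: (@ev_bit K Y L LY M n (L - 1 - i) H6 (leq_ltn_trans Hn totalL) HjL).
rewrite /symbol.
have -> : [seq digit_of (votes_for u) i | u <- perms m] =
    [seq digit_of (votes_for (nth [::] (perms m) j)) i | j <- iota 0 (size (perms m))].
  by rewrite -[in LHS](mkseq_nth [::] (perms m)) -map_comp.
apply: (@ev_list K Y M _ _ _ _ _ (fun j => digit_of (votes_for (nth [::] (perms m) j)) i)) => //.
  apply: ev_pair => //; first by apply: pairY; [exact: bit1 | ].
  apply: (@ev_app2 K Y M _ _ _ _ k (L - 1 - i)).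
  2: exact: ev_var.
  2: exact: (Hbit k (leq_addr _ _)).
  rewrite -[in X in ev _ _ _ X]input_k; apply: ev_input => //; first by rewrite size_input; clear; lia.
  exact: ev_add (ev_glb _ _ _ H2) (ev_cst _ _ _ _ 2).
move=> l acc Hl Eacc.
have Hl' : size (perms m) - 1 - l < size (perms m) by move: Hl; clear; lia.
apply: ev_pair; last exact: ev_var.
  apply: pairY; first exact: bit1.
  rewrite Eacc; apply: symbolN.
    rewrite all_cat /= digit_of_le !andbT.
    by apply/allP => a /mapP [j _ ->]; apply: digit_of_le.
  by rewrite size_cat size_map size_iota /=; move: Hl; clear; lia.
apply: (@ev_app2 K Y M _ _ _ _ (votes_for (nth [::] (perms m) (size (perms m) - 1 - l))) (L - 1 - i)).
2: exact: (ev_var _ _ _ _ 2).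
2: exact: (Hbit _ (votes_for_le _)).
apply: ev_count => //.
apply: (ev_call (x := (perms m, size (perms m) - 1 - l)) nthE_ok); last exact: nthY.
apply: ev_pair.
- apply: pairY; first exact: permsN.
  exact: leq_trans (ltnW Hl') (leq_trans (size_enc _) permsN).
- exact: ev_glb.
- apply: ev_sub; last exact: (ev_var _ _ _ _ 1).
  exact: ev_sub (ev_glb _ _ _ H4) (ev_cst _ _ _ _ 1).
Qed.

Hypotheses (startE_ok : computes startE start_states)
  (nextE_ok : computes nextE (fun z : nat * seq (seq nat) * seq nat => next_states z.1.1 z.1.2 z.2)).
Hypothesis startY : forall M env, cost K M startE (enc m :: env) <= Y.
Hypothesis statesN : enc (start_states m) + enc (words (width m + width m + 1) (size (labels m))) <= N.
Hypothesis pairY2 : forall M u v, u <= cpair N N -> v <= N -> cost K M pairE [:: u; v] <= Y.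
Hypothesis nextY : forall M env (S : seq (seq nat)) (sg : seq nat), enc S <= N -> enc sg <= N ->
  cost K M nextE (enc (m, S, sg) :: env) <= Y.

Definition states (i : nat) : seq (seq nat) :=
  iteri i (fun i S => next_states m S (symbol i)) (start_states m).

Lemma states_le i : enc (states i) <= N.
Proof.
case: i => [|i]; first exact: leq_trans (leq_addr _ _) statesN.
rewrite /states iteriS; apply: leq_trans (leq_trans (leq_addl _ _) statesN).
exact: seq_enc_filter.
Qed.

Lemma symbol_le i : enc (symbol i) <= N.
Proof.
apply: symbolN; last by rewrite size_cat size_map /= addn1.
rewrite all_cat /= digit_of_le !andbT.
by apply/allP => a /mapP [j _ ->]; apply: digit_of_le.
Qed.

Lemma ev_states M : input_at M -> state_regs M ->
  ev M [::] (statesE b nthE startE nextE) (enc (states L)).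
Proof.
move=> HM HR; have [H2 H3 H4 H5 H6] := HR.
apply: (ev_rec (F := fun i => enc (states i))); [exact: ev_glb|exact: LY| |].
  by apply: (ev_call (x := m) startE_ok); [exact: ev_glb | exact: startY].
move=> i Hi; rewrite /states iteriS -/(states i).
apply: (ev_call (x := (m, states i, symbol i)) nextE_ok); last first.
  by apply: nextY; [exact: states_le | exact: symbol_le].
apply: ev_pair; last by apply: ev_symbol => //; exact: (ev_var _ _ _ _ 1).
  by apply: pairY2; [apply: leq_cpair; rewrite ?states_le | exact: symbol_le].
apply: ev_pair; [|exact: ev_glb|exact: ev_var].
by apply: pairY => //; exact: states_le.
Qed.

Lemma mem_states s : s \in states L <->
  exists y, (forall j, j < nmoves m -> y j < 2 ^ L) /\ s = final_state C (voters_of Es) k y.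
Proof.
(* The number formed by the first [i] digits of the constant term: dropping the last [L - i] digits
   leaves 0 at the start and the whole number at the end. *)
pose beta i r := if i <= L then supply C (voters_of Es) k r %/ 2 ^ (L - i) else 0.
have Hsup r : supply C (voters_of Es) k r < 2 ^ L.
  have [Hr|Hr] := ltnP r (size (perms m) + 1); last first.
    by rewrite /supply nth_default ?expn_gt0 // size_cat size_map.
  rewrite /supply nth_cat size_map; case: ifP => Hr'.
    rewrite (nth_map [::]) //; apply: leq_ltn_trans totalL; exact: votes_for_le.
  have -> : r - size (perms m) = 0 by move: Hr Hr'; clear; lia.
  by apply: leq_ltn_trans totalL; apply: leq_addr.
have Esym i r : nth 0 (symbol i) r = digit_of (supply C (voters_of Es) k r) i.
  rewrite /symbol /supply -[[:: digit_of k i]]/(map (digit_of^~ i) [:: k]).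
  rewrite (map_comp (digit_of^~ i)) -map_cat; set s' := _ ++ _.
  have [Hr|Hr] := ltnP r (size s'); first by rewrite (nth_map 0).
  by rewrite !nth_default ?size_map // /digit_of div0n mod0n.
have Hc y : clip (size (labels m)) (nmoves m) (width m) (rowP m) (rowM m) (beta L) y =
    final_state C (voters_of Es) k y.
  by apply: eq_map => r; rewrite /beta leqnn subnn expn0 divn1.
have [|r _|i r Hi _|H1 H2] := @reachable_states (size (labels m)) (nmoves m) (width m)
    (rowP m) (rowM m) (@rowP_lt m) (@rowM_le m) symbol beta L _ _ _ s.
- by move=> i r; rewrite Esym digit_of_le.
- by rewrite /beta /= subn0 divn_small.
- rewrite Esym /beta Hi (ltnW Hi) /digit_of.
  have -> : L - i = (L - 1 - i).+1 by move: Hi; clear; lia.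
  have -> : L - i.+1 = L - 1 - i by move: Hi; clear; lia.
  rewrite expnSr divnMA; move: (_ %/ 2 ^ _) => q.
  by rewrite addnn -muln2 -divn_eq.
split=> [/H1 [y [Hy E]]|[y [Hy E]]]; first by exists y; rewrite -Hc.
by apply: H2; exists y; rewrite Hc.
Qed.

Definition sim_output (j : nat) (l : seq nat) (M : memory) : Prop :=
  M (cell bb j 0) = size l /\ forall i, i < size l -> M (cell bb j i.+1) = nth 0 l i.

Lemma ev_tau M l : input_at M -> M 2 = m -> sim_output 0 l M -> size l = m ->
  {subset l <= C} -> ev M [::] tauE (enc (map idx l)).
Proof.
move=> HM H2 [_ Hl] Hsz Hsub; apply: ev_index_list => //.
- by rewrite Hsz leq_addr.
- by rewrite Hsz; apply: leq_trans mY; rewrite addn1.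
- by rewrite Hsz; exact: ev_glb.
move=> i acc Hi; rewrite -Hl ?rev_lt //; apply: ev_sim => //.
rewrite (_ : (size l - 1 - i).+1 = m - i); last by move: Hi; rewrite Hsz; clear; lia.
exact: ev_sub (ev_glb _ _ _ H2) (ev_var _ _ _ _ 1).
Qed.

Hypothesis mmY : 2 * (m * m) <= Y.

Lemma ev_pi M l : input_at M -> M 2 = m -> sim_output 1 l M -> size l <= 2 * (m * m) ->
  {subset l <= C} -> ev M [::] piE (enc (map idx l)).
Proof.
move=> HM H2 [Hl0 Hl] Hsz Hsub.
have Hn env : ev M env (simE 1 (Cst 0)) (size l).
  by rewrite -Hl0; apply: ev_sim => //; exact: ev_cst.
apply: ev_index_list => //.
- exact: leq_trans Hsz (leq_addl _ _).
- exact: leq_trans Hsz mmY.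
move=> i acc Hi; rewrite -Hl ?rev_lt //; apply: ev_sim => //.
rewrite (_ : (size l - 1 - i).+1 = size l - i); last by move: Hi; clear; lia.
exact: ev_sub (Hn _) (ev_var _ _ _ _ 1).
Qed.

Variables (constructive unique : bool) (acceptE : expr) (N4 : nat).
Hypothesis acceptE_ok : computes acceptE
  (fun z : seq (seq nat) * (nat * nat) * seq nat * seq nat =>
    accept constructive unique z.1.1.1 z.1.1.2 z.1.2 z.2).
Hypothesis N4_ge : cpair (cpair N (cpair N N)) N <= N4.
Hypothesis pairY4 : forall M u v, u <= N4 -> v <= N4 -> cost K M pairE [:: u; v] <= Y.
Hypothesis acceptY : forall M env (z : seq (seq nat) * (nat * nat) * seq nat * seq nat),
  enc z <= cpair N4 N -> cost K M acceptE (enc z :: env) <= Y.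

Lemma ev_decide M S tau pi : M 2 = m -> M 7 = enc S -> M 8 = enc tau -> M 9 = enc pi ->
  M 10 = idx p -> enc S <= N -> enc tau <= N -> enc pi <= N ->
  ev M [::] (decideE acceptE) (accept constructive unique S (m, idx p) tau pi).
Proof.
move=> H2 H7 H8 H9 H10 HS Ht Hp.
have HiN : idx p <= N by apply: leq_trans mN; rewrite ltnW // index_mem.
have H1 : cpair m (idx p) <= cpair N N by apply: leq_cpair.
have H1' : cpair (enc S) (cpair m (idx p)) <= cpair N (cpair N N) by apply: leq_cpair.
have H1'' : cpair (cpair (enc S) (cpair m (idx p))) (enc tau) <= N4.
  by apply: leq_trans N4_ge; apply: leq_cpair.
have NN : cpair N N <= N4.
  by apply: leq_trans N4_ge; apply: leq_cpair => //; apply: ltnW; apply: cpair_ltl.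
have NNN : cpair N (cpair N N) <= N4 by apply: leq_trans N4_ge; apply: ltnW; apply: cpair_ltl.
have N4N : N <= N4 by apply: leq_trans NN; apply: ltnW; apply: cpair_ltl.
apply: (ev_call (x := (S, (m, idx p), tau, pi)) acceptE_ok); last first.
  by apply: acceptY; apply: leq_cpair.
apply: ev_pair; [| |exact: ev_glb].
  by apply: pairY4 => //; exact: leq_trans Hp N4N.
apply: ev_pair; [| |exact: ev_glb].
  by apply: pairY4; [exact: leq_trans H1' NNN | exact: leq_trans Ht N4N].
apply: ev_pair; [|exact: ev_glb|].
  by apply: pairY4; [exact: leq_trans HS N4N | exact: leq_trans H1 NN].
apply: ev_pair; [|exact: ev_glb|exact: ev_glb].
by apply: pairY4; [exact: leq_trans mN N4N | exact: leq_trans HiN N4N].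
Qed.

(** * Contents of the simulated memories *)

Lemma fill_mem_cell A V M n j a r : (forall i, K + A i = cell bb j i) -> r = cell bb j a ->
  fill_mem K A V M n r = if a < n then V a else M r.
Proof.
move=> HA Hr; elim: n => // n IH.
rewrite -[LHS]/(upd (fill_mem K A V M n) (K + A n) (V n) r) updE IH HA Hr.
rewrite (_ : (cell bb j a == cell bb j n) = (a == n)); last by rewrite /cell; clear; lia.
by case: (ltngtP a n) => [an|an|->]; rewrite ?ltnS ?leqnn ?(ltnW an) // leqNgt an.
Qed.

Lemma fill_mem_other A V M n j r : (forall i, K + A i = cell bb j i) ->
  (forall a, r != cell bb j a) -> fill_mem K A V M n r = M r.
Proof.
move=> HA Hr; elim: n => // n IH.
by rewrite -[LHS]/(upd (fill_mem K A V M n) (K + A n) (V n) r) updE IH HA (negPf (Hr n)).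
Qed.

Variables (permsE sizeE : expr).
Hypotheses (permsE_ok : computes permsE perms)
  (sizeE_ok : computes sizeE (fun s : seq (seq nat) => size s)).
Hypothesis permsEY : forall M env, cost K M permsE (enc m :: env) <= Y.
Hypothesis sizeEY : forall M env, cost K M sizeE (enc (perms m) :: env) <= Y.

Variables (QC QP : program) (TC TP : nat) (lc lp : seq nat).
Hypotheses (haltC : halted QC (exec QC TC (init C))) (outC : output (exec QC TC (init C)) = lc).
Hypotheses (haltP : halted QP (exec QP TP (init C))) (outP : output (exec QP TP (init C)) = lp).
Hypotheses (lc_size : size lc = m) (lc_sub : {subset lc <= C}).
Hypotheses (lp_size : size lp <= 2 * (m * m)) (lp_sub : {subset lp <= C}).
Hypotheses (HL : L = lg total) (Y16 : 16 <= Y).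
Hypothesis HK : 40 + main_regs b permsE sizeE nthE startE nextE acceptE <= K.

Lemma K_le_bb : K <= bb.
Proof.
have := save_base_ge (ltnW (leq_trans (isT : 2 < 12) K12)) size_x_gt0.
by rewrite /free_base; move: K12; clear; lia.
Qed.

Lemma phase_set_ev i e v M : i < 11 -> wf 11 0 e -> 11 + regs e <= K -> ev M [::] e v ->
  phase K 11 (set_code K 11 i e) M (upd M i v) (Y ^ degree e + 2).
Proof.
move=> Hi He Hr [<- Hl] P pc mm Hc Hm.
have [t [m' [Ht Hx' Hm']]] := @phase_set K 11 i e M Hi He Hr P pc mm Hc Hm.
exists t, m'; split=> //; apply: leq_trans Ht _.
by rewrite leq_add2r; apply: cost_degree.
Qed.

Definition sim_cells (j i : nat) : nat := bb + (i + i + j) - K.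

Lemma sim_cellsE j i : K + sim_cells j i = cell bb j i.
Proof. by rewrite /sim_cells /cell; have := K_le_bb; clear; lia. Qed.

Lemma cell_neq j j' a a' : j < 2 -> j' < 2 -> j != j' -> cell bb j a != cell bb j' a'.
Proof. by rewrite /cell; clear; lia. Qed.

Lemma cell_ge j a r : (r < 2) || (K <= r) && (r < bb) -> r != cell bb j a.
Proof. by have := K_le_bb; move: K12; rewrite /cell; clear; lia. Qed.

Definition filled (j : nat) (M : memory) : memory :=
  fill_mem K (sim_cells j) (nth 0 x) M (m + 1).

Lemma input_at_fill j M n : input_at M -> input_at (fill_mem K (sim_cells j) (nth 0 x) M n).
Proof.
move=> HM; apply: input_at_agree HM _ => r Hr.
by apply: (fill_mem_other _ _ _ (sim_cellsE j)) => a; apply: cell_ge.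
Qed.

Lemma phase_fill_ev j M : input_at M ->
  wf 11 1 (sim_addrE j (Var 0)) -> 16 + regs (sim_addrE j (Var 0)) + regs (inputE (Var 0)) <= K ->
  11 + regs fill_countE <= K ->
  phase K 11 (fill_code K 11 fill_countE (sim_addrE j (Var 0)) (inputE (Var 0))) M
    (filled j M) (fill_time Y j).
Proof.
move=> HM Hw Hr Hr'.
have [En Ln] : ev M [::] fill_countE (m + 1).
  apply: ev_add (ev_cst _ _ _ _ 1).
  rewrite -[in X in ev _ _ _ X](_ : nth 0 x 0 = m); last by rewrite input_head.
  by apply: ev_input => //; exact: size_x_gt0.
move=> P pc mm Hc Hm.
have [|t [m' [Ht Hx' Hm']]] := @phase_fill K 11 fill_countE (sim_addrE j (Var 0)) (inputE (Var 0))
   M (m + 1) (sim_cells j) (nth 0 x) (Y ^ degree (sim_addrE j (Var 0)))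
   (Y ^ degree (inputE (Var 0))) isT Hw isT Hr' Hr En _ P pc mm Hc Hm.
  move=> i Hi M'; have HM' : input_at M' by apply: input_at_fill.
  have [E1 L1] := ev_sim_addr j HM' (ev_var K Y M' [:: i] 0).
  have [|E2 L2] := ev_input HM' _ (ev_var K Y M' [:: i] 0).
    by rewrite /= size_input; move: Hi; clear; lia.
  by split=> //; apply: cost_degree.
exists t, m'; split=> //; apply: leq_trans Ht _; rewrite /fill_time.
apply: leq_add; first by rewrite leq_add2r; apply: cost_degree.
by rewrite leq_mul2r mY orbT.
Qed.

Definition overlaid (j : nat) (s : state) (M : memory) : memory := overlay bb j s.2 M.

Lemma overlaid_cell j s M a : j < 2 -> overlaid j s M (cell bb j a) = s.2 a.
Proof.
move=> Hj; rewrite /overlaid /overlay /cell -addnA leq_addr addKn addnn.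
rewrite oddD odd_double /= (_ : odd j == (j == 1)); last by move: Hj; case: j => [|[|]].
by congr (s.2 _); move: Hj; case: j => [|[|//]] _; rewrite ?addn0 ?addn1 ?doubleK //= uphalf_double.
Qed.

Lemma overlaid_other j s M r : j < 2 -> (forall a, r != cell bb j a) -> overlaid j s M r = M r.
Proof.
move=> Hj H; rewrite /overlaid /overlay; case: ifP => // /andP[Hb /eqP Ho].
have := H (r - bb)./2; rewrite /cell addnn.
have := odd_double_half (r - bb); rewrite Ho => E.
case/eqP; move: E Hj; case: (j =P 1) => [->|]; move: Hb; clear; lia.
Qed.

Lemma input_at_overlaid j s M : j < 2 -> input_at M -> input_at (overlaid j s M).
Proof.
move=> Hj HM; apply: input_at_agree HM _ => r Hr.
by apply: overlaid_other => // a; apply: cell_ge.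
Qed.

Lemma input_at_upd i v M : 1 < i -> i < 11 -> input_at M -> input_at (upd M i v).
Proof.
move=> Hi Hi' HM; apply: input_at_agree HM _ => r Hr; rewrite upd_neq //.
by move: Hi Hi' Hr K12; clear; lia.
Qed.

(** Beyond the copied numbers [init C] is zero, so the free cells must be zero beforehand. The
    second alternative serves the odd cells, after the even ones have been filled. *)
Lemma filled_init j M : (forall r, bb <= r -> M r = 0) \/ (forall a, M (cell bb j a) = 0) ->
  forall a, filled j M (cell bb j a) = (init C).2 a.
Proof.
move=> HM a; rewrite /filled (fill_mem_cell _ _ _ (sim_cellsE j) (erefl (cell bb j a))).
case: ltnP => Ha.
  have Ham : a <= m by move: Ha; clear; lia.
  by rewrite input_head //; case: a Ha Ham.
have -> : M (cell bb j a) = 0.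
  by case: HM => // HM; apply: HM; rewrite /cell -addnA leq_addr.
have Ha' : size C <= a.-1 by move: Ha; clear; lia.
by rewrite /init /= nth_default //; move: Ha; clear; case: a => [|a] //; rewrite addn1.
Qed.

Lemma output_nth s l : output s = l -> s.2 0 = size l /\ forall i, i < size l -> s.2 i.+1 = nth 0 l i.
Proof.
move=> <-; rewrite /output size_map size_iota; split=> // i Hi.
by rewrite (nth_map 0) ?size_iota // nth_iota.
Qed.

(** All phases before the last write only to registers 2 to 10 and to cells from [bb] on, so the
    input stays readable, and the outputs of the simulated programs survive the setting of
    registers. *)
Lemma run_ok M : input_at M -> (forall r, bb <= r -> M r = 0) ->
  exists M' : memory, M' 0 = nat_of_bool
      (accept constructive unique (states L) (m, idx p) (map idx lc) (map idx lp)) /\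
    phase K 11 (main_code K b QC QP permsE sizeE nthE startE nextE acceptE) M M'
      (main_time b permsE sizeE nthE startE nextE acceptE Y TC TP).
Proof.
move=> HM HM0.
have wP := computes_wf permsE_ok; have wS := computes_wf sizeE_ok.
have wN := computes_wf nthE_ok; have wSt := computes_wf startE_ok.
have wNx := computes_wf nextE_ok; have wA := computes_wf acceptE_ok.
have HKr : 40 + main_regs b permsE sizeE nthE startE nextE acceptE <= K by [].
rewrite /main_regs in HKr.
pose M1 := filled 0 M; pose M2 := filled 1 M1.
have I1 : input_at M1 by apply: input_at_fill.
have I2 : input_at M2 by apply: input_at_fill.
pose M3 := overlaid 0 (exec QC TC (init C)) M2.
pose M4 := overlaid 1 (exec QP TP (init C)) M3.
have I3 : input_at M3 by apply: input_at_overlaid.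
have I4 : input_at M4 by apply: input_at_overlaid.
have C2 a : M2 (cell bb 0 a) = (init C).2 a.
  rewrite /M2 /filled (fill_mem_other _ _ _ (sim_cellsE 1)); last by move=> a'; apply: cell_neq.
  by apply: filled_init; left.
have C3 a : M3 (cell bb 1 a) = (init C).2 a.
  rewrite /M3 overlaid_other //; last by move=> a'; apply: cell_neq.
  apply: filled_init; right=> a'; rewrite /M1 /filled (fill_mem_other _ _ _ (sim_cellsE 0)).
    by apply: HM0; rewrite /cell -addnA leq_addr.
  by move=> a''; apply: cell_neq.
have [oC0 oC] := output_nth outC; have [oP0 oP] := output_nth outP.
have O0 : sim_output 0 lc M4.
  have H a : M4 (cell bb 0 a) = (exec QC TC (init C)).2 a.
    rewrite /M4 overlaid_other //; last by move=> a'; apply: cell_neq.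
    by rewrite /M3 overlaid_cell.
  by split=> [|i Hi]; rewrite H ?oC0 ?oC.
have O1 : sim_output 1 lp M4.
  have H a : M4 (cell bb 1 a) = (exec QP TP (init C)).2 a by rewrite /M4 overlaid_cell.
  by split=> [|i Hi]; rewrite H ?oP0 ?oP.
have sim_upd j l Mx i v : i < 11 -> sim_output j l Mx -> sim_output j l (upd Mx i v).
  move=> Hi [Ha Hb]; have Hne a : cell bb j a != i.
    by have := K_le_bb; move: Hi K12; rewrite /cell; clear; lia.
  by split=> [|i' Hi']; rewrite upd_neq ?Ha ?Hb.
pose (M5 := upd M4 2 m).
pose (M6 := upd M5 3 (enc (perms m))).
pose (M7 := upd M6 4 (size (perms m))).
pose (M8 := upd M7 5 (size Es)).
pose (M9 := upd M8 6 L).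
pose (M10 := upd M9 7 (enc (states L))).
pose (M11 := upd M10 8 (enc (map idx lc))).
pose (M12 := upd M11 9 (enc (map idx lp))).
pose (M13 := upd M12 10 (idx p)).
have I5 : input_at M5 by apply: input_at_upd.
have I6 : input_at M6 by apply: input_at_upd.
have I7 : input_at M7 by apply: input_at_upd.
have I8 : input_at M8 by apply: input_at_upd.
have I9 : input_at M9 by apply: input_at_upd.
have I10 : input_at M10 by apply: input_at_upd.
have I11 : input_at M11 by apply: input_at_upd.
have I12 : input_at M12 by apply: input_at_upd.
have O10 : sim_output 0 lc M10 by do 6 (apply: (sim_upd); first by []).
have O11 : sim_output 1 lp M11 by do 7 (apply: (sim_upd); first by []).
exists (upd M13 0 (accept constructive unique (states L) (m, idx p) (map idx lc) (map idx lp))).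
split=> //; rewrite /main_code /main_time.
apply: (phase_seq (M2 := M1)); first by apply: phase_fill_ev => //; move: HKr; clear; lia.
apply: (phase_seq (M2 := M2)); first by apply: phase_fill_ev => //; move: HKr; clear; lia.
apply: (phase_seq (M2 := M3)).
  apply: phase_sim => //; first by move: HKr; clear; lia.
  - exact: K_le_bb.
  - by case: I2.
apply: (phase_seq (M2 := M4)).
  apply: phase_sim => //; first by move: HKr; clear; lia.
  - exact: K_le_bb.
  - by case: I3.
apply: (phase_seq (M2 := M5)).
  apply: phase_set_ev; [by []|by []|by move: HKr; clear; lia|].
  rewrite -[in X in ev _ _ _ X](_ : nth 0 x 0 = m); last by rewrite input_head.
  by apply: ev_input => //; exact: size_x_gt0.
apply: (phase_seq (M2 := M6)).
  apply: phase_set_ev; [by []|by rewrite /= wP|by move: HKr; clear; lia|].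
  by apply: (ev_call (x := m) permsE_ok); [exact: ev_glb | exact: permsEY].
apply: (phase_seq (M2 := M7)).
  apply: phase_set_ev; [by []|by rewrite /= wS|by move: HKr; clear; lia|].
  by apply: (ev_call (x := perms m) sizeE_ok); [exact: ev_glb | exact: sizeEY].
apply: (phase_seq (M2 := M8)).
  apply: phase_set_ev; [by []|by []|by move: HKr; clear; lia|].
  by rewrite -input_nv; apply: ev_input => //; rewrite size_input; clear; lia.
apply: (phase_seq (M2 := M9)).
  apply: phase_set_ev; [by []|by rewrite /= /multE /strideE; case: (b)|by move: HKr; clear; lia|].
  by rewrite HL; apply: ev_lg; [apply: ev_total | rewrite -HL].
apply: (phase_seq (M2 := M10)).
  apply: phase_set_ev; [by []| |by move: HKr; clear; lia|exact: ev_states].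
  by rewrite /= /strideE; case: (b); rewrite /= wN wSt wNx.
apply: (phase_seq (M2 := M11)).
  apply: phase_set_ev; [by []|by []|by move: HKr; clear; lia|].
  by apply: ev_tau.
apply: (phase_seq (M2 := M12)).
  apply: phase_set_ev; [by []|by []|by move: HKr; clear; lia|].
  by apply: ev_pi.
apply: (phase_seq (M2 := M13)).
  apply: phase_set_ev; [by []|by []|by move: HKr; clear; lia|].
  apply: ev_index => //; rewrite -[in X in ev _ _ _ X]input_p.
  by apply: ev_input => //; rewrite size_input; clear; lia.
apply: phase_set_ev; [by []|by rewrite /= wA|by move: HKr; clear; lia|].
apply: ev_decide => //; first exact: states_le.
  by apply: index_list_le => //; rewrite lc_size leq_addr.
by apply: index_list_le => //; apply: leq_trans lp_size (leq_addl _ _).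
Qed.

Lemma voters_votes : all (is_vote C) (voters_of Es).
Proof.
apply/allP => v /flattenP [s /mapP [vm Hvm ->]]; rewrite mem_nseq => /andP[_ /eqP ->].
by apply: (allP HE); rewrite map_f.
Qed.

Lemma size_voters : size (voters_of Es) <= total.
Proof.
rewrite /voters_of size_flatten /shape -map_comp sumnE big_map /total.
apply: leq_trans (leq_addl _ _); apply: leq_sum => vm _.
by rewrite /= size_nseq.
Qed.

Lemma accept_bribery tbc tbp : valid_tbc tbc -> valid_tbp tbp ->
  accept constructive unique (states L) (m, idx p) (map idx (tbc C))
    (map idx (flatten [seq [:: q.1; q.2] | q <- tbp C])) <->
  bribery_yes tbc tbp constructive unique C (voters_of Es) p k.
Proof.
move=> Hc Hp; rewrite (bribery_states k Hc Hp uC pC voters_votes _ _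
  (leq_ltn_trans size_voters totalL)) /accept /=.
have -> : pairup (map idx (flatten [seq [:: q.1; q.2] | q <- tbp C])) = pi_of tbp C.
  by rewrite map_flatten -map_comp -[RHS]pairup_flatten /pi_of -map_comp.
split=> [/hasP [s /mem_states [y [Hy ->]] Hg]|[y [Hy Hg]]]; first by exists y.
by apply/hasP; exists (final_state C (voters_of Es) k y) => //; apply/mem_states; exists y.
Qed.

End Evaluation.

(** * Assembling the algorithm *)

Definition poly_bounded (T : nat -> nat) : Prop :=
  exists d, forall Y, 16 <= Y -> T Y <= Y ^ d.

Lemma poly_bounded_pow k : poly_bounded (fun Y => Y ^ k).
Proof. by exists k. Qed.

Lemma poly_bounded_id : poly_bounded (fun Y => Y).
Proof. by exists 1 => Y _; rewrite expn1. Qed.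

Lemma leq_exp_base a b e : a <= b -> a ^ e <= b ^ e.
Proof. by move=> ab; elim: e => // e IH; rewrite !expnS leq_mul. Qed.

Lemma poly_bounded_cst c : poly_bounded (fun _ => c).
Proof.
exists c => Y HY; apply: leq_trans (ltnW (ltn_expl c (isT : 1 < 2))) _.
by apply: leq_exp_base; lia.
Qed.

Lemma poly_bounded_mul T T' : poly_bounded T -> poly_bounded T' ->
  poly_bounded (fun Y => T Y * T' Y).
Proof.
by move=> [d H] [d' H']; exists (d + d') => Y HY; rewrite expnD leq_mul ?H ?H'.
Qed.

Lemma poly_bounded_add T T' : poly_bounded T -> poly_bounded T' ->
  poly_bounded (fun Y => T Y + T' Y).
Proof.
move=> [d H] [d' H']; exists (d + d' + 1) => Y HY; rewrite addn1 expnS.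
have Y0 : 0 < Y by lia.
have := H Y HY; have := H' Y HY.
have : Y ^ d <= Y ^ (d + d') by rewrite leq_pexp2l // leq_addr.
have : Y ^ d' <= Y ^ (d + d') by rewrite leq_pexp2l // leq_addl.
have : 2 * Y ^ (d + d') <= Y * Y ^ (d + d') by rewrite leq_mul2r; apply/orP; right; lia.
by lia.
Qed.

Ltac poly_tac := repeat first
  [ apply: poly_bounded_cst | apply: poly_bounded_id | apply: poly_bounded_pow
  | apply: poly_bounded_add | apply: poly_bounded_mul ].

(** * Comparison with the size of the input *)

Lemma bits_gt0 n : 0 < bits n.
Proof. by []. Qed.

Lemma sumn_lt_exp (x : seq nat) : sumn x < 2 ^ sumn [seq bits n | n <- x].
Proof.
elim: x => //= a x IH; rewrite expnD.
have Ha : a < 2 ^ bits a by apply: trunc_log_ltn.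
by move: (2 ^ bits a) (2 ^ sumn _) Ha IH => u v; nia.
Qed.

Lemma size_enc_size (x : seq nat) : size x < enc_size x.
Proof.
rewrite /enc_size ltnS; elim: x => //= a x IH.
by have := bits_gt0 a; lia.
Qed.

Lemma sumn_enc_size (x : seq nat) : lg (sumn x) <= enc_size x.
Proof.
rewrite -lgP; apply: leq_trans (sumn_lt_exp x) _.
by rewrite leq_exp2l // /enc_size.
Qed.

Lemma enc_size_candidates b (C : seq nat) Es p k : enc_size C <= enc_size (input_of b C Es p k).
Proof.
rewrite /enc_size /input_of ltnS !map_cat !sumn_cat.
by apply: leq_trans (leq_addl _ _); apply: leq_addr.
Qed.

Lemma lg_mono a b : a <= b -> lg a <= lg b.
Proof. by move=> ab; rewrite -lgP; apply: leq_ltn_trans ab _; rewrite lgP. Qed.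

(** Where multiplicities are not part of the input they are all 1, and their sum is [size Es], which
    is itself one of the input numbers. *)
Lemma total_le_sumn b C (Es : seq (seq nat * nat)) p k :
  (~~ b -> all (fun vm => vm.2 == 1) Es) ->
  total Es k <= sumn (input_of b C Es p k).
Proof.
move=> Hb; rewrite /input_of !sumn_cat /= /total.
suff : \sum_(vm <- Es) vm.2 <= size Es +
    sumn (flatten [seq vm.1 ++ (if b then [:: vm.2] else [::]) | vm <- Es]).
  by move: (\sum_(vm <- _) _) (sumn (flatten _)); clear; lia.
case: b Hb => [_|/(_ isT)]; elim: Es => [|vm s IH] /=; rewrite ?big_nil // ?big_cons.
  by rewrite !sumn_cat /=; lia.
by case/andP=> /eqP -> /IH; rewrite sumn_cat; lia.
Qed.

(** Each entry takes up at least one number, because votes are nonempty once [p] is a candidate. *)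
Lemma size_entries b (C : seq nat) (Es : seq (seq nat * nat)) (p k : nat) : p \in C -> all (is_vote C) (map fst Es) ->
  size Es <= size (input_of b C Es p k).
Proof.
move=> pC HE; rewrite /input_of !size_cat /= size_flatten /shape -map_comp.
apply: leq_trans (leq_addl 1 _) _; rewrite add1n ltnS.
suff : size Es <= sumn [seq (size \o (fun vm => vm.1 ++ (if b then [:: vm.2] else [::]))) i | i <- Es].
  by move: (sumn _); clear; lia.
have C0 : 0 < size C by case: (C) pC.
elim: Es HE => //= vm s IH /andP[/perm_size Hv /IH Hs].
by rewrite size_cat Hv -add1n leq_add // addn_gt0 C0.
Qed.

Lemma size_cpairs C : size (cpairs C) <= size C * size C.
Proof.
have H s : sumn [seq size [seq b <- C | a < b] | a <- s] <= size s * size C.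
  elim: s => //= a s IH; rewrite mulSn leq_add //.
  by rewrite size_filter count_size.
by rewrite size_allpairs_dep; exact: H.
Qed.

Section Program.
Variables (tbc : seq nat -> seq nat) (tbp : seq nat -> seq (nat * nat)).
Hypotheses (Vc : valid_tbc tbc) (Vp : valid_tbp tbp).
Hypotheses (Fc : feasible_tbc tbc) (Fp : feasible_tbp tbp).
Variables (b constructive unique : bool).

(* A bound on the codes of all lists the program builds. *)
Definition list_bound (m : nat) : nat :=
  2 ^ (m.+1 * (m + 2 * (m * m))) + 2 ^ (2 * (size (perms m)).+1) + enc (perms m) +
  (enc (start_states m) + enc (words (width m + width m + 1) (size (labels m)))) + m.

Definition triple_bound (m : nat) : nat :=
  cpair (cpair (list_bound m) (cpair (list_bound m) (list_bound m))) (list_bound m).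

Definition code_bound (m : nat) : nat := cpair (triple_bound m) (triple_bound m).

Lemma prf_code_bound : prf code_bound.
Proof.
have Hl : prf list_bound.
  rewrite /list_bound; apply: prf_add; last by prf_tac.
  apply: prf_add.
    apply: prf_add; first by prf_tac.
    exact: prf_enc prf_perms.
  apply: prf_add; first exact: prf_enc prf_start_states.
  by apply: prf_enc; apply: (prf_ap2 prf_words); prf_tac.
have Hp (f f' : nat -> nat) : prf f -> prf f' -> prf (fun m => cpair (f m) (f' m)).
  exact: prf_op2 prim2_pair.
have Ht : prf triple_bound by apply: (Hp) => //; apply: (Hp) => //; apply: (Hp).
exact: Hp.
Qed.

(** Both input models are covered at once: the flag [b] is fixed when the code is generated and
    decides only how an entry is read. *)
Theorem bribery_program : exists (P : program) (f : nat -> nat) (c : nat),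
  computable_fun f /\ forall (C : seq nat) (Es : seq (seq nat * nat)) (p k : nat), uniq C -> p \in C -> all (is_vote C) (map fst Es) ->
    (~~ b -> all (fun vm => vm.2 == 1) Es) ->
    let x := input_of b C Es p k in
    let s := exec P (f (size C) * enc_size x ^ c) (init x) in
    halted P s /\ (accepts s <-> bribery_yes tbc tbp constructive unique C (voters_of Es) p k).
Proof.
have [QC [cC HC]] := Fc; have [QP [cP HP]] := Fp.
have [permsE permsE_ok] := prf_perms.
have [sizeE sizeE_ok] : prf (fun s : seq (seq nat) => size s) by prf_tac.
have [nthE nthE_ok] : prf (fun z : seq (seq nat) * nat => nth [::] z.1 z.2) by prf_tac.
have [startE startE_ok] := prf_start_states.
have [nextE nextE_ok] := prf_next_states.
have [acceptE acceptE_ok] := prf_accept constructive unique.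
have [bP [RP MP IP HbP]] := computes_bound permsE_ok.
have [bS [RS MS IS HbS]] := computes_bound sizeE_ok.
have [bN [RN MN IN HbN]] := computes_bound nthE_ok.
have [bT [RT MT IT HbT]] := computes_bound startE_ok.
have [bX [RX MX IX HbX]] := computes_bound nextE_ok.
have [bA [RA MA IA HbA]] := computes_bound acceptE_ok.
have [bR [RR MR IR HbR]] := @pure2_bound pairE isT isT.
pose K := 40 + main_regs b permsE sizeE nthE startE nextE acceptE.
(* Sum of all bounds depending on [m] only: 16 for [cost_degree], the loops over candidates, pairs
   and votes, and the costs of the pure calls on arguments with codes up to [code_bound m]. *)
pose G m := 16 + (m.+1 + (2 * (m * m) + (size (perms m) + (bP (code_bound m) +
  (bS (code_bound m) + (bN (code_bound m) + (bT (code_bound m) + (bX (code_bound m) +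
  (bA (code_bound m) + bR (code_bound m)))))))))).
have RG : prf G.
  have Hc (bb : nat -> nat) : prf bb -> prf (fun m => bb (code_bound m)).
    by move=> Hb; apply: (prf_comp (g := bb)) Hb prf_code_bound.
  apply: prf_add; first by prf_tac.
  apply: prf_add; first by prf_tac.
  apply: prf_add; first by prf_tac.
  apply: prf_add; first by prf_tac.
  by do 6 (apply: prf_add; first exact: Hc); exact: Hc.
pose T Y := size (prelude K) + main_time b permsE sizeE nthE startE nextE acceptE Y
  (cC * Y ^ cC + cC) (cP * Y ^ cP + cP).
have [d Hd] : poly_bounded T by rewrite /T /main_time /fill_time; poly_tac.
pose code := main_code K b QC QP permsE sizeE nthE startE nextE acceptE.
pose P := prelude K ++ code (size (prelude K)) ++ [:: IHalt].
exists P, (fun m => G m ^ d), d; split; first by apply: prf_computable; apply: prf_expn.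
move=> C Es p k uC pC HE Hb1 x s.
(* A product rather than a sum: it dominates both positive factors, and [Y ^ d] splits exactly into
   [G m ^ d * Z ^ d]. *)
pose m := size C; pose Z := enc_size x; pose Y := G m * Z.
have Z0 : 0 < Z by [].
have GY : G m <= Y by rewrite /Y leq_pmulr.
have ZY : Z <= Y by rewrite /Y leq_pmull.
have HGm : G m = G (size C) by [].
have Y16 : 16 <= Y by apply: leq_trans GY; rewrite /G; clear; lia.
have [BP [BS [BN [BT [BX [BA BR]]]]]] : bP (code_bound m) <= Y /\ bS (code_bound m) <= Y /\
    bN (code_bound m) <= Y /\ bT (code_bound m) <= Y /\ bX (code_bound m) <= Y /\
    bA (code_bound m) <= Y /\ bR (code_bound m) <= Y.
  by move: GY; rewrite /G; clear; lia.
have mY : size C + 1 <= Y by move: GY; rewrite /G /m; clear; lia.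
have mmY : 2 * (size C * size C) <= Y by move: GY; rewrite /G /m; clear; lia.
have permsY : size (perms (size C)) <= Y by move: GY; rewrite /G /m; clear; lia.
pose N := list_bound m; pose N4 := triple_bound m.
have NN : cpair N N <= N4 by apply: leq_cpair => //; apply: ltnW; apply: cpair_ltl.
have N4C : N4 <= code_bound m by apply: ltnW; apply: cpair_ltl.
have NN4 : N <= N4 by apply: leq_trans NN; apply: ltnW; apply: cpair_ltl.
have NC : N <= code_bound m by apply: leq_trans NN4 N4C.
have NN2 : cpair (cpair N N) N <= N4.
  by apply: leq_cpair => //; apply: leq_cpair => //; apply: ltnW; apply: cpair_ltl.
have [mN [N1 [N2 [N3 N5]]]] : m <= N /\ 2 ^ (m.+1 * (m + 2 * (m * m))) <= N /\
    2 ^ (2 * (size (perms m)).+1) <= N /\ enc (perms m) <= N /\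
    enc (start_states m) + enc (words (width m + width m + 1) (size (labels m))) <= N.
  by rewrite /N /list_bound; clear; lia.
have size_x : size x <= Y by apply: leq_trans ZY; apply: ltnW; apply: size_enc_size.
have K12 : 11 < K by rewrite /K; clear; lia.
have x0 : 0 < size x by rewrite /x.
have pairY4 M u v : u <= N4 -> v <= N4 -> cost K M pairE [:: u; v] <= Y.
  move=> Hu Hv; apply: leq_trans BR; apply: HbR; first exact: leq_trans Hu N4C.
  exact: leq_trans Hv N4C.
pose TC := cC * enc_size C ^ cC + cC; pose TP := cP * enc_size C ^ cP + cP.
have [haltC outC] := HC C uC; have [haltP outP] := HP C uC.
have EC : enc_size C <= Y by apply: leq_trans ZY; apply: enc_size_candidates.
pose L := lg (total Es k).
have totalL : total Es k < 2 ^ L by rewrite lgP.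
have LY : L <= Y.
  apply: leq_trans ZY; apply: leq_trans (sumn_enc_size x).
  by apply: lg_mono; apply: total_le_sumn.
pose lp := flatten [seq [:: q.1; q.2] | q <- tbp C].
have lp_size : size lp <= 2 * (size C * size C).
  have -> : size lp = 2 * size (tbp C).
    by rewrite /lp; elim: (tbp C) => //= q l ->; rewrite mulnS.
  rewrite leq_mul2l /=; apply: leq_trans (size_cpairs C).
  by rewrite -(perm_size (Vp uC)) size_map.
have lp_sub : {subset lp <= C}.
  move=> a /flattenP [l /mapP [q Hq ->]].
  have /andP[H1 H2] := tbp_mem Vp uC Hq.
  by rewrite !inE => /orP[] /eqP ->.
have [M0 M1 M2 M3 M4] := prelude_ok (ltnW (leq_trans (isT : 2 < 12) K12)) x0.
have [M' [M'0 Hph]] : exists M' : memory, M' 0 = nat_of_bool (accept constructive unique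
    (states C Es k L L) (m, index p C) (map (index^~ C) (tbc C)) (map (index^~ C) lp)) /\
    phase K 11 code (straight (prelude K) (init x).2) M'
      (main_time b permsE sizeE nthE startE nextE acceptE Y TC TP).
  apply: (@run_ok K Y x b C Es p k erefl uC pC HE Hb1 K12 mY N _ mN _ _ L LY totalL _ N3 permsY
    nthE startE nextE nthE_ok _ startE_ok nextE_ok _ N5 _ _ mmY constructive unique acceptE N4
    acceptE_ok (leqnn _) pairY4 _ permsE sizeE permsE_ok sizeE_ok _ _ QC QP TC TP (tbc C) lp
    haltC outC haltP outP _ _ lp_size lp_sub erefl Y16 (leqnn _)) => //.
  - by move=> M u v Hu Hv; apply: pairY4; [exact: leq_trans Hu NN4 | exact: leq_trans Hv NN4].
  - by move=> l Hl Hs; apply: leq_trans N1; apply: ltnW; apply: seq_enc_lt.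
  - by apply: leq_trans size_x; apply: size_entries.
  - by move=> l Hl Hs; apply: leq_trans N2; apply: ltnW; apply: seq_enc_lt.
  - move=> M env i Hi; apply: leq_trans BN.
    have [|_ H] := HbN (perms m, i) (code_bound m); last exact: H.
    apply: leq_trans N4C; apply: leq_trans NN; apply: leq_cpair => //.
    exact: leq_trans (ltnW Hi) (leq_trans (size_enc _) N3).
  - by move=> M env; apply: leq_trans BT; have [_ H] := HbT m (code_bound m) (leq_trans mN NC); apply: H.
  - move=> M u v Hu Hv; apply: pairY4; first exact: leq_trans Hu NN.
    exact: leq_trans Hv NN4.
  - move=> M env S sg HS Hsg; apply: leq_trans BX.
    have [|_ H] := HbX (m, S, sg) (code_bound m); last exact: H.
    by apply: leq_trans N4C; apply: leq_trans NN2; apply: leq_cpair => //; apply: leq_cpair.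
  - move=> M env z Hz; apply: leq_trans BA.
    have [|_ H] := HbA z (code_bound m); last exact: H.
    by apply: leq_trans Hz _; apply: leq_cpair.
  - by move=> M env; apply: leq_trans BP; have [_ H] := HbP m (code_bound m) (leq_trans mN NC); apply: H.
  - move=> M env; apply: leq_trans BS.
    by have [_ H] := HbS (perms m) (code_bound m) (leq_trans N3 NC); apply: H.
  - exact: perm_size (Vc uC).
  - by move=> a; rewrite (perm_mem (Vc uC)).
have : code_at P 0 P by [].
rewrite {2}/P => /code_at_cat [Hpre] /code_at_cat [Hcode] /code_at_cons [Hhalt _].
have [t [m' [Ht Hx Hm']]] := Hph P (size (prelude K)) _ Hcode (fun _ _ => erefl).
have Hrun : exec P (size (prelude K) + t) (init x) =
    (size (prelude K) + size (code (size (prelude K))), m').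
  by rewrite execD [init x]surjective_pairing exec_straight ?straight_prelude // Hx.
have Hh : halted P (exec P (size (prelude K) + t) (init x)).
  by move: Hhalt; rewrite add0n Hrun /halted [fst _]/= => ->.
have HT : size (prelude K) + t <= G (size C) ^ d * enc_size x ^ d.
  rewrite -expnMn; apply: leq_trans (Hd Y Y16); rewrite /T leq_add2l; apply: leq_trans Ht _.
  have HTC : TC <= cC * Y ^ cC + cC.
    by rewrite leq_add2r leq_mul2l leq_exp_base ?orbT.
  have HTP : TP <= cP * Y ^ cP + cP.
    by rewrite leq_add2r leq_mul2l leq_exp_base ?orbT.
  by rewrite /main_time; move: HTC HTP; clear; lia.
rewrite /s (exec_halted_le HT Hh); split=> //.
rewrite Hrun /accepts /= -(Hm' 0 isT) M'0 eqb0 negbK.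
exact: accept_bribery.
Qed.

End Program.

Theorem theorem2 (tbc : seq nat -> seq nat) (tbp : seq nat -> seq (nat * nat)) :
  valid_tbc tbc -> valid_tbp tbp -> feasible_tbc tbc -> feasible_tbp tbp ->
  forall constructive unique : bool,
    FPT ns_wf ns_enc (fun I => size (ns_C I)) (ns_yes tbc tbp constructive unique) /\
    FPT s_wf s_enc (fun I => size (s_C I)) (s_yes tbc tbp constructive unique).
Proof.
move=> Vc Vp Fc Fp constructive unique; split.
  have [P [f [c [Hf H]]]] := bribery_program Vc Vp Fc Fp false constructive unique.
  exists P, f, c; split=> // -[C V p k] [/= uC pC HV].
  (* Each listed vote becomes an entry of multiplicity 1; equal votes remain separate entries. *)
  have Ev : voters_of [seq (v, 1) | v <- V] = V by elim: (V) => //= v s {2}<-.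
  have Ei : input_of false C [seq (v, 1) | v <- V] p k = ns_enc (NSInst C V p k).
    rewrite /input_of /ns_enc /= size_map; congr (_ :: _ ++ [:: _, _, _ & _]).
    by elim: (V) => //= v s ->; rewrite cats0.
  have := H C [seq (v, 1) | v <- V] p k uC pC; rewrite Ei Ev -map_comp map_id.
  apply=> // _; by rewrite all_map; apply/allP.
have [P [f [c [Hf H]]]] := bribery_program Vc Vp Fc Fp true constructive unique.
exists P, f, c; split=> // -[C V p k] [/= uC pC HV _ _].
exact: (H C V p k uC pC HV).
Qed.
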